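(* Let $\mathcal{A}$ be a strongly maximal TAF algebra. Then the triple $(\Omega_{\mathcal{A}}/\!\sim,\mathcal{T},\circ)$ forms a topological semigroupoid which is isomorphic to the fundamental relation $\operatorname{Spec}(\mathcal{A})$ of $\mathcal{A}$.
   Context: Strongly maximal TAF algebra: for each $i\in\mathbb{N}$, let $\mathfrak{A}_i$ be a finite direct sum of full complex matrix algebras and $\mathcal{A}_i\subseteq\mathfrak{A}_i$ the corresponding direct sum of the upper triangular matrix subalgebras. Let $\varphi_i:\mathfrak{A}_i\to\mathfrak{A}_{i+1}$ be an injective $*$-homomorphism with $\varphi_i(\mathcal{A}_i)\subseteq\mathcal{A}_{i+1}$ (the embedding of $\mathcal{A}_i$ is $*$-extendable) which is regular, i.e. maps each matrix unit to a sum of matrix units. Then $\mathcal{A}=\varinjlim(\mathcal{A}_i,\varphi_i)$ is the norm closure of $\bigcup_i\mathcal{A}_i$ inside the AF C*-algebra $\mathfrak{A}=\varinjlim(\mathfrak{A}_i,\varphi_i)$. $\mathcal{C}_i$ denotes the natural system of matrix units of $\mathcal{A}_i$. The diagonal of $\mathcal{A}$ is $\mathcal{A}\cap\mathcal{A}^*$. The set $\Omega_{\mathcal{A}}$: a nest representation is a bounded homomorphism $\rho:\mathcal{A}\to B(\mathcal{H})$, $\mathcal{H}$ a Hilbert space, whose lattice $\operatorname{Lat}\rho(\mathcal{A})$ of closed invariant subspaces is linearly ordered. $\operatorname{nrep}_*(\mathcal{A})$ is the collection of nest representations of $\mathcal{A}$ that are $*$-representations on $\mathcal{A}\cap\mathcal{A}^*$.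 For $\rho\in\operatorname{nrep}_*(\mathcal{A})$ and vectors $g,h\in\mathcal{H}$ whose spans $[g],[h]$ are atoms (minimal intervals $N\ominus M$, $M\subsetneq N$ consecutive elements) of $\operatorname{Lat}\rho(\mathcal{A})$, put $\omega^{(\rho)}_{g,h}(a)=\langle\rho(a)g,h\rangle$, $a\in\mathcal{A}$. $\Omega_{\mathcal{A}}$ is the collection of all non-zero linear forms on $\mathcal{A}$ of this type, and $\omega\sim\omega'$ iff $\omega=\lambda\omega'$ for some non-zero scalar $\lambda\in\mathbb{C}$. The topology $\mathcal{T}$ on $\Omega_{\mathcal{A}}/\!\sim$ is that of the metric $$d([\omega_1],[\omega_2])=\sum_{n=1}^\infty\frac{1}{2^n}\left|\frac{|\omega_1(a_n)|}{\|\omega_1\|}-\frac{|\omega_2(a_n)|}{\|\omega_2\|}\right|,$$ where $\{a_n\}_{n\ge1}$ is a dense subset of $\mathcal{A}$; $[\omega_k]\to[\omega]$ iff $|\omega_k(a)|/\|\omega_k\|\to|\omega(a)|/\|\omega\|$ for all $a\in\mathcal{A}$, so $\mathcal{T}$ does not depend on the choice of $\{a_n\}$. The partial operation $\circ$: for $\omega^{(\rho)}_{g,h},\omega^{(\rho')}_{g',h'}\in\Omega_{\mathcal{A}}$ with $\rho=\rho'$ and $[g]=[h']$, one puts $\omega^{(\rho)}_{g,h}\circ\omega^{(\rho')}_{g',h'}=\omega^{(\rho)}_{g',h}$. On $\Omega_{\mathcal{A}}/\!\sim$, two classes are composable if they have representatives composable in this sense, and the product is the class of the product of such representatives (well-definedness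 is part of the assertion). Fundamental relation (spectrum): $\operatorname{Spec}(\mathcal{A})=\{\omega\in\mathcal{A}^{\#}:\|\omega\|=1,\ \omega(\bigcup_i\mathcal{C}_i)\subseteq\{0,1\}\}$ with the relative w*-topology of the Banach dual $\mathcal{A}^{\#}$. For $\omega\in\operatorname{Spec}(\mathcal{A})$ there is, for all large $i$, a unique $e_i\in\mathcal{C}_i$ with $\omega(e_i)=1$. The source $s(\omega)$ and range $r(\omega)$ are the elements of $\operatorname{Spec}(\mathcal{A})$ taking the value $1$ on $e_i^*e_i$, respectively on $e_ie_i^*$, for all large $i$. The product $\omega\circ\omega'$ is defined iff $s(\omega)=r(\omega')$, and then it is the element of $\operatorname{Spec}(\mathcal{A})$ taking the value $1$ on $e_ie_i'$ for all large $i$, where $e_i,e_i'\in\mathcal{C}_i$ are the matrix units with $\omega(e_i)=\omega'(e_i')=1$. A topological semigroupoid is a topological space with a partially defined associative operation that is continuous on the set of composable pairs; an isomorphism is a homeomorphism preserving composability in both directions and products.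
   Formalization: The dense sequence (a_n) defining the metric d is assumed to satisfy that the sum of ‖a_n‖/2^n is finite; for an arbitrary dense sequence the series for d may diverge or give a different topology. *)

(* Defs.v *)
From HB Require Import structures.
From mathcomp Require Import all_boot all_order all_algebra.
From mathcomp Require Import complex.
From mathcomp Require Import all_classical all_reals all_analysis.
Set Implicit Arguments.
Unset Strict Implicit.
Unset Printing Implicit Defensive.
Import Order.TTheory GRing.Theory Num.Theory numFieldNormedType.Exports.
Local Open Scope classical_set_scope.
Local Open Scope ring_scope.
Local Open Scope complex_scope.
Local Open Scope quotient_scope.

(* The norm of a normed module over [R[i]] takes its values in [R[i]];
   [rnorm] is the same norm seen as a real number. *)
Definition rnorm (R : realType) (V : normedZmodType R[i]) (x : V) : R :=
  complex.Re `|x|.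

(* C*-algebras, not assumed unital. *)
Record cstarAlgebra (R : realType) := CstarAlgebra {
  cs_space :> completeNormedModType R[i];
  cs_mul : {bilinear cs_space -> cs_space -> cs_space};
  cs_star : cs_space -> cs_space;
  cs_mulA : associative cs_mul;
  cs_star_semilinear : forall (c : R[i]) x y,
    cs_star (c *: x + y) = (Num.conj c) *: cs_star x + cs_star y;
  cs_starM : forall x y, cs_star (cs_mul x y) = cs_mul (cs_star y) (cs_star x);
  cs_starK : involutive cs_star;
  cs_norm_mul : forall x y, `|cs_mul x y| <= `|x| * `|y|;
  cs_norm_star : forall x, `|cs_mul (cs_star x) x| = `|x| ^+ 2 }.

(* [{dot U for theta}] is linear in the first variable, [theta]-linear in the
   second one. *)
Record hilbertSpace (R : realType) := HilbertSpace {
  hs_space :> completeNormedModType R[i];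
  hs_dot : {dot hs_space for Num.conj};
  hs_norm : forall x, `|x| ^+ 2 = hs_dot x x }.

(* The direct sum over [k : 'I_m] of the full matrix algebras of size
   [(n k).+1], with the componentwise operations. *)
Definition fdalg (R : realType) (m : nat) (n : 'I_m -> nat) : Type :=
  forall k : 'I_m, 'M[R[i]]_((n k).+1).

Section FiniteDimensional.
Variables (R : realType) (m : nat) (n : 'I_m -> nat).
Local Notation A := (fdalg R n).

HB.instance Definition _ := gen_eqMixin A.
HB.instance Definition _ := gen_choiceMixin A.

Let add (x y : A) : A := fun k => x k + y k.
Let opp (x : A) : A := fun k => - x k.
Let zero : A := fun k => 0.

Let addA : associative add.
Proof. by move=> x y z; apply: functional_extensionality_dep => k; exact: addrA. Qed.
Let addC : commutative add.
Proof. by move=> x y; apply: functional_extensionality_dep => k; exact: addrC. Qed.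
Let add0 : left_id zero add.
Proof. by move=> x; apply: functional_extensionality_dep => k; exact: add0r. Qed.
Let addN : left_inverse zero opp add.
Proof. by move=> x; apply: functional_extensionality_dep => k; exact: addNr. Qed.

HB.instance Definition _ := GRing.isZmodule.Build A addA addC add0 addN.

Let scale (c : R[i]) (x : A) : A := fun k => c *: x k.

Let scaleA c d x : scale c (scale d x) = scale (c * d) x.
Proof. by apply: functional_extensionality_dep => k; exact: scalerA. Qed.
Let scale1 : left_id 1 scale.
Proof. by move=> x; apply: functional_extensionality_dep => k; exact: scale1r. Qed.
Let scaleDr : right_distributive scale +%R.
Proof. by move=> c x y; apply: functional_extensionality_dep => k; exact: scalerDr. Qed.
Let scaleDl x : {morph scale^~ x : c d / c + d}.
Proof. by move=> c d; apply: functional_extensionality_dep => k; exact: scalerDl. Qed.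

HB.instance Definition _ :=
  GRing.Zmodule_isLmodule.Build R[i] A scaleA scale1 scaleDr scaleDl.

Definition fd_mul (x y : A) : A := fun k => x k *m y k.
Definition fd_star (x : A) : A := fun k => map_mx Num.conj (x k)^T.

Definition fd_upper : set A :=
  [set x | forall k (p q : 'I_(n k).+1), (q < p)%N -> x k p q = 0].

(* The index [Tagged _ (p, q)] at the tag [k] is that of the matrix unit with
   entry 1 at the place (p, q) of the k-th block. *)
Definition munit_index : finType :=
  {k : 'I_m & ('I_(n k).+1 * 'I_(n k).+1)%type}.

Definition munit (u : munit_index) : A := fun k => \matrix_(p, q)
  (Tagged (fun k => 'I_(n k).+1 * 'I_(n k).+1)%type (p, q) == u)%:R.

End FiniteDimensional.

Record taf_system (R : realType) := TafSystem {
  nblocks : nat -> nat;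
  bsize : forall i, 'I_(nblocks i) -> nat;
  emb : forall i, {linear fdalg R (@bsize i) -> fdalg R (@bsize i.+1)};
  embM : forall i x y, emb i (fd_mul x y) = fd_mul (emb i x) (emb i y);
  emb_star : forall i x, emb i (fd_star x) = fd_star (emb i x);
  emb_inj : forall i, injective (emb i);
  emb_upper : forall i x, fd_upper x -> fd_upper (emb i x);
  emb_regular : forall i u, exists V : {set munit_index (@bsize i.+1)},
    emb i (munit R u) = \sum_(v in V) munit R v }.

(* The C*-algebra inductive limit of a sequence of injective *-homomorphisms,
   determined up to isomorphism: an increasing union of copies of the
   algebras of the sequence, with dense union. *)
Record af_limit (R : realType) (S : taf_system R) := AfLimit {
  af_alg :> cstarAlgebra R;
  af_in : forall i, {linear fdalg R (@bsize R S i) -> af_alg};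
  af_inM : forall i x y,
    af_in i (fd_mul x y) = cs_mul af_alg (af_in i x) (af_in i y);
  af_in_star : forall i x, af_in i (fd_star x) = cs_star (af_in i x);
  af_in_inj : forall i, injective (af_in i);
  af_in_emb : forall i x, af_in i.+1 (emb S i x) = af_in i x;
  af_dense : closure (\bigcup_i range (af_in i)) = setT }.

Section TafAlgebra.
Variables (R : realType) (S : taf_system R) (L : af_limit S).

Definition taf_union : set L := \bigcup_i (af_in L i @` @fd_upper R _ _).
Definition taf_set : set L := closure taf_union.
Definition taf_pred : {pred L} := fun x => `[< taf_set x >].

Lemma taf_predE x : (x \in taf_pred) = `[< taf_set x >]. Proof. by []. Qed.

Lemma fd_upperM m (n : 'I_m -> nat) (x y : fdalg R n) :
  fd_upper x -> fd_upper y -> fd_upper (fd_mul x y).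
Proof.
move=> ux uy k p q qp; rewrite /fd_mul mxE big1// => r _.
have [rp|pr] := ltnP r p; first by rewrite ux// mul0r.
by rewrite uy ?mulr0// (leq_trans qp).
Qed.

Lemma taf_union_level i j x : (i <= j)%N -> fd_upper x ->
  exists2 y, fd_upper y & af_in L j y = af_in L i x.
Proof.
move=> ij ux; elim: j ij => [|j IH].
  by rewrite leqn0 => /eqP i0; subst i; exists x.
rewrite leq_eqVlt => /predU1P[ij|]; first by subst i; exists x.
rewrite ltnS => /IH[y uy yx]; exists (emb S j y); first exact: emb_upper.
by rewrite af_in_emb.
Qed.

Lemma taf_union_pair x y : taf_union x -> taf_union y -> exists i x' y',
  [/\ fd_upper x', fd_upper y', af_in L i x' = x & af_in L i y' = y].
Proof.
move=> [i _ [x' ux <-]] [j _ [y' uy <-]].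
have [x1 ux1 <-] := taf_union_level (leq_maxl i j) ux.
have [y1 uy1 <-] := taf_union_level (leq_maxr i j) uy.
by exists (maxn i j), x1, y1.
Qed.

Lemma taf_unionM x y : taf_union x -> taf_union y -> taf_union (cs_mul L x y).
Proof.
move=> /taf_union_pair/[apply] -[i [x' [y' [ux uy <- <-]]]].
by exists i => //; exists (fd_mul x' y'); [exact: fd_upperM|exact: af_inM].
Qed.

Lemma taf_union_linear (c : R[i]) x y :
  taf_union x -> taf_union y -> taf_union (c *: x + y).
Proof.
move=> /taf_union_pair/[apply] -[i [x' [y' [ux uy <- <-]]]].
exists i => //; exists (c *: x' + y'); last by rewrite linearP.
by move=> k p q qp; rewrite !mxE ux// uy// mulr0 addr0.
Qed.

Lemma closure_map (U V : topologicalType) (f : U -> V) (A : set U) (B : set V) :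
  continuous f -> (forall x, A x -> B (f x)) ->
  forall x, closure A x -> closure B (f x).
Proof.
move=> cf AB x Ax W /cf /Ax[y [Ay Wy]].
by exists (f y); split => //; exact: AB.
Qed.

Lemma bounded_op_continuous (f : L -> L) (M : R[i]) :
  linear f -> (forall x, `|f x| <= M * `|x|) -> 0 <= M -> continuous f.
Proof.
move=> lf fM M0; pose g : {linear L -> L} := HB.pack f
  (GRing.isLinear.Build _ _ _ _ _ lf).
apply: (@bounded_linear_continuous _ _ _ g); apply/bounded_funP => r.
exists (M * r) => x xr; apply: le_trans (fM _) _.
by rewrite ler_wpM2l.
Qed.

Lemma taf_setM x y : taf_set x -> taf_set y -> taf_set (cs_mul L x y).
Proof.
move=> xA yA.
have cr a : continuous (cs_mul L a).
  apply: (@bounded_op_continuous _ `|a|); last exact: normr_ge0.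
    by move=> c u v; rewrite linearPr.
  by move=> u; exact: cs_norm_mul.
have cl a : continuous (cs_mul L ^~ a).
  apply: (@bounded_op_continuous _ `|a|); last exact: normr_ge0.
    by move=> c u v; rewrite linearPl.
  by move=> u; rewrite mulrC; exact: cs_norm_mul.
rewrite /taf_set (closure_id (closure taf_union)).1; last exact: closed_closure.
apply: (closure_map (A := taf_union) (cr x)) yA => b bA.
by apply: (closure_map (A := taf_union) (cl b)) xA => a aA; exact: taf_unionM.
Qed.

Lemma taf_set_linear (c : R[i]) x y :
  taf_set x -> taf_set y -> taf_set (c *: x + y).
Proof.
move=> xA yA.
have cr a : continuous (fun b : L => c *: a + b).
  by move=> b; apply: cvgD; [exact: cvg_cst|exact: cvg_id].
have cl b : continuous (fun a : L => c *: a + b).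
  by move=> a; apply: cvgD; [apply: cvgZr; exact: cvg_id|exact: cvg_cst].
rewrite /taf_set (closure_id (closure taf_union)).1; last exact: closed_closure.
apply: (closure_map (A := taf_union) (cr x)) yA => b bA.
by apply: (closure_map (A := taf_union) (cl b)) xA => a aA; exact: taf_union_linear.
Qed.

Lemma taf_set0 : taf_set 0.
Proof.
apply: subset_closure; exists 0%N => //; exists 0; last exact: linear0.
by move=> k p q _; rewrite mxE.
Qed.

Lemma taf_submod_closed : submod_closed taf_pred.
Proof.
split; first by rewrite taf_predE; apply/asboolP; exact: taf_set0.
move=> c x y; rewrite !taf_predE => /asboolP xA /asboolP yA; apply/asboolP.
exact: taf_set_linear.
Qed.

HB.instance Definition _ :=
  GRing.isSubmodClosed.Build R[i] L taf_pred taf_submod_closed.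

Record taf : Type := Taf { taf_val : L; taf_valP : taf_val \in taf_pred }.

HB.instance Definition _ := [isSub for taf_val].
HB.instance Definition _ := [Choice of taf by <:].
HB.instance Definition _ := [SubChoice_isSubLmodule of taf by <:].

Lemma taf_mul_subproof (a b : taf) : cs_mul L (\val a) (\val b) \in taf_pred.
Proof.
have /asboolP aA := valP a; have /asboolP bA := valP b.
by apply/asboolP; exact: taf_setM.
Qed.

Definition taf_mul (a b : taf) : taf := Taf (taf_mul_subproof a b).

(* The matrix units of the i-th upper triangular algebra, as elements of the
   limit. *)
Definition munits (i : nat) : set taf :=
  [set a | exists2 u : munit_index (@bsize R S i),
     ((tagged u).1 <= (tagged u).2)%N & \val a = af_in L i (munit R u)].

End TafAlgebra.

Arguments munits {R S} L i.
Arguments taf_set {R S} L.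

Section Representations.
Variables (R : realType) (S : taf_system R) (L : af_limit S).
Local Notation A := (taf L).

(* Bounded homomorphisms into the algebra of bounded operators on a Hilbert
   space; [rep_bounded] entails that each operator [rep_op a] is bounded. *)
Record representation := Representation {
  rep_space : hilbertSpace R;
  rep_op :> A -> {linear rep_space -> rep_space};
  rep_linear : forall (c : R[i]) (a b : A) x,
    rep_op (c *: a + b) x = c *: rep_op a x + rep_op b x;
  rep_mul : forall (a b : A) x, rep_op (taf_mul a b) x = rep_op a (rep_op b x);
  rep_bounded : exists M : R, forall (a : A) x,
    rnorm (rep_op a x) <= M * rnorm (\val a) * rnorm x }.

Variable rho : representation.
Local Notation H := (rep_space rho).

Definition rep_lat : set (set H) := [set M | [/\ M 0,
  forall (c : R[i]) x y, M x -> M y -> M (c *: x + y),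
  closed M & forall a x, M x -> M (rho a x)]].

Definition nest_rep : Prop :=
  forall M N, rep_lat M -> rep_lat N -> M `<=` N \/ N `<=` M.

Definition star_on_diagonal : Prop := forall a b : A,
  \val b = cs_star (\val a) ->
  forall x y : H, hs_dot H (rho a x) y = hs_dot H x (rho b y).

Definition nrep_star : Prop := nest_rep /\ star_on_diagonal.

Definition line (g : H) : set H := [set c *: g | c in [set: R[i]]].

Definition ominus (N M : set H) : set H :=
  [set x | N x /\ forall y, M y -> hs_dot H x y = 0].

Definition lat_atom (E : set H) : Prop := exists N M, [/\ rep_lat N, rep_lat M,
  M `<` N, forall K, rep_lat K -> M `<=` K -> K `<=` N -> K = M \/ K = N
  & E = ominus N M].

Definition coef (g h : H) (a : A) : R[i] := hs_dot H (rho a g) h.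

End Representations.

Section Forms.
Variables (R : realType) (S : taf_system R) (L : af_limit S).
Local Notation A := (taf L).

Definition fnorm (w : A -> R[i]) : R :=
  sup [set rnorm (w a) | a in [set a : A | rnorm (\val a) <= 1]].

Definition dual_form (w : A -> R[i]) : Prop :=
  scalar w /\ exists M : R, forall a, rnorm (w a) <= M * rnorm (\val a).

Definition Omega : set (A -> R[i]) := [set w | (exists a, w a != 0) /\
  exists (rho : representation L) (g h : rep_space rho), [/\ nrep_star rho,
    lat_atom (line g), lat_atom (line h) & w = coef g h]].

Definition Omega_rel (w1 w2 : Omega) : bool := `[< exists2 c : R[i], c != 0 &
  forall a, \val w1 a = c * \val w2 a >].

Lemma Omega_rel_refl : reflexive Omega_rel.
Proof.
by move=> w; apply/asboolP; exists 1; [exact: oner_neq0|move=> a; rewrite mul1r].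
Qed.

Lemma Omega_rel_sym : symmetric Omega_rel.
Proof.
suff sym w1 w2 : Omega_rel w1 w2 -> Omega_rel w2 w1.
  by move=> w1 w2; apply/idP/idP; exact: sym.
move=> /asboolP[c c0 cw]; apply/asboolP; exists c^-1; first by rewrite invr_eq0.
by move=> a; rewrite cw mulKf.
Qed.

Lemma Omega_rel_trans : transitive Omega_rel.
Proof.
move=> w2 w1 w3 /asboolP[c c0 cw] /asboolP[d d0 dw]; apply/asboolP.
by exists (c * d); [rewrite mulf_neq0|move=> a; rewrite cw dw mulrA].
Qed.

Canonical Omega_equiv :=
  EquivRel Omega_rel Omega_rel_refl Omega_rel_sym Omega_rel_trans.

(* The graph of the partial operation on forms: [w = w1 o w2]. *)
Definition form_comp (w1 w2 w : A -> R[i]) : Prop :=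
  exists (rho : representation L) (g h g' h' : rep_space rho),
  [/\ nrep_star rho,
      [/\ lat_atom (line g), lat_atom (line h), lat_atom (line g')
        & lat_atom (line h')],
      w1 = coef g h, w2 = coef g' h' & line g = line h' /\ w = coef g' h].

(* The quotient of Omega, with the topology of the metric attached to the
   sequence [a]. *)
Definition Omega_quot (a : nat -> A) : Type := {eq_quot Omega_rel}.

Section Quotient.
Variable a : nat -> A.
Local Notation Q := (Omega_quot a).

HB.instance Definition _ := Choice.on Q.
HB.instance Definition _ := EqQuotient.on Q.

(* [|w (a n)| / fnorm w] does not depend on the representative [w] of its
   class. The sequence is indexed from 0, so that the weight of [a n] is
   1 / 2 ^ n.+1. The sum is computed in the extended reals; it is finite when
   the series of the |a n| / 2 ^ n.+1 converges. *)
Definition Omega_dist (p q : Q) : \bar R := (\sum_(0 <= n <oo)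
  (2^-1 ^+ n.+1 * `|rnorm (\val (repr p) (a n)) / fnorm (\val (repr p))
                  - rnorm (\val (repr q) (a n)) / fnorm (\val (repr q))|)%:E)%E.

Definition Omega_ball (p : Q) (e : R) : set Q :=
  [set q | (Omega_dist p q < e%:E)%E].

Let ball_center p (e : R) : 0 < e -> Omega_ball p e p.
Proof.
move=> e0; rewrite /Omega_ball/= /Omega_dist eseries0// => n _ _.
by rewrite subrr normr0 mulr0.
Qed.

Let ball_sym p q (e : R) : Omega_ball p e q -> Omega_ball q e p.
Proof.
rewrite /Omega_ball/=; congr (_ < _)%E; apply: eq_eseriesr => n _.
by rewrite distrC.
Qed.

Let ball_triangle p q r (e1 e2 : R) :
  Omega_ball p e1 q -> Omega_ball q e2 r -> Omega_ball p (e1 + e2) r.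
Proof.
rewrite /Omega_ball/= => pq qr; rewrite EFinD.
have t0 p' q' n : (0%N <= n)%N -> xpredT n -> (0 <= (2^-1 ^+ n.+1 *
    `|rnorm (\val (repr p') (a n)) / fnorm (\val (repr p'))
    - rnorm (\val (repr q') (a n)) / fnorm (\val (repr q'))|)%:E :> \bar R)%E.
  by move=> _ _; rewrite lee_fin mulr_ge0// exprn_ge0// invr_ge0.
apply: le_lt_trans (lteD pq qr); rewrite /Omega_dist -nneseriesD//.
apply: lee_nneseries => [n _ _|n _]; first exact: t0.
by rewrite -EFinD lee_fin -mulrDr ler_wpM2l ?exprn_ge0 ?invr_ge0// ler_distD.
Qed.

Let ent : set_system (Q * Q) := entourage_ Omega_ball.

HB.instance Definition _ := hasNbhs.Build Q (nbhs_ ent).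
HB.instance Definition _ := @Nbhs_isPseudoMetric.Build R Q ent erefl
  Omega_ball ball_center ball_sym ball_triangle erefl.

End Quotient.

Definition Spec : set {ptws A -> R[i]^o} := [set w | [/\ dual_form w, fnorm w = 1
  & forall i e, munits L i e -> w e = 0 \/ w e = 1]].

Definition spec_source (w s : Spec) : Prop := \forall i \near \oo,
  exists e d : A, [/\ munits L i e, \val w e = 1,
    \val d = cs_mul L (cs_star (\val e)) (\val e) & \val s d = 1].

Definition spec_range (w r : Spec) : Prop := \forall i \near \oo,
  exists e d : A, [/\ munits L i e, \val w e = 1,
    \val d = cs_mul L (\val e) (cs_star (\val e)) & \val r d = 1].

End Forms.

Arguments Omega {R S} L.
Arguments Spec {R S} L.

(* A partial operation given by its domain and its graph. *)
Record partial_op (X : Type) := PartialOp {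
  composable : X -> X -> Prop;
  composite : X -> X -> X -> Prop }.

(* Associativity: as soon as one of the three pairs of conditions "(x, y) and
   (y, z) composable", "(x, y) and (x o y, z) composable", "(y, z) and
   (x, y o z) composable" holds, so do the other ones, and
   (x o y) o z = x o (y o z). *)
Definition topological_semigroupoid (X : topologicalType) (P : partial_op X) :=
  exists op : X * X -> X, [/\
    forall x y, composable P x y -> forall z, composite P x y z <-> z = op (x, y),
    forall x y z, composable P x y -> composable P y z ->
      [/\ composable P (op (x, y)) z, composable P x (op (y, z))
        & op (op (x, y), z) = op (x, op (y, z))],
    forall x y z, composable P x y -> composable P (op (x, y)) z ->
      composable P y z,
    forall x y z, composable P y z -> composable P x (op (y, z)) ->
      composable P x y
  & {within [set p | composable P p.1 p.2], continuous op}].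

Definition semigroupoid_isomorphism (X Y : topologicalType)
    (P : partial_op X) (Q : partial_op Y) (f : X -> Y) : Prop := [/\
  exists g : Y -> X, [/\ cancel f g, cancel g f, continuous f & continuous g],
  forall x y, composable P x y <-> composable Q (f x) (f y)
  & forall x y z, composable P x y ->
      (composite P x y z <-> composite Q (f x) (f y) (f z))].

Section Operations.
Variables (R : realType) (S : taf_system R) (L : af_limit S).

Definition Omega_op (a : nat -> taf L) : partial_op (Omega_quot a) :=
  PartialOp
    (fun p q => exists w1 w2 : Omega L, exists w, [/\ \pi_(Omega_quot a) w1 = p,
      \pi_(Omega_quot a) w2 = q & form_comp (\val w1) (\val w2) w])
    (fun p q r => exists w1 w2 w : Omega L, [/\ \pi_(Omega_quot a) w1 = p,
      \pi_(Omega_quot a) w2 = q, \pi_(Omega_quot a) w = r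
      & form_comp (\val w1) (\val w2) (\val w)]).

Definition Spec_op : partial_op (Spec L) :=
  PartialOp
    (fun w1 w2 => exists s, spec_source w1 s /\ spec_range w2 s)
    (fun w1 w2 w => \forall i \near \oo, exists e1 e2 : taf L,
      [/\ munits L i e1, munits L i e2, \val w1 e1 = 1, \val w2 e2 = 1
        & \val w (taf_mul e1 e2) = 1]).

End Operations.

(* Main.v *)
Require Import Defs.
From HB Require Import structures.
From mathcomp Require Import all_boot all_order all_algebra.
From mathcomp Require Import complex finmap ring lra.
From mathcomp Require Import all_classical all_reals all_analysis.
Set Implicit Arguments.
Unset Strict Implicit.
Unset Printing Implicit Defensive.
Import Order.TTheory GRing.Theory Num.Theory numFieldNormedType.Exports.
Local Open Scope classical_set_scope.
Local Open Scope ring_scope.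
Local Open Scope complex_scope.

(** In a nest representation, a vector spanning an atom is an eigenvector of the
diagonal, so at every level it is fixed by exactly one minimal diagonal
projection. The form of two such vectors thus takes a non-zero value at a single
matrix unit of each high level, and its normalisation lies in the spectrum: this
is the map from the classes of forms to [Spec L]. By the nest condition the
vectors fixed by the same minimal diagonal projections form a line; hence the
composition of forms is the multiplication of the matrix units carrying them.

Conversely a decreasing sequence of minimal diagonal projections gives a
representation on the square summable functions on its orbit. The orbit is
linearly ordered by the upper triangular matrix units, the invariant subspaces
are those of the functions supported by initial segments, and so every vector of
the canonical basis spans an atom: every element of the spectrum is a coefficient
of such a representation. *)

(** A nest representation is only assumed bounded, with an unknown constant, so norms of forms are
    computed in the limit algebra instead. There every matrix entry is dominated by the norm, hence
    a form that reads one entry with the factor c at all high levels has norm |c|. Dividing moduli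
    by the norm therefore removes exactly the scalar left free in a class. On the spectrum the
    values at matrix units are 0 or 1. Moduli lose no information there and values at distance less
    than 1 coincide, which reduces convergence to equalities at matrix units. In the converse
    direction one point of the orbit has a different name at each level. It is encoded by a
    functional on the limit, which does not depend on the level. The operators are given by finite
    matrices at each level, and they extend to the limit only once these matrices are bounded by the
    norm of the limit algebra. This bound is extracted from the C*-identity, by improving a crude
    constant again and again. The extension is then made by continuity for each vector
    separately. *)

Section SquareNorm.
Context {R : realType}.
Implicit Types (z w : R[i]).

Definition nsq z : R := complex.Re z ^+ 2 + complex.Im z ^+ 2.

Lemma nsqE z : (nsq z)%:C = `|z| ^+ 2.
Proof. exact: add_Re2_Im2. Qed.

Lemma nsq_ge0 z : 0 <= nsq z.
Proof. by rewrite addr_ge0// sqr_ge0. Qed.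

Lemma nsq_eq0 z : nsq z = 0 -> z = 0.
Proof.
move=> /eqP; rewrite paddr_eq0 ?sqr_ge0// !sqrf_eq0 => /andP[/eqP a /eqP b].
by apply/eqP; rewrite eq_complex a b !eqxx.
Qed.

Lemma rnormE (V : normedZmodType R[i]) (x : V) : `|x| = (rnorm x)%:C.
Proof. by rewrite RRe_real// normr_real. Qed.

Lemma rnorm_ge0 (V : normedZmodType R[i]) (x : V) : 0 <= rnorm x.
Proof. by rewrite -ler0c -rnormE. Qed.

Lemma rnorm_sqr z : rnorm z ^+ 2 = nsq z.
Proof. by apply: complexI; rewrite rmorphXn/= -rnormE nsqE. Qed.

Lemma normc_sqrt z : `|z| = (Num.sqrt (nsq z))%:C.
Proof. exact: normc_def. Qed.

End SquareNorm.

(** * The Hilbert space of square summable functions *)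

Section NonnegativeSums.
Context {R : realType} {T : choiceType}.
Implicit Types (F G : T -> R).

Local Notation esumr F := (\esum_(t in [set: T]) (F t)%:E)%E.

Lemma esumrZ_le (c : R) F : 0 <= c -> (forall t, 0 <= F t) ->
  (esumr (fun t => c * F t)%R <= c%:E * esumr F)%E.
Proof.
move=> c0 F0; apply: ge_ereal_sup => _ [A [fA _] <-].
rewrite (eq_fsbigr (fun t => c%:E * (F t)%:E)%E) => [|t _]; last by rewrite EFinM.
rewrite -ge0_mule_fsumr => [|t]; last by rewrite lee_fin.
by rewrite lee_wpmul2l ?lee_fin//; apply: ereal_sup_ubound; exists A.
Qed.

Lemma esumrZ (c : R) F : 0 <= c -> (forall t, 0 <= F t) ->
  (esumr (fun t => c * F t)%R = c%:E * esumr F)%E.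
Proof.
move=> c0 F0; apply/eqP; rewrite eq_le esumrZ_le//=.
have [->|cn0] := eqVneq c 0.
  by rewrite mul0e esum_ge0// => t _; rewrite mul0r.
have cp : 0 < c by rewrite lt_def cn0.
rewrite muleC -lee_pdivlMr//.
have -> : esumr F = esumr (fun t => c^-1 * (c * F t)).
  by apply: eq_esum => t _; rewrite mulKf.
rewrite muleC; apply: esumrZ_le => [|t]; first by rewrite invr_ge0.
by rewrite mulr_ge0.
Qed.

End NonnegativeSums.

(** Functions live on all of [T] and vanish off [X]: the orbit of a point, a set of functionals, can
    then index the space without a subtype. *)
Definition ell2_pred (R : realType) (T : choiceType) (X : set T) :
  {pred T -> R[i]^o} := fun f => `[< (forall t, ~ X t -> f t = 0) /\
    (\esum_(t in [set: T]) (nsq (f t))%:E < +oo)%E >].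

Section EllTwo.
Variables (R : realType) (T : choiceType) (X : set T).
Implicit Types (f g : T -> R[i]^o).

Lemma ell2_submod_closed : submod_closed (@ell2_pred R T X).
Proof.
split=> [|c f g /asboolP[fX fs] /asboolP[gX gs]]; apply/asboolP; split => //.
- by rewrite esum1// => t _; rewrite /nsq/= expr0n addr0.
- by move=> t Xt; rewrite !fctE fX// gX// scaler0 addr0.
(* By the parallelogram law the two sides differ by the squared modulus of [c * f t - g t]. *)
have le t : (nsq (c * f t + g t) <= 2 * nsq c * nsq (f t) + 2 * nsq (g t)).
  rewrite /nsq; case: c (f t) (g t) => a b [x y] [u v] /=.
  rewrite -subr_ge0; set e := (X in 0 <= X).
  have -> : e = (a * x - b * y - u) ^+ 2 + (a * y + b * x - v) ^+ 2.
    by rewrite /e; ring.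
  by rewrite addr_ge0// sqr_ge0.
apply: (@le_lt_trans _ _ (\esum_(t in [set: T])
    ((2 * nsq c * nsq (f t))%:E + (2 * nsq (g t))%:E))%E).
  by apply: le_esum => t _; rewrite -EFinD lee_fin; exact: le.
have c0 := nsq_ge0 c.
rewrite esumD => [|t _|t _]; last first.
- by rewrite lee_fin mulr_ge0// nsq_ge0.
- by rewrite lee_fin !mulr_ge0// nsq_ge0.
have scale d h : 0 <= d -> (\esum_(t in [set: T]) (nsq (h t))%:E < +oo)%E ->
    (\esum_(t in [set: T]) (d * nsq (h t))%:E < +oo)%E.
  move=> d0 hs; rewrite (@esumrZ _ _ d (nsq \o h))//; last by move=> t; exact: nsq_ge0.
  by rewrite lte_mul_pinfty ?lee_fin.
by rewrite lte_add_pinfty// scale// mulr_ge0.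
Qed.
End EllTwo.

HB.instance Definition _ (R : realType) (T : choiceType) (X : set T) :=
  GRing.isSubmodClosed.Build R[i] (T -> R[i]^o) (@ell2_pred R T X)
    (@ell2_submod_closed R T X).

Record ell2 (R : realType) (T : choiceType) (X : set T) : Type :=
  Ell2 { ell2_val :> T -> R[i]^o; ell2_valP : ell2_val \in @ell2_pred R T X }.

Arguments ell2_val {R T X} _ _ : simpl never.

Section EllTwoModule.
Variables (R : realType) (T : choiceType) (X : set T).

HB.instance Definition _ := [isSub for @ell2_val R T X].
HB.instance Definition _ := [Choice of ell2 R X by <:].
HB.instance Definition _ := [SubChoice_isSubLmodule of ell2 R X by <:].

Implicit Types (f g h : ell2 R X).

Lemma ell2P f g : (forall t, f t = g t) -> f = g.
Proof. by move=> fg; apply/val_inj/funext. Qed.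

Lemma ell2_out f t : ~ X t -> f t = 0.
Proof. by have /asboolP[+ _] := ell2_valP f; exact. Qed.

Lemma ell2D f g t : (f + g) t = f t + g t. Proof. by []. Qed.
Lemma ell2N f t : (- f) t = - f t. Proof. by []. Qed.
Lemma ell2B f g t : (f - g) t = f t - g t. Proof. by []. Qed.
Lemma ell2Z c f t : (c *: f) t = c * f t. Proof. by []. Qed.
Lemma ell20 t : (0 : ell2 R X) t = 0. Proof. by []. Qed.
Definition ell2E := (ell2D, ell2N, ell2Z, ell20).

Definition sqsum f : R := fine (\esum_(t in [set: T]) (nsq (f t))%:E).

Lemma sqsumE f : (sqsum f)%:E = (\esum_(t in [set: T]) (nsq (f t))%:E)%E.
Proof.
have /asboolP[_ fs] := ell2_valP f; rewrite fineK// ge0_fin_numE//.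
by apply: esum_ge0 => t _; rewrite lee_fin nsq_ge0.
Qed.

Lemma sqsum_ge0 f : 0 <= sqsum f.
Proof. by rewrite -lee_fin sqsumE esum_ge0// => t _; rewrite lee_fin nsq_ge0. Qed.

Lemma sqsum_combE (s : seq (R * ell2 R X)) : (forall p, p \in s -> 0 <= p.1) ->
  ((\sum_(p <- s) p.1 * sqsum p.2)%:E =
   \esum_(t in [set: T]) (\sum_(p <- s) p.1 * nsq (p.2 t))%:E)%E.
Proof.
move=> s0; have s1 (t : T) (p : R * ell2 R X) : 0 <= Num.max 0 p.1 * nsq (p.2 t) :> R.
  by rewrite mulr_ge0 ?nsq_ge0// le_max lexx.
(* Truncating the coefficients at 0 makes the terms non-negative for every pair, not only for the
   members of [s], as the exchange of sums requires. *)
have -> : \sum_(p <- s) p.1 * sqsum p.2 = \sum_(p <- s) Num.max 0 p.1 * sqsum p.2.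
  by apply: eq_big_seq => p ps; rewrite max_r ?s0.
transitivity (\esum_(t in [set: T])
    \sum_(p <- s) (Num.max 0 p.1 * nsq (p.2 t))%:E)%E; last first.
  apply: eq_esum => t _; rewrite sumEFin; congr EFin.
  by apply: eq_big_seq => p ps; rewrite max_r ?s0.
rewrite (@esum_sum _ _ _ setT s predT) => [|t p _ _]; last by rewrite lee_fin s1.
rewrite -sumEFin; apply: eq_bigr => p _; rewrite esumrZ => [||t].
- by rewrite -sqsumE -EFinM.
- by rewrite le_max lexx.
- exact: nsq_ge0.
Qed.

(* The negative coefficients are moved to the other side, where sums in the
   extended reals can be used. *)
Lemma sqsum_comb_ge0 (s : seq (R * ell2 R X)) :
  (forall t, 0 <= \sum_(p <- s) p.1 * nsq (p.2 t)) ->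
  0 <= \sum_(p <- s) p.1 * sqsum p.2.
Proof.
move=> s0; pose pos := [seq (Num.max p.1 0, p.2) | p <- s].
pose neg := [seq (Num.max (- p.1) 0, p.2) | p <- s].
have split (F : ell2 R X -> R) : \sum_(p <- s) p.1 * F p.2 =
    \sum_(p <- pos) p.1 * F p.2 - \sum_(p <- neg) p.1 * F p.2.
  rewrite /pos /neg !big_map -sumrB; apply: eq_bigr => -[c f] _ /=.
  rewrite -mulrBl; congr (_ * _); case: (leP 0 c) => c0.
    by rewrite max_r ?subr0// oppr_le0.
  by rewrite max_l ?sub0r ?opprK// oppr_ge0 ltW.
rewrite split subr_ge0 -lee_fin !sqsum_combE.
- apply: le_esum => t _; rewrite lee_fin -subr_ge0.
  by have := s0 t; rewrite (split (fun f => nsq (f t))).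
- by move=> _ /mapP[p _ ->]; rewrite le_max lexx orbT.
- by move=> _ /mapP[p _ ->]; rewrite le_max lexx orbT.
Qed.

(** This turns pointwise quadratic identities, provable by [ring], into identities between sums of
    squares: homogeneity, bilinearity after polarisation, and the pairing with basis vectors. *)
Lemma sqsum_comb_eq0 (s : seq (R * ell2 R X)) :
  (forall t, \sum_(p <- s) p.1 * nsq (p.2 t) = 0) ->
  \sum_(p <- s) p.1 * sqsum p.2 = 0.
Proof.
move=> s0; apply/eqP; rewrite eq_le sqsum_comb_ge0 ?andbT => [|t]; last by rewrite s0.
rewrite -oppr_ge0 -sumrN.
have := @sqsum_comb_ge0 [seq (- p.1, p.2) | p <- s].
rewrite big_map; under eq_bigr do rewrite /= mulNr.
apply => t; rewrite big_map; under eq_bigr do rewrite /= mulNr.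
by rewrite sumrN s0 oppr0.
Qed.

Lemma sqsumZ c f : sqsum (c *: f) = nsq c * sqsum f.
Proof.
have := @sqsum_comb_eq0 [:: (1, c *: f); (- nsq c, f)].
rewrite !big_cons big_nil /= mul1r mulNr addr0 => /(_ _)/subr0_eq; apply => t.
rewrite !big_cons big_nil /= ell2E /nsq.
by case: c (f t) => a b [x y]/=; ring.
Qed.

Lemma nsq_le_sqsum f t : nsq (f t) <= sqsum f.
Proof.
rewrite -lee_fin sqsumE; apply: esum_ge; exists [set t]; first by split.
by rewrite fsbig_set1.
Qed.

Lemma sqsum_eq0 f : sqsum f = 0 -> f = 0.
Proof.
move=> f0; apply: ell2P => t; apply: nsq_eq0; apply/eqP.
by rewrite eq_le nsq_ge0 -f0 nsq_le_sqsum.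
Qed.

Lemma sqsum0 : sqsum 0 = 0.
Proof. by rewrite -(scale0r (0 : ell2 R X)) sqsumZ /nsq/= expr0n addr0 mul0r. Qed.

(** The two sides differ pointwise by |a f - g|^2 / a. With the ratio of the norms of [g] and [f]
    for [a], the bound becomes the square of the sum of the norms, which is the triangle
    inequality. *)
Lemma sqsumD_le f g (a : R) : 0 < a ->
  sqsum (f + g) <= (1 + a) * sqsum f + (1 + a^-1) * sqsum g.
Proof.
move=> a0; have an0 : a != 0 by rewrite gt_eqF.
have := @sqsum_comb_ge0 [:: (1 + a, f); (1 + a^-1, g); (- 1, f + g)].
rewrite !big_cons big_nil /= addr0 mulN1r addrA subr_ge0; apply => t.
rewrite !big_cons big_nil /= ell2E /nsq.
case: (f t) (g t) => x y [u v]/=; set e := (X in 0 <= X).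
have -> : e = a^-1 * ((a * x - u) ^+ 2 + (a * y - v) ^+ 2) by rewrite /e; field.
by rewrite mulr_ge0 ?invr_ge0 ?(ltW a0)// addr_ge0// sqr_ge0.
Qed.

Definition ell2_norm f : R[i] := (Num.sqrt (sqsum f))%:C.

Lemma ell2_normD f g : ell2_norm (f + g) <= ell2_norm f + ell2_norm g.
Proof.
rewrite /ell2_norm -rmorphD lecR.
have [/eqP f0|f0] := boolP (sqsum f == 0).
  by rewrite f0 (sqsum_eq0 f0) add0r sqrtr0 add0r.
have [/eqP g0|g0] := boolP (sqsum g == 0).
  by rewrite g0 (sqsum_eq0 g0) addr0 sqrtr0 addr0.
have sf : 0 < Num.sqrt (sqsum f) by rewrite sqrtr_gt0 lt_def f0 sqsum_ge0.
have sg : 0 < Num.sqrt (sqsum g) by rewrite sqrtr_gt0 lt_def g0 sqsum_ge0.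
have a0 : 0 < Num.sqrt (sqsum g) / Num.sqrt (sqsum f) by rewrite divr_gt0.
have := sqsumD_le f g a0.
rewrite -{2}(sqr_sqrtr (sqsum_ge0 f)) -{3}(sqr_sqrtr (sqsum_ge0 g)) => le.
rewrite -(@ger0_norm _ (_ + _)) ?addr_ge0 ?sqrtr_ge0// -sqrtr_sqr ler_wsqrtr//.
apply: le_trans le _; rewrite le_eqVlt; apply/orP; left; apply/eqP.
by field; rewrite !gt_eqF.
Qed.

Lemma ell2_normZ c f : ell2_norm (c *: f) = `|c| * ell2_norm f.
Proof. by rewrite /ell2_norm sqsumZ sqrtrM ?nsq_ge0// rmorphM/= -normc_sqrt. Qed.

Lemma ell2_norm_eq0 f : ell2_norm f = 0 -> f = 0.
Proof.
move=> /complexI/eqP; rewrite sqrtr_eq0 => f0; apply: sqsum_eq0; apply/eqP.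
by rewrite eq_le f0 sqsum_ge0.
Qed.

HB.instance Definition _ := Lmodule_isNormed.Build R[i] (ell2 R X)
  ell2_normD ell2_normZ ell2_norm_eq0.

Lemma ell2_normE f : `|f| = (Num.sqrt (sqsum f))%:C. Proof. by []. Qed.

Lemma rnorm_ell2 f : rnorm f ^+ 2 = sqsum f.
Proof. by rewrite /rnorm ell2_normE/= sqr_sqrtr// sqsum_ge0. Qed.

End EllTwoModule.

Section EllTwoComplete.
Variables (R : realType) (T : choiceType) (X : set T).
Implicit Types (f g h : ell2 R X).

Lemma sqsumBC f g : sqsum (f - g) = sqsum (g - f).
Proof. by rewrite -!rnorm_ell2 /rnorm distrC. Qed.

(** Coordinates are dominated by the norm, so they converge; it remains to see that the pointwise
    limit lies in the space and is the limit in norm. *)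
Lemma ell2_cauchy_cvg (F : set_system (ell2 R X)) :
  ProperFilter F -> cauchy F -> cvg F.
Proof.
move=> FF /cauchyP Fc.
have near_sq (e : R) : 0 < e -> exists x, \forall y \near F, sqsum (x - y) <= e ^+ 2.
  move=> e0; have [|x xF] := Fc e%:C; first by rewrite ltcR.
  exists x; apply: filterS xF => y; rewrite -ball_normE /ball_/= rnormE ltcR => xy.
  by rewrite -rnorm_ell2 lerXn2r// ?nnegrE ?rnorm_ge0// ltW.
have lims (phi : R[i] -> R) : (forall z w, (phi z - phi w) ^+ 2 <= nsq (z - w)) ->
    forall t, cvg ((fun y : ell2 R X => phi (y t)) @ F).
  move=> phile t; apply: (@cauchy_cvg R); apply: cauchy_exP => e e0.
  have [x xF] := near_sq (e / 2) (divr_gt0 e0 (ltr0Sn R 1)).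
  exists (phi (x t)); apply: filterS xF => y xy.
  rewrite -ball_normE /ball_/=; apply: (@le_lt_trans _ _ (e / 2)).
    rewrite -(@ler_pXn2r _ 2)// ?nnegrE ?divr_ge0 ?(ltW e0)// real_normK ?num_real//.
    apply: le_trans (phile _ _) _; rewrite -ell2B.
    exact: le_trans (nsq_le_sqsum _ _) xy.
  by rewrite ltr_pdivrMr// mulr2n mulrDr mulr1 ltrDl.
have phiRe : forall z w : R[i], (complex.Re z - complex.Re w) ^+ 2 <= nsq (z - w).
  by move=> [a b] [c d]; rewrite /nsq/= lerDl sqr_ge0.
have phiIm : forall z w : R[i], (complex.Im z - complex.Im w) ^+ 2 <= nsq (z - w).
  by move=> [a b] [c d]; rewrite /nsq/= lerDr sqr_ge0.
have cRe := lims _ phiRe; have cIm := lims _ phiIm.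
pose l t : R[i]^o := lim ((fun y : ell2 R X => complex.Re (y t)) @ F) +i*
  lim ((fun y : ell2 R X => complex.Im (y t)) @ F).
have cnsq (x : ell2 R X) t :
    (fun y : ell2 R X => nsq (x t - y t)) @ F --> nsq (x t - l t).
  have dRe : (fun y : ell2 R X => complex.Re (x t) - complex.Re (y t)) @ F -->
      complex.Re (x t) - complex.Re (l t) by apply: cvgB; [exact: cvg_cst|exact: cRe].
  have dIm : (fun y : ell2 R X => complex.Im (x t) - complex.Im (y t)) @ F -->
      complex.Im (x t) - complex.Im (l t) by apply: cvgB; [exact: cvg_cst|exact: cIm].
  have nsqB (z w : R[i]) : nsq (z - w) =
      (complex.Re z - complex.Re w) * (complex.Re z - complex.Re w) +
      (complex.Im z - complex.Im w) * (complex.Im z - complex.Im w).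
    by case: z w => a b [c d]; rewrite /nsq/= !expr2.
  by under eq_cvg do rewrite nsqB; rewrite nsqB; apply: cvgD; apply: cvgM.
have csum (x : ell2 R X) (s : seq T) : (fun y : ell2 R X => \sum_(t <- s) nsq (x t - y t)) @ F
     --> \sum_(t <- s) nsq (x t - l t).
  elim: s => [|t s IH].
    by under eq_cvg do rewrite big_nil; rewrite big_nil; exact: cvg_cst.
  by under eq_cvg do rewrite big_cons; rewrite big_cons; exact: cvgD.
(* Fatou's argument: the bound holds for the finite partial sums at [y], passes to their limits, and
   then to the supremum over finite sets. *)
have lim_sq (x : ell2 R X) (e : R) : (\forall y \near F, sqsum (x - y) <= e) ->
    (\esum_(t in [set: T]) (nsq (x t - l t))%:E <= e%:E)%E.
  move=> xe; apply: ge_ereal_sup => _ [A [fA _] <-].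
  rewrite fsbig_finite//= sumEFin lee_fin -(cvg_lim _ (csum x _))//.
  apply: limr_le; first by apply/cvg_ex; eexists; exact: csum.
  apply: filterS xe => y; apply: le_trans; rewrite -lee_fin sqsumE -sumEFin.
  apply: esum_ge; exists A; first by split.
  by rewrite fsbig_finite.
have [x0 x0F] := near_sq 1 ltr01.
have lX t : ~ X t -> l t = 0.
  move=> Xt; rewrite /l; under eq_fun do rewrite ell2_out//=.
  rewrite lim_cst//; under eq_fun do rewrite ell2_out//=.
  by rewrite lim_cst.
have dP : (fun t => x0 t - l t) \in @ell2_pred R T X.
  apply/asboolP; split; first by move=> t Xt; rewrite lX// ell2_out// subr0.
  exact: le_lt_trans (lim_sq x0 _ x0F) (ltry _).
(* Only differences with [l] are known to be square summable, so the limit is recovered as x0 - (x0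
   - l). *)
pose y0 := x0 - Ell2 dP.
have y0E t : y0 t = l t by apply: subKr.
apply/cvg_ex; exists y0; apply/cvgrPdist_le => e e0.
have [r r0 er] : exists2 r : R, 0 < r & e = r%:C.
  exists (complex.Re e); last by rewrite RRe_real// ger0_real// ltW.
  by move: e0; rewrite ltcE => /andP[].
have [x xF] := near_sq (r / 2) (divr_gt0 r0 (ltr0Sn R 1)).
have xy0 : sqsum (x - y0) <= (r / 2) ^+ 2.
  rewrite -lee_fin sqsumE; apply: le_trans (lim_sq x _ xF).
  by apply: le_esum => t _; rewrite ell2B y0E.
have nle f : sqsum f <= (r / 2) ^+ 2 -> `|f| <= (r / 2)%:C.
  move=> fr; rewrite ell2_normE lecR -(@ger0_norm _ (r / 2)) ?divr_ge0 ?(ltW r0)//.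
  by rewrite -sqrtr_sqr ler_wsqrtr.
apply: filterS xF => y xy.
rewrite er (splitr r) rmorphD -(subrKA x); apply: le_trans (ler_normD _ _) _.
by rewrite lerD// nle// sqsumBC.
Qed.

HB.instance Definition _ := Uniform_isComplete.Build (ell2 R X) ell2_cauchy_cvg.

End EllTwoComplete.

Section EllTwoDot.
Variables (R : realType) (T : choiceType) (X : set T).
Implicit Types (f g h : ell2 R X).

Let conjE (z : R[i]) : Num.conj z = complex.Re z -i* complex.Im z.
Proof. by case: z. Qed.

(** Polarisation gives the real part of the inner product from sums of squares alone, whose
    convergence is already known. *)
Definition ell2_rdot f g : R := (sqsum (f + g) - sqsum (f - g)) / 4.

(** The product is conjugate-linear in [g], hence its imaginary part is the real part of its value
    at ['i *: g]. *)
Definition ell2_dot f g : R[i] := ell2_rdot f g +i* ell2_rdot f ('i *: g).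

Let rdot_lin c f f' g : ell2_rdot (c *: f + f') g =
  complex.Re c * ell2_rdot f g - complex.Im c * ell2_rdot f ('i *: g) + ell2_rdot f' g.
Proof.
apply/eqP; rewrite -subr_eq0; apply/eqP; case: c => a b /=.
(* These are the polarisation terms of the left side minus those of the right side. *)
pose s := [:: (4^-1 : R, a +i* b *: f + f' + g);
  (- 4^-1, a +i* b *: f + f' - g); (- (4^-1 * a), f + g); (4^-1 * a, f - g);
  (4^-1 * b, f + 'i *: g); (- (4^-1 * b), f - 'i *: g);
  (- 4^-1, f' + g); (4^-1, f' - g)].
have e t : \sum_(p <- s) p.1 * nsq (p.2 t) = 0.
  rewrite /s !big_cons big_nil /= !ell2E /nsq.
  by case: (f t) (f' t) (g t) => x y [u v] [z w]/=; ring.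
have := sqsum_comb_eq0 e; rewrite /s !big_cons !big_nil /= /ell2_rdot.
do ![move: (sqsum _) => ?]; move=> {}e; rewrite -[RHS]e; ring.
Qed.

Let rdotC f g : ell2_rdot f g = ell2_rdot g f.
Proof. by rewrite /ell2_rdot [f + g]addrC sqsumBC. Qed.

Let rdotNi f g : ell2_rdot f ('i *: g) = - ell2_rdot g ('i *: f).
Proof.
have := rdot_lin ('i : R[i]) g 0 f; rewrite addr0 /= mul0r mul1r sub0r => e.
rewrite rdotC e /ell2_rdot !sub0r !add0r.
by rewrite -[sqsum (- _)]rnorm_ell2 /rnorm normrN -/(rnorm _) rnorm_ell2 subrr mul0r addr0.
Qed.

Let dot_linl g : scalar (ell2_dot ^~ g).
Proof.
move=> c f f'; rewrite /ell2_dot !rdot_lin scalerA.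
have -> : 'i * 'i = -1 :> R[i] by rewrite -expr2 sqr_i.
have -> : ell2_rdot f (-1 *: g) = - ell2_rdot f g.
  by rewrite scaleN1r /ell2_rdot opprK -mulNr opprB.
case: c => a b; do ![move: (ell2_rdot _ _) => ?].
by apply/eqP; rewrite eq_complex /=; apply/andP; split; apply/eqP; ring.
Qed.

Let dotC f g : ell2_dot f g = Num.conj (ell2_dot g f).
Proof.
by rewrite conjE /ell2_dot /= rdotC; congr (_ +i* _); rewrite rdotNi.
Qed.

Let dot_linr f : GRing.linear_for (Num.conj \; *%R) (ell2_dot f).
Proof.
move=> c g g'; rewrite dotC dot_linl rmorphD rmorphM /=; congr (_ * _ + _).
  by rewrite [RHS]dotC.
by rewrite [RHS]dotC.
Qed.

Lemma ell2_dot_norm f : `|f| ^+ 2 = ell2_dot f f.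
Proof.
rewrite ell2_normE -rmorphXn/= sqr_sqrtr ?sqsum_ge0// /ell2_dot.
apply/eqP; rewrite eq_complex /=; apply/andP; split; last first.
  by have := rdotNi f f => /eqP; rewrite -addr_eq0 -mulr2n mulrn_eq0/= eq_sym.
rewrite /ell2_rdot subrr sqsum0 subr0 -mulr2n -scaler_nat sqsumZ.
by apply/eqP; rewrite /nsq/= addr0 expr0n addr0; field.
Qed.

Let dot_gt0 f : f != 0 -> 0 < ell2_dot f f.
Proof. by move=> f0; rewrite -ell2_dot_norm exprn_gt0// normr_gt0. Qed.

HB.instance Definition _ := @bilinear_isBilinear.Build R[i] (ell2 R X)
  (ell2 R X) R[i] *%R (Num.conj \; *%R) ell2_dot (dot_linl, dot_linr).

Let dot_herm f g : ell2_dot f g = (-1) ^+ false * Num.conj (ell2_dot g f).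
Proof. by rewrite expr0 mul1r dotC. Qed.

HB.instance Definition _ := @isHermitianSesquilinear.Build R[i] (ell2 R X)
  false Num.conj ell2_dot dot_herm.

HB.instance Definition _ := @isDotProduct.Build R[i] (ell2 R X) ell2_dot dot_gt0.

Definition ell2_hilbert : hilbertSpace R :=
  HilbertSpace (hs_dot := ell2_dot) ell2_dot_norm.

End EllTwoDot.

(** * Inner products, real-valued norms and closures *)

Section HilbertTheory.
Variables (R : realType) (H : hilbertSpace R).
Local Notation dot := (hs_dot H).
Implicit Types (x y z : H).

Lemma dotC x y : dot x y = Num.conj (dot y x).
Proof. by rewrite hermC expr0 mul1r. Qed.

Lemma dotDl x y z : dot (x + y) z = dot x z + dot y z.
Proof. exact: linearDl. Qed.

Lemma dotZl c x z : dot (c *: x) z = c * dot x z.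
Proof. exact: linearZl_LR. Qed.

Lemma dotZr c x z : dot z (c *: x) = Num.conj c * dot z x.
Proof. by rewrite dotC dotZl rmorphM/= -dotC. Qed.

Lemma dot0l z : dot 0 z = 0.
Proof. by rewrite -(scale0r z) dotZl mul0r. Qed.

Lemma dot0r z : dot z 0 = 0.
Proof. by rewrite dotC dot0l conjC0. Qed.

Lemma dotNl x z : dot (- x) z = - dot x z.
Proof. by rewrite -scaleN1r dotZl mulN1r. Qed.

Lemma dotBl x y z : dot (x - y) z = dot x z - dot y z.
Proof. by rewrite dotDl dotNl. Qed.

Lemma dotBr x y z : dot z (x - y) = dot z x - dot z y.
Proof. by rewrite dotC dotBl rmorphB/= -!dotC. Qed.

Lemma dot_eq0 x : dot x x = 0 -> x = 0.
Proof. by rewrite -hs_norm => /eqP; rewrite sqrf_eq0 normr_eq0 => /eqP. Qed.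

Lemma dot_sum_l (I : Type) (s : seq I) (P : pred I) (F : I -> H) z :
  dot (\sum_(i <- s | P i) F i) z = \sum_(i <- s | P i) dot (F i) z.
Proof.
by elim/big_rec2: _ => [|i u v _ <-]; rewrite ?dot0l ?dotDl.
Qed.

Lemma cauchy_schwarz x y : `|dot x y| <= `|x| * `|y|.
Proof.
have [->|y0] := eqVneq y 0; first by rewrite dot0r !normr0 mulr0.
have yy : dot y y != 0 by apply: contra_neq y0 => /dot_eq0.
have ny : 0 < `|y| by rewrite normr_gt0.
pose a := dot x y / dot y y.
have : 0 <= `|x - a *: y| ^+ 2 by rewrite exprn_ge0.
rewrite hs_norm dotBl !dotBr dotZl !dotZr dotZl.
have -> : a * dot y y = dot x y by rewrite divfK.
have -> : dot x x - Num.conj a * dot x y - (a * dot y x - Num.conj a * dot x y) =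
  `|x| ^+ 2 - `|dot x y| ^+ 2 / `|y| ^+ 2.
  by rewrite opprB addrA subrK hs_norm normCK (hs_norm y) /a [dot y x]dotC; field.
rewrite subr_ge0 ler_pdivrMr ?exprn_gt0// -exprMn.
by rewrite ler_sqr ?nnegrE// mulr_ge0.
Qed.

Lemma rnorm_dot x y : rnorm (dot x y) <= rnorm x * rnorm y.
Proof. by rewrite -lecR rmorphM/= -!rnormE cauchy_schwarz. Qed.

End HilbertTheory.

Section RealNorm.
Variable (R : realType).

Lemma complex_pos_real (e : R[i]) : 0 < e -> exists2 r : R, 0 < r & e = r%:C.
Proof.
move=> e0; exists (complex.Re e); first by move: e0; rewrite ltcE => /andP[].
by rewrite RRe_real// ger0_real// ltW.
Qed.

Lemma rnormM (a b : R[i]) : rnorm (a * b) = rnorm a * rnorm b.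
Proof. by apply: complexI; rewrite rmorphM/= -!rnormE normrM. Qed.

Lemma rnorm1 : rnorm (1 : R[i]) = 1.
Proof. by rewrite /rnorm normr1. Qed.

Variables (V : normedZmodType R[i]).
Implicit Types (x y z : V).

Lemma normC_le x (r : R) : (`|x| <= r%:C) = (rnorm x <= r).
Proof. by rewrite rnormE lecR. Qed.

Lemma normC_lt x (r : R) : (`|x| < r%:C) = (rnorm x < r).
Proof. by rewrite rnormE ltcR. Qed.

Lemma rnorm0 : rnorm (0 : V) = 0.
Proof. by rewrite /rnorm normr0. Qed.

Lemma rnormN x : rnorm (- x) = rnorm x.
Proof. by rewrite /rnorm normrN. Qed.

Lemma rnormBC x y : rnorm (x - y) = rnorm (y - x).
Proof. by rewrite /rnorm distrC. Qed.

Lemma rnormD x y : rnorm (x + y) <= rnorm x + rnorm y.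
Proof. by rewrite -lecR rmorphD/= -!rnormE ler_normD. Qed.

Lemma rnormB x y z : rnorm (x - z) <= rnorm (x - y) + rnorm (y - z).
Proof. by rewrite -lecR rmorphD/= -!rnormE ler_distD. Qed.

Lemma rnorm_eq0 x : rnorm x <= 0 -> x = 0.
Proof. by rewrite -normC_le normr_le0 => /eqP. Qed.

Lemma rnorm_le_eps x : (forall e : R, 0 < e -> rnorm x <= e) -> x = 0.
Proof.
move=> xe; apply: rnorm_eq0; apply/ler_addgt0Pr => e e0.
by rewrite add0r xe.
Qed.

End RealNorm.

Section NormClosure.
Variables (R : realType) (V : normedModType R[i]).
Implicit Types (M : set V) (x y : V).

Lemma rnormZ (c : R[i]) x : rnorm (c *: x) = rnorm c * rnorm x.
Proof. by apply: complexI; rewrite rmorphM/= -!rnormE normrZ. Qed.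

Lemma closure_normP M x : closure M x <->
  forall e : R, 0 < e -> exists2 y, M y & rnorm (x - y) <= e.
Proof.
split=> [Mx e e0|Mx B].
  have [|y [My /=]] := Mx (ball x e%:C); first by apply: nbhsx_ballx; rewrite ltcR.
  by rewrite -ball_normE /ball_/= normC_lt => xy; exists y => //; exact: ltW.
move=> /nbhs_ballP[e /= /complex_pos_real[r r0 ->] xB].
have [y My xy] := Mx _ (divr_gt0 r0 (ltr0Sn R 1)).
exists y; split => //; apply: xB; rewrite -ball_normE /ball_/= normC_lt.
by apply: le_lt_trans xy _; rewrite ltr_pdivrMr// mulr2n mulrDr mulr1 ltrDl.
Qed.

Lemma closed_normP M x : closed M ->
  (forall e : R, 0 < e -> exists2 y, M y & rnorm (x - y) <= e) -> M x.
Proof. by move=> cM Mx; apply: cM; apply/closure_normP. Qed.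

End NormClosure.

(** * The canonical basis *)

Section EllTwoBasis.
Variables (R : realType) (T : choiceType) (X : set T).
Implicit Types (f g h : ell2 R X) (t u : T).

Let mem1 u t : (t \in [set u]) = (t == u).
Proof. by apply/idP/eqP => [/set_mem//|->]; exact: mem_set. Qed.

(** The second condition makes the vector zero for an index outside [X], so that it is defined for
    every index. *)
Let delta_fun u : T -> R[i]^o := fun t => ((t == u) && `[< X u >])%:R.

Lemma delta_subproof u : delta_fun u \in @ell2_pred R T X.
Proof.
apply/asboolP; split=> [t Xt|].
  rewrite /delta_fun; case: eqP => [<-|//] /=.
  by case: asboolP.
apply: (@le_lt_trans _ _ (\esum_(t in [set: T]) if t \in [set u] then 1%:E else 0)).
  apply: le_esum => t _; rewrite mem1 /delta_fun; case: eqP => _ /=.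
    by case: asboolP; rewrite lee_fin /nsq/= ?expr1n expr0n addr0.
  by rewrite lee_fin /nsq/= expr0n addr0.
by rewrite -esum_mkcond esum_set1 ?ltry.
Qed.

Definition delta u : ell2 R X := Ell2 (delta_subproof u).

Lemma deltaE u t : X u -> delta u t = (t == u)%:R.
Proof. by move=> Xu; rewrite /ell2_val/= /delta_fun asboolT// andbT. Qed.

Lemma sqsum_delta u : X u -> sqsum (delta u) = 1.
Proof.
move=> Xu; apply: EFin_inj; rewrite sqsumE.
transitivity (\esum_(t in [set: T]) if t \in [set u] then (1 : R)%:E else 0)%E.
  apply: eq_esum => t _; rewrite mem1 deltaE//.
  by case: eqP => _; rewrite /nsq/= ?expr1n expr0n addr0.
by rewrite -esum_mkcond esum_set1.
Qed.

Lemma rnorm_delta u : X u -> rnorm (delta u) = 1.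
Proof.
move=> Xu; apply/eqP; rewrite -(@eqrXn2 _ 2)// ?rnorm_ge0//.
by rewrite rnorm_ell2 sqsum_delta// expr1n.
Qed.

Lemma nsq_delta u t : X u -> nsq (delta u t) = (t == u)%:R.
Proof.
by move=> Xu; rewrite deltaE//; case: eqP => _; rewrite /nsq/= ?expr1n expr0n addr0.
Qed.

Lemma dot_delta f u : X u -> ell2_dot f (delta u) = f u.
Proof.
move=> Xu; have rdot c : ell2_rdot f (c *: delta u) =
    complex.Re c * complex.Re (f u) + complex.Im c * complex.Im (f u).
  (* At [u] this is |z + c|^2 - |z - c|^2 = 4 Re (z conj c) with z = [f u]; at other points the two
     squares cancel. *)
  have e t : \sum_(p <- [:: (1, f + c *: delta u); (- 1, f - c *: delta u);
     (- 4 * (complex.Re c * complex.Re (f u) + complex.Im c * complex.Im (f u)),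
      delta u)]) p.1 * nsq (p.2 t) = 0.
    rewrite !big_cons big_nil /= nsq_delta// !ell2E deltaE//.
    case: eqP => [->|_] /=; last by rewrite !mulr0 subr0 !addr0; ring.
    by rewrite /nsq !mulr1; case: c (f u) => a b [x y]/=; ring.
  have := sqsum_comb_eq0 e; rewrite !big_cons big_nil /= sqsum_delta// /ell2_rdot.
  do ![move: (sqsum _) => ?] => {}e; apply/eqP; rewrite -subr_eq0; apply/eqP.
  by rewrite -[RHS](mul0r 4^-1) -e; field.
rewrite /ell2_dot rdot -[delta u]scale1r rdot.
by case: (f u) => x y /=; rewrite !mul0r !mul1r add0r addr0.
Qed.

(** The bound is uniform over all [h] dominated by [f] and vanishing on [s], so it covers both
    partial sums of the basis expansion and restrictions to the points of one level. *)
Lemma ell2_tail f (e : R) : 0 < e -> exists s : seq T, forall h,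
  (forall t, t \in s -> h t = 0) -> (forall t, nsq (h t) <= nsq (f t)) ->
  rnorm h <= e.
Proof.
move=> e0.
have : ((\esum_(t in [set: T]) (nsq (f t))%:E) \is a fin_num)%E by rewrite -sqsumE.
move=> /ub_ereal_sup_adherent -/(_ _ (exprn_gt0 2 e0))[_ [A [fA _] <-]].
rewrite -/(esum _ _) -sqsumE fsbig_finite//= => Ae.
set s : seq T := enum_fset (fset_set A) in Ae; exists s => h hs hf.
suff : sqsum h <= e ^+ 2.
  rewrite -rnorm_ell2 => he; rewrite -(@ler_pXn2r _ 2)// nnegrE ?rnorm_ge0//.
  exact: ltW.
have us : uniq s by exact: fset_uniq.
(* The finite sum over [s] is written with basis vectors, so that the inequality between [sqsum f],
   [sqsum h] and this sum is again a pointwise one. *)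
have := @sqsum_comb_ge0 R T X [:: (1, f), (- 1, h) & [seq (- nsq (f u), delta u) | u <- s]].
rewrite !big_cons big_map /= => H.
have {}H : 0 <= sqsum f - (sqsum h + \sum_(u <- s) nsq (f u)).
  rewrite opprD; move: H; rewrite mul1r mulN1r.
  have -> : \sum_(j <- s) - nsq (f j) * sqsum (delta j) = - \sum_(u <- s) nsq (f u).
    rewrite -sumrN; apply: eq_bigr => u _; have [Xu|Xu] := pselect (X u).
      by rewrite sqsum_delta// mulr1.
    by rewrite ell2_out// /nsq/= expr0n addr0 oppr0 mul0r.
  apply => t; rewrite !big_cons big_map /= mul1r mulN1r.
  have -> : \sum_(j <- s) - nsq (f j) * nsq (delta j t) =
      - (if t \in s then nsq (f t) else 0).
    have d0 u : t != u -> - nsq (f u) * nsq (delta u t) = 0.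
      move=> tu; have [Xu|Xu] := pselect (X u).
        by rewrite nsq_delta// (negPf tu) mulr0.
      by rewrite ell2_out// /nsq/= expr0n addr0 oppr0 mul0r.
    case: ifPn => ts.
      rewrite (bigD1_seq t)//= big1 ?addr0 => [|u ut]; last by rewrite d0// eq_sym.
      have [Xt|Xt] := pselect (X t); first by rewrite nsq_delta// eqxx mulr1.
      by rewrite [f t]ell2_out// /nsq/= expr0n addr0 oppr0 mul0r.
    rewrite oppr0 big_seq big1// => u us'; rewrite d0//.
    by apply: contraNneq ts => ->.
  case: ifPn => ts.
    by rewrite hs// /nsq/= expr0n addr0 oppr0 add0r subrr.
  by rewrite oppr0 addr0 subr_ge0.
move: Ae; rewrite -/s sumEFin -EFinB lte_fin; move: H; rewrite subr_ge0 => H1 H2.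
have : sqsum h + \sum_(u <- s) nsq (f u) < \sum_(u <- s) nsq (f u) + e ^+ 2.
  by apply: le_lt_trans H1 _; rewrite -ltrBlDr.
by rewrite addrC ltrD2l => /ltW.
Qed.

Lemma ell2_sum f (s : seq (ell2 R X)) t : (\sum_(g <- s) g) t = \sum_(g <- s) g t.
Proof. by elim: s => [|g s IH]; rewrite ?big_nil// !big_cons -IH. Qed.

Lemma delta_sumE f (s : seq T) t : uniq s ->
  (\sum_(u <- s) f u *: delta u) t = if t \in s then f t else 0.
Proof.
move=> us; rewrite -(big_map (fun u => f u *: delta u) predT id) ell2_sum// big_map.
have d0 u : t != u -> (f u *: delta u) t = 0.
  move=> tu; have [Xu|Xu] := pselect (X u).
    by rewrite ell2Z deltaE// (negPf tu) mulr0.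
  by rewrite ell2Z ell2_out// mul0r.
case: ifPn => ts; last first.
  by rewrite big_seq big1// => u us'; rewrite d0//; apply: contraNneq ts => ->.
rewrite (bigD1_seq t)//= big1 ?addr0 => [|u ut]; last by rewrite d0// eq_sym.
have [Xt|Xt] := pselect (X t); first by rewrite ell2Z deltaE// eqxx mulr1.
by rewrite ell2Z ell2_out// mul0r.
Qed.

Lemma delta_sum_approx f (e : R) : 0 < e -> exists2 s : seq T, uniq s &
  rnorm (f - \sum_(u <- s) f u *: delta u) <= e.
Proof.
move=> /(ell2_tail f)[s sP]; exists (undup s); first exact: undup_uniq.
apply: sP => t; rewrite ell2B delta_sumE ?undup_uniq// mem_undup.
  by move=> ->; rewrite subrr.
by case: ifP => _; rewrite ?subr0// subrr /nsq/= expr0n addr0 addr_ge0// sqr_ge0.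
Qed.

Lemma ell2_closed_span (M : set (ell2 R X)) f : M 0 ->
  (forall (c : R[i]) x y, M x -> M y -> M (c *: x + y)) -> closed M ->
  (forall t, f t != 0 -> M (delta t)) -> M f.
Proof.
move=> M0 Mlin Mcl fM; apply: closed_normP => // e e0.
have [s _ fs] := delta_sum_approx f e0.
exists (\sum_(u <- s) f u *: delta u) => //; elim: s {fs} => [|u s IH].
  by rewrite big_nil.
rewrite big_cons; have [->|fu] := eqVneq (f u) 0; first by rewrite scale0r add0r.
by apply: Mlin => //; exact: fM.
Qed.

End EllTwoBasis.

(** * Extension by continuity of a densely defined bounded linear relation *)

Section BoundedExtension.
Variables (R : realType) (V : normedModType R[i]) (W : completeNormedModType R[i]).
Variables (graph : V -> W -> Prop) (C : R).
Hypothesis C0 : 0 <= C.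
Hypothesis graph_linear : forall c x x' y y',
  graph x y -> graph x' y' -> graph (c *: x + x') (c *: y + y').
Hypothesis graph_bounded : forall x y, graph x y -> rnorm y <= C * rnorm x.
Hypothesis graph_dense : closure [set x | exists y, graph x y] = setT.

Let graphB x x' y y' : graph x y -> graph x' y' -> graph (x - x') (y - y').
Proof.
by move=> g g'; have := graph_linear (-1) g' g; rewrite !scaleN1r [- x' + x]addrC [- y' + y]addrC.
Qed.

Let approx x (e : R) : 0 < e -> exists2 p : V * W, graph p.1 p.2 & rnorm (x - p.1) <= e.
Proof.
move=> e0; have : closure [set x | exists y, graph x y] x by rewrite graph_dense.
by move=> /closure_normP/(_ _ e0)[y [z yz] xy]; exists (y, z).
Qed.

(** The values at graph points close to [x] form a Cauchy filter. Recording the distance of its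
    limit to every graph value is enough for linearity, boundedness and the extension property. *)
Lemma graph_limit x : exists z, forall y w, graph y w ->
  rnorm (z - w) <= C * rnorm (x - y).
Proof.
pose B (e : R) := [set w | exists2 y, graph y w & rnorm (x - y) <= e].
pose F := filter_from [set e : R | 0 < e] B.
have FF : ProperFilter F.
  apply: filter_from_proper => [|e /= e0].
    apply: filter_from_filter; first by exists 1; exact: ltr01.
    move=> e e' /= e0 e'0; exists (Num.min e e'); first by rewrite lt_min e0.
    by move=> w [y yw]; rewrite le_min => /andP[ye ye']; split; exists y.
  by have [[y w] /= yw xy] := approx x e0; exists w; exists y.
have BB e w w' : B e w -> B e w' -> rnorm (w - w') <= C * (e + e).
  move=> [y yw xy] [y' yw' xy']; apply: le_trans (graph_bounded (graphB yw yw')) _.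
  rewrite ler_wpM2l//; apply: le_trans (rnormB _ x _) _.
  by rewrite lerD// rnormBC.
have small (r : R) : 0 < r -> exists2 e : R, 0 < e & C * (e + e) < r.
  (* The divisor [C + 1] is positive even for [C = 0], and the 4 leaves C (e + e) at most r / 2. *)
  move=> r0; exists (r / (C + 1) / 4); first by rewrite !divr_gt0// ltr_wpDl.
  have C1 : 0 < C + 1 by rewrite ltr_wpDl.
  rewrite (_ : C * _ = (C / (C + 1)) * (r / 2)); last by field; rewrite gt_eqF.
  apply: (@le_lt_trans _ _ (1 * (r / 2))).
    by rewrite ler_wpM2r ?divr_ge0 ?(ltW r0)// ler_pdivrMr// mul1r lerDl.
  by rewrite mul1r ltr_pdivrMr// mulr2n mulrDr mulr1 ltrDl.
have /cvg_ex[z Fz] : cvg F.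
  apply: cauchy_cvg; apply: cauchy_exP => _ /complex_pos_real[r r0 ->].
  have [e e0 er] := small r r0.
  have [[y w] /= yw xy] := approx x e0.
  exists w, e => // w' Bw'; rewrite -ball_normE /ball_/= normC_lt.
  by apply: le_lt_trans er; apply: BB => //; exists y.
exists z => y w yw; apply/ler_addgt0Pr => r r0.
have [e e0 er] := small (r / 2) (divr_gt0 r0 (ltr0Sn R 1)).
have : F (ball z (r / 2)%:C).
  by apply: Fz; apply: nbhsx_ballx; rewrite ltcR divr_gt0.
move=> [d d0 dz]; pose e' := Num.min d e.
have e'0 : 0 < e' by rewrite lt_min d0.
have [[y' w'] /= yw' xy'] := approx x e'0.
move: xy'; rewrite le_min => /andP[xd xe].
have : ball z (r / 2)%:C w' by apply: dz; exists y'.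
rewrite -ball_normE /ball_/= normC_lt => zw'.
apply: le_trans (rnormB _ w' _) _.
apply: (@le_trans _ _ (r / 2 + C * (e + rnorm (x - y)))).
  rewrite lerD ?(ltW zw')//; apply: le_trans (graph_bounded (graphB yw' yw)) _.
  rewrite ler_wpM2l//; apply: le_trans (rnormB _ x _) _.
  by rewrite lerD// rnormBC.
rewrite mulrDr addrA [leRHS]addrC lerD2r [leRHS]splitr lerD2l.
by apply: le_trans (ltW er); rewrite ler_wpM2l// lerDl ltW.
Qed.

(** The relation is not assumed single-valued: this follows from the distance estimate between [x]
    and itself. *)
Lemma bounded_extension : exists G : V -> W, [/\ linear G,
  forall x, rnorm (G x) <= C * rnorm x & forall x y, graph x y -> G x = y].
Proof.
have [G GP] := choice graph_limit.
have g00 : graph 0 0.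
  have [[y w] /= yw _] := approx 0 ltr01.
  by rewrite -(subrr y) -(subrr w); exact: graphB.
have Gx x y : graph x y -> G x = y.
  move=> xy; apply/eqP; rewrite -subr_eq0; apply/eqP; apply: rnorm_eq0.
  by apply: le_trans (GP _ _ _ xy) _; rewrite subrr rnorm0 mulr0.
exists G; split => // [|x]; last by have := GP x _ _ g00; rewrite !subr0.
move=> c u v; apply/eqP; rewrite -subr_eq0; apply/eqP.
(* [K] adds the errors at [c *: u + v], at [u] and at [v] per unit of approximation; the later
   [K + 1] is a positive divisor. *)
pose K := C * (rnorm c + 1) + (rnorm c * C + C).
have K0 : 0 <= K by rewrite !addr_ge0 ?mulr_ge0 ?addr_ge0 ?rnorm_ge0.
apply: rnorm_le_eps => r r0.
have e0 : 0 < r / (K + 1) by rewrite divr_gt0// ltr_wpDl.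
have [[y w] /= yw uy] := approx u e0; have [[y' w'] /= yw' vy] := approx v e0.
set e := r / (K + 1) in e0 uy vy.
apply: (@le_trans _ _ (K * e)); last first.
  rewrite /e mulrA ler_pdivrMr ?ltr_wpDl// mulrC ler_wpM2l ?(ltW r0)//.
  by rewrite lerDl.
apply: le_trans (rnormB _ (c *: w + w') _) _; rewrite /K mulrDl lerD//.
  apply: le_trans (GP _ _ _ (graph_linear c yw yw')) _.
  rewrite -mulrA ler_wpM2l//.
  have -> : c *: u + v - (c *: y + y') = c *: (u - y) + (v - y').
    by rewrite scalerBr opprD addrACA.
  apply: le_trans (rnormD _ _) _; rewrite rnormZ mulrDl mul1r lerD//.
  by rewrite ler_wpM2l// rnorm_ge0.
have -> : c *: w + w' - (c *: G u + G v) = c *: (w - G u) + (w' - G v).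
  by rewrite scalerBr opprD addrACA.
apply: le_trans (rnormD _ _) _; rewrite rnormZ mulrDl lerD//.
  rewrite -mulrA ler_wpM2l ?rnorm_ge0// rnormBC; apply: le_trans (GP _ _ _ yw) _.
  by rewrite ler_wpM2l.
by rewrite rnormBC; apply: le_trans (GP _ _ _ yw') _; rewrite ler_wpM2l.
Qed.

End BoundedExtension.

(** * Matrix units of a finite direct sum of matrix algebras *)

Section MatrixUnits.
Variables (R : realType) (m : nat) (n : 'I_m -> nat).
Local Notation A := (fdalg R n).
Local Notation unit := (munit_index n).
Local Notation T_ := (fun k : 'I_m => 'I_(n k).+1 * 'I_(n k).+1)%type.
Implicit Types (u v w : unit) (x y : A).

Let tag_inj k (p q : 'I_(n k).+1) : Tagged (fun k => 'I_(n k).+1) p =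
  Tagged (fun k => 'I_(n k).+1) q -> p = q.
Proof. by move/eqP; rewrite eq_Tagged => /eqP. Qed.

Definition munit_rng u : {k : 'I_m & 'I_(n k).+1} :=
  Tagged (fun k => 'I_(n k).+1) (tagged u).1.
Definition munit_src u : {k : 'I_m & 'I_(n k).+1} :=
  Tagged (fun k => 'I_(n k).+1) (tagged u).2.
Definition munit_adj u : unit := Tagged T_ ((tagged u).2, (tagged u).1).
Definition munit_diag (r : {k : 'I_m & 'I_(n k).+1}) : unit :=
  Tagged T_ (tagged r, tagged r).
(* Only meaningful when [munit_src u = munit_rng v]. *)
Definition munit_comp u v : unit :=
  Tagged T_ ((tagged u).1, (tagged_as u v).2).
Definition munit_upper u : bool := ((tagged u).1 <= (tagged u).2)%N.
Definition coord x u : R[i] := x (tag u) (tagged u).1 (tagged u).2.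

Lemma coordP x y : (forall u, coord x u = coord y u) -> x = y.
Proof.
move=> xy; apply: functional_extensionality_dep => k; apply/matrixP => p q.
exact: (xy (Tagged T_ (p, q))).
Qed.

Lemma munitK u : Tagged T_ ((tagged u).1, (tagged u).2) = u.
Proof. by case: u => k [p q]. Qed.

Lemma coord_munit u v : coord (munit R u) v = (v == u)%:R.
Proof. by rewrite /coord mxE munitK. Qed.

Lemma coordD x y u : coord (x + y) u = coord x u + coord y u.
Proof. by rewrite /coord mxE. Qed.

Lemma coordZ c x u : coord (c *: x) u = c * coord x u.
Proof. by rewrite /coord mxE. Qed.

Lemma coord0 u : coord 0 u = 0.
Proof. by rewrite /coord mxE. Qed.

Lemma coord_sum (I : Type) (s : seq I) (P : pred I) (F : I -> A) u :
  coord (\sum_(i <- s | P i) F i) u = \sum_(i <- s | P i) coord (F i) u.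
Proof.
by elim/big_rec2: _ => [|i a b _ <-]; rewrite ?coord0 ?coordD.
Qed.

Lemma coord_sumE x : x = \sum_u coord x u *: munit R u.
Proof.
apply: coordP => v; rewrite coord_sum (bigD1 v)//= big1 => [|u uv].
  by rewrite coordZ coord_munit eqxx mulr1 addr0.
by rewrite coordZ coord_munit eq_sym (negPf uv) mulr0.
Qed.

Lemma fd_upperE x : fd_upper x <-> forall u, ~~ munit_upper u -> coord x u = 0.
Proof.
split=> [ux u|ux k p q qp]; first by rewrite /munit_upper -ltnNge; exact: ux.
by have := ux (Tagged T_ (p, q)); rewrite /munit_upper -ltnNge; exact.
Qed.

Lemma munit_is_upper u : munit_upper u -> fd_upper (munit R u).
Proof.
move=> uu; apply/fd_upperE => v vl; rewrite coord_munit; case: eqP => // vu.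
by rewrite vu uu in vl.
Qed.

(** Equalities of matrix units are proved through this criterion, which confines the transport along
    equal block indices to one place. *)
Lemma rng_src_inj u v : munit_rng u = munit_rng v -> munit_src u = munit_src v -> u = v.
Proof.
case: u v => k [p q] [l [p' q']] pp; have kl : k = l := congr1 tag pp.
by subst l; move: pp => /tag_inj/= -> /tag_inj/= ->.
Qed.

Lemma rng_adj u : munit_rng (munit_adj u) = munit_src u. Proof. by []. Qed.
Lemma src_adj u : munit_src (munit_adj u) = munit_rng u. Proof. by []. Qed.
Lemma adjK : involutive munit_adj. Proof. by case=> k [p q]. Qed.

Lemma rng_diag r : munit_rng (munit_diag r) = r.
Proof. by case: r. Qed.

Lemma src_diag r : munit_src (munit_diag r) = r.
Proof. by case: r. Qed.

Lemma adj_diag r : munit_adj (munit_diag r) = munit_diag r.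
Proof. by []. Qed.

Lemma upper_diag r : munit_upper (munit_diag r).
Proof. by rewrite /munit_upper leqnn. Qed.

Lemma rng_comp u v : munit_rng (munit_comp u v) = munit_rng u.
Proof. by []. Qed.

Lemma src_comp u v : munit_src u = munit_rng v -> munit_src (munit_comp u v) = munit_src v.
Proof.
case: u v => k [p q] [l [q' r]] e; have kl : k = l := congr1 tag e.
by subst l; rewrite /munit_src /munit_comp tagged_asE.
Qed.

Lemma upper_comp u v : munit_src u = munit_rng v ->
  munit_upper u -> munit_upper v -> munit_upper (munit_comp u v).
Proof.
case: u v => k [p q] [l [q' r]] e; have kl : k = l := congr1 tag e.
subst l; move: e => /tag_inj/= <-.
by rewrite /munit_upper /munit_comp tagged_asE/=; exact: leq_trans.
Qed.

Lemma munit_mul u v : fd_mul (munit R u) (munit R v) =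
  if munit_src u == munit_rng v then munit R (munit_comp u v) else 0.
Proof.
apply: coordP => -[k [p r]].
have -> : coord (fd_mul (munit R u) (munit R v)) (Tagged T_ (p, r)) =
    \sum_s (Tagged T_ (p, s) == u)%:R * (Tagged T_ (s, r) == v)%:R.
  by rewrite /coord/= /fd_mul mxE; apply: eq_bigr => s _; congr (_ * _); rewrite mxE.
case: eqP => uv; last first.
  rewrite coord0 big1// => s _; case: eqP => [us|]; last by rewrite mul0r.
  case: eqP => [vs|]; last by rewrite mulr0.
  by case: uv; rewrite -us -vs.
rewrite coord_munit; case: u v uv => k1 [p1 q] [k2 [q' r2]] e.
have kl : k1 = k2 := congr1 tag e.
subst k2; move: e => /tag_inj/= <-.
rewrite /munit_comp tagged_asE /=.
have [kk|kk] := eqVneq k k1; last first.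
  have ne (a : 'I_(n k).+1 * 'I_(n k).+1) (b : 'I_(n k1).+1 * 'I_(n k1).+1) :
      (Tagged T_ a == Tagged T_ b :> unit) = false.
    by apply/negbTE; apply: contra_neq kk => /(congr1 tag).
  by rewrite ne big1// => t _; rewrite ne mul0r.
subst k1; rewrite eq_Tagged/= xpair_eqE (bigD1 q)//= big1 ?addr0 => [|t tq].
  by rewrite !eq_Tagged/= !xpair_eqE !eqxx andbT /= -natrM mulnb.
by rewrite eq_Tagged/= xpair_eqE (negPf tq) andbF mul0r.
Qed.

Lemma munit_star u : fd_star (munit R u) = munit R (munit_adj u).
Proof.
apply: coordP => -[k [p q]]; rewrite coord_munit /coord/= /fd_star !mxE.
rewrite rmorph_nat; congr (nat_of_bool _)%:R; apply/eqP/eqP => [<-//|e].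
by rewrite -[u]adjK -e.
Qed.

End MatrixUnits.

(** * Projections and matrix units in the limit C*-algebra *)

Section CStarTheory.
Variables (R : realType) (A : cstarAlgebra R).
Local Notation "x ** y" := (cs_mul A x y) (at level 40, left associativity).
Local Notation star := (@cs_star R A).
Implicit Types (x y z p q : A) (c : R[i]).

Lemma cs_mulDl x y z : (x + y) ** z = x ** z + y ** z.
Proof. exact: linearDl. Qed.
Lemma cs_mulDr x y z : z ** (x + y) = z ** x + z ** y.
Proof. exact: linearDr. Qed.
Lemma cs_mul4 x y z p : x ** y ** (z ** p) = x ** (y ** z) ** p.
Proof. by rewrite !cs_mulA. Qed.
Lemma cs_mul5 x y z p q : x ** y ** z ** (p ** q) = x ** (y ** z ** p) ** q.
Proof. by rewrite !cs_mulA. Qed.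
Lemma cs_mulZl c x z : (c *: x) ** z = c *: (x ** z).
Proof. exact: linearZl_LR. Qed.
Lemma cs_mulZr c x z : z ** (c *: x) = c *: (z ** x).
Proof. exact: linearZr_LR. Qed.
Lemma cs_mul0l z : 0 ** z = 0.
Proof. by have := cs_mulZl 0 0 z; rewrite !scale0r. Qed.
Lemma cs_mul0r z : z ** 0 = 0.
Proof. by have := cs_mulZr 0 0 z; rewrite !scale0r. Qed.
Lemma cs_mulNl x z : (- x) ** z = - (x ** z).
Proof. by rewrite -scaleN1r cs_mulZl scaleN1r. Qed.
Lemma cs_mulNr x z : z ** (- x) = - (z ** x).
Proof. by rewrite -scaleN1r cs_mulZr scaleN1r. Qed.
Lemma cs_mulBl x y z : (x - y) ** z = x ** z - y ** z.
Proof. by rewrite cs_mulDl cs_mulNl. Qed.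
Lemma cs_mulBr x y z : z ** (x - y) = z ** x - z ** y.
Proof. by rewrite cs_mulDr cs_mulNr. Qed.
Lemma cs_mul_suml (I : Type) (s : seq I) (P : pred I) (F : I -> A) z :
  (\sum_(i <- s | P i) F i) ** z = \sum_(i <- s | P i) F i ** z.
Proof. by elim/big_rec2: _ => [|i a b _ <-]; rewrite ?cs_mul0l ?cs_mulDl. Qed.
Lemma cs_mul_sumr (I : Type) (s : seq I) (P : pred I) (F : I -> A) z :
  z ** (\sum_(i <- s | P i) F i) = \sum_(i <- s | P i) z ** F i.
Proof. by elim/big_rec2: _ => [|i a b _ <-]; rewrite ?cs_mul0r ?cs_mulDr. Qed.

Lemma cs_starD x y : star (x + y) = star x + star y.
Proof. by have := cs_star_semilinear 1 x y; rewrite conjC1 !scale1r. Qed.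
Lemma cs_star0 : star 0 = 0.
Proof. by apply: (@addrI _ (star 0)); rewrite -cs_starD !addr0. Qed.
Lemma cs_starZ c x : star (c *: x) = Num.conj c *: star x.
Proof. by have := cs_star_semilinear c x 0; rewrite cs_star0 !addr0. Qed.
Lemma cs_starN x : star (- x) = - star x.
Proof. by apply/eqP; rewrite -addr_eq0 -cs_starD addNr cs_star0. Qed.
Lemma cs_starB x y : star (x - y) = star x - star y.
Proof. by rewrite cs_starD cs_starN. Qed.
Lemma cs_star_sum (I : Type) (s : seq I) (P : pred I) (F : I -> A) :
  star (\sum_(i <- s | P i) F i) = \sum_(i <- s | P i) star (F i).
Proof. by elim/big_rec2: _ => [|i a b _ <-]; rewrite ?cs_star0 ?cs_starD. Qed.

Lemma rnorm_mul x y : rnorm (x ** y) <= rnorm x * rnorm y.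
Proof. by rewrite -lecR rmorphM/= -!rnormE cs_norm_mul. Qed.

Lemma rnorm_star_mul x : rnorm (star x ** x) = rnorm x ^+ 2.
Proof. by apply: complexI; rewrite rmorphXn/= -!rnormE cs_norm_star. Qed.

Lemma star_mul_eq0 x : star x ** x = 0 -> x = 0.
Proof.
move=> xx; apply: rnorm_eq0; have := rnorm_star_mul x.
by rewrite xx rnorm0 => /esym/eqP; rewrite sqrf_eq0 => /eqP ->.
Qed.

Lemma rnorm_star x : rnorm (star x) = rnorm x.
Proof.
have le z : rnorm z <= rnorm (star z).
  have [z0|z0] := eqVneq (rnorm z) 0; first by rewrite z0 rnorm_ge0.
  have zp : 0 < rnorm z by rewrite lt_def z0 rnorm_ge0.
  by rewrite -(ler_pM2r zp) -expr2 -rnorm_star_mul rnorm_mul.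
by apply/eqP; rewrite eq_le le andbT -{2}(cs_starK x) le.
Qed.

Definition projection p := star p = p /\ p ** p = p.

(* [(p - q p)^* (p - q p) = p - p q p] for projections [p] and [q]. *)
Lemma projection_below p q : projection p -> projection q ->
  p ** q ** p = p -> q ** p = p.
Proof.
move=> [sp pp] [sq qq] pqp; apply/eqP; rewrite eq_sym -subr_eq0; apply/eqP.
apply: star_mul_eq0; rewrite cs_starB cs_starM sp sq cs_mulBl !cs_mulBr pp.
rewrite !cs_mulA pqp -(cs_mulA p q q) qq pqp.
by rewrite subrr.
Qed.

Lemma projection_belowC p q : projection p -> projection q ->
  q ** p = p -> p ** q = p.
Proof. by move=> [sp _] [sq _] /(congr1 star); rewrite cs_starM sp sq. Qed.

End CStarTheory.

Section LimitUnits.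
Variables (R : realType) (S : taf_system R) (L : af_limit S).
Local Notation "x ** y" := (cs_mul L x y) (at level 40, left associativity).
Local Notation star := (@cs_star R L).
Local Notation idx j := (munit_index (@bsize R S j)).

(* Matrix units of the limit are sealed: comparing two of them by conversion
   would compare matrices entry by entry. *)
Fact unit_in_seal : {f : forall j, idx j -> L | forall j u, f j u = af_in L j (munit R u)}.
Proof. by exists (fun j u => af_in L j (munit R u)). Qed.
Definition unit_in j (u : idx j) : L := sval unit_in_seal j u.

Lemma unit_inE j (u : idx j) : unit_in u = af_in L j (munit R u).
Proof. exact: (svalP unit_in_seal). Qed.

Fact diag_in_seal : {f : forall j, {k & 'I_(@bsize R S j k).+1} -> L |
  forall j r, f j r = unit_in (munit_diag r)}.
Proof. by exists (fun j r => unit_in (munit_diag r)). Qed.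
Definition diag_in j (r : {k & 'I_(@bsize R S j k).+1}) : L := sval diag_in_seal j r.

Lemma diag_inE j r : @diag_in j r = unit_in (munit_diag r).
Proof. exact: (svalP diag_in_seal). Qed.

End LimitUnits.

Section LimitUnitsTheory.
Variables (R : realType) (S : taf_system R) (L : af_limit S).
Local Notation "x ** y" := (cs_mul L x y) (at level 40, left associativity).
Local Notation star := (@cs_star R L).
Local Notation idx j := (munit_index (@bsize R S j)).
Local Notation E := (@unit_in R S L _).
Local Notation P := (@diag_in R S L _).

Lemma unit_neq0 j (u : idx j) : E u != 0.
Proof.
apply/eqP; rewrite unit_inE => u0; have : munit R u = 0.
  by apply: (@af_in_inj _ _ L j); rewrite u0 linear0.
by move=> /(congr1 (fun x => @coord R _ (@bsize R S j) x u))/eqP; rewrite coord_munit eqxx coord0 oner_eq0.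
Qed.

Lemma unit_scaleI j (u : idx j) : injective (fun c => c *: E u).
Proof.
move=> c d /eqP; rewrite -subr_eq0 -scalerBl scaler_eq0 (negPf (unit_neq0 u)) orbF.
by rewrite subr_eq0 => /eqP.
Qed.

Lemma unit_mul j (u v : idx j) : munit_src u = munit_rng v ->
  E u ** E v = E (munit_comp u v).
Proof. by move=> uv; rewrite !unit_inE -af_inM munit_mul uv eqxx. Qed.

Lemma unit_mul0 j (u v : idx j) : munit_src u != munit_rng v -> E u ** E v = 0.
Proof. by move=> uv; rewrite !unit_inE -af_inM munit_mul (negPf uv) linear0. Qed.

Lemma unit_star j (u : idx j) : star (E u) = E (munit_adj u).
Proof. by rewrite !unit_inE -af_in_star munit_star. Qed.

Lemma unit_adjr j (u : idx j) : E u ** E (munit_adj u) = P (munit_rng u).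
Proof.
rewrite (@unit_mul j u (munit_adj u) erefl) diag_inE; apply: (congr1 (@unit_in R S L j)).
by apply: rng_src_inj; rewrite ?rng_diag// src_comp// src_diag.
Qed.

Lemma unit_adjl j (u : idx j) : E (munit_adj u) ** E u = P (munit_src u).
Proof. by rewrite -{2}(adjK u) unit_adjr. Qed.

Lemma diag_unit j (u : idx j) : P (munit_rng u) ** E u = E u.
Proof.
have e := src_diag (munit_rng u); rewrite diag_inE (unit_mul e).
apply: (congr1 (@unit_in R S L j)).
by apply: rng_src_inj; rewrite ?src_comp// rng_comp rng_diag.
Qed.

Lemma unit_diag j (u : idx j) : E u ** P (munit_src u) = E u.
Proof.
have e := esym (rng_diag (munit_src u)); rewrite diag_inE (unit_mul e).
apply: (congr1 (@unit_in R S L j)).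
by apply: rng_src_inj; rewrite ?rng_comp// src_comp ?src_diag.
Qed.

Lemma diag_unit0 j r (u : idx j) : r != munit_rng u -> P r ** E u = 0.
Proof. by move=> ru; rewrite diag_inE unit_mul0// src_diag. Qed.

Lemma unit_diag0 j r (u : idx j) : munit_src u != r -> E u ** P r = 0.
Proof. by move=> ru; rewrite diag_inE unit_mul0// rng_diag. Qed.

Lemma diag_in_neq0 j r : @diag_in R S L j r != 0.
Proof. by rewrite diag_inE unit_neq0. Qed.

Lemma diag_mul0 j r s : r != s -> @diag_in R S L j r ** P s = 0.
Proof. by move=> rs; rewrite [P s]diag_inE diag_unit0// rng_diag. Qed.

Lemma diag_projection j (r : {k & 'I_(@bsize R S j k).+1}) : projection (P r).
Proof.
split; first by rewrite diag_inE unit_star adj_diag.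
by have := diag_unit (munit_diag r); rewrite rng_diag -diag_inE.
Qed.

Lemma rnorm_unit j (u : idx j) : rnorm (E u) = 1.
Proof.
have nP r : rnorm (@diag_in R S L j r) = 1.
  have [sp pp] := diag_projection r; have := rnorm_star_mul (P r).
  rewrite sp pp expr2 => /esym/eqP; rewrite -subr_eq0 -{3}[rnorm _]mulr1 -mulrBr.
  rewrite mulf_eq0 => /orP[/eqP p0|]; last by rewrite subr_eq0 => /eqP.
  by have := unit_neq0 (munit_diag r); rewrite -diag_inE [P _]rnorm_eq0 ?eqxx// p0.
apply/eqP; rewrite -(@eqrXn2 _ 2)// ?rnorm_ge0// expr1n.
by rewrite -rnorm_star_mul unit_star unit_adjl nP.
Qed.

Lemma rnorm_diag j r : rnorm (@diag_in R S L j r) = 1.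
Proof. by rewrite diag_inE rnorm_unit. Qed.

Lemma af_in_coord j x : af_in L j x = \sum_u coord x u *: E u.
Proof.
rewrite [x in LHS]coord_sumE linear_sum; apply: eq_bigr => u _.
by rewrite linearZ unit_inE.
Qed.

Lemma compress_coord j x (u : idx j) :
  P (munit_rng u) ** af_in L j x ** P (munit_src u) = coord x u *: E u.
Proof.
rewrite af_in_coord cs_mul_sumr cs_mul_suml (bigD1 u)//= big1 ?addr0 => [|v vu].
  by rewrite cs_mulZr cs_mulZl diag_unit unit_diag.
rewrite cs_mulZr cs_mulZl; have [ru|ru] := eqVneq (munit_rng u) (munit_rng v).
  rewrite -cs_mulA.
  have sv : munit_src v != munit_src u.
    by apply: contra_neq vu => sv; apply: rng_src_inj.
  by rewrite (unit_diag0 sv) cs_mul0r scaler0.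
by rewrite diag_unit0// cs_mul0l scaler0.
Qed.

(** Compression by two projections of norm 1 leaves the entry times a matrix unit of norm 1. This
    bounds every form that reads a single entry. *)
Lemma coord_le j x (u : idx j) : rnorm (coord x u) <= rnorm (af_in L j x).
Proof.
rewrite -[leLHS]mulr1 -(rnorm_unit u) -rnormZ -compress_coord.
apply: le_trans (rnorm_mul _ _) _; rewrite rnorm_diag mulr1.
by apply: le_trans (rnorm_mul _ _) _; rewrite rnorm_diag mul1r.
Qed.

Lemma af_in_lift i j x : (i <= j)%N -> exists y, af_in L j y = af_in L i x.
Proof.
elim: j => [|j IH]; first by rewrite leqn0 => /eqP i0; subst i; exists x.
rewrite leq_eqVlt => /predU1P[ij|]; first by subst i; exists x.
by rewrite ltnS => /IH[y <-]; exists (emb S j y); rewrite af_in_emb.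
Qed.

(** Regularity is iterated through the levels with natural multiplicities, since a unit could a
    priori be reached in several ways; that this does not happen is a matter of norms, treated
    next. *)
Lemma unit_nat_comb i j (u : idx i) : (i <= j)%N ->
  exists N : idx j -> nat, E u = \sum_v (N v)%:R *: E v.
Proof.
elim: j => [|j IH].
  rewrite leqn0 => /eqP i0; subst i; exists (fun v => v == u).
  by rewrite (bigD1 u)//= big1 ?addr0 ?eqxx ?scale1r// => v /negPf ->; rewrite scale0r.
rewrite leq_eqVlt => /predU1P[ij|].
  subst i; exists (fun v => v == u).
  by rewrite (bigD1 u)//= big1 ?addr0 ?eqxx ?scale1r// => v /negPf ->; rewrite scale0r.
rewrite ltnS => /IH[N ->].
have reg (v : idx j) : exists V : {set idx j.+1}, E v = \sum_(w in V) E w.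
  have [V vV] := emb_regular v; exists V.
  rewrite unit_inE -af_in_emb vV linear_sum.
  by apply: eq_bigr => w _; rewrite unit_inE.
have [V VP] := choice reg.
exists (fun w => \sum_v (N v * (w \in V v)))%N.
transitivity (\sum_v \sum_w (N v * (w \in V v))%:R *: E w).
  apply: eq_bigr => v _; rewrite VP scaler_sumr big_mkcond; apply: eq_bigr => w _.
  by case: ifP => _; rewrite ?muln1// muln0 scale0r.
rewrite exchange_big; apply: eq_bigr => w _.
by rewrite -scaler_suml natr_sum.
Qed.

(** Cutting [E u] down to the row [r] gives an element of norm at most 1, whose product with its
    adjoint is the sum of the squared multiplicities times [P r]. So a row holds at most one
    non-zero multiplicity, and it is 1. *)
Lemma nat_comb_row i j (u : idx i) (N : idx j -> nat) r :
  E u = \sum_v (N v)%:R *: E v ->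
  (\sum_(v | munit_rng v == r) N v ^ 2 <= 1)%N.
Proof.
move=> uN; pose y := \sum_(v | munit_rng v == r) (N v)%:R *: E v.
have yE : P r ** E u = y.
  rewrite uN cs_mul_sumr (bigID (fun v => munit_rng v == r))/= [X in _ + X]big1.
    rewrite addr0; apply: eq_bigr => v /eqP <-.
    by rewrite cs_mulZr diag_unit.
  by move=> v vr; rewrite cs_mulZr diag_unit0 ?scaler0// eq_sym.
have y1 : rnorm y <= 1.
  rewrite -yE; apply: le_trans (rnorm_mul _ _) _.
  by rewrite rnorm_diag mul1r rnorm_unit.
have yy : y ** star y = (\sum_(v | munit_rng v == r) N v ^ 2)%N%:R *: P r.
  rewrite {1}/y cs_mul_suml natr_sum scaler_suml; apply: eq_bigr => v /eqP vr.
  rewrite cs_mulZl cs_star_sum cs_mul_sumr (bigD1 v)/=; last by rewrite vr.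
  rewrite big1 ?addr0 => [|w /andP[/eqP wr wv]].
    rewrite cs_starZ unit_star conjC_nat cs_mulZr unit_adjr vr scalerA.
    by rewrite -natrM mulnn.
  rewrite cs_starZ unit_star cs_mulZr.
  have vw : munit_src v != munit_rng (munit_adj w).
    by apply: contra_neq wv; rewrite rng_adj => vw; apply: rng_src_inj; rewrite ?wr ?vr.
  by rewrite (unit_mul0 vw) scaler0.
have : rnorm (y ** star y) <= 1.
  by rewrite -{1}(cs_starK y) rnorm_star_mul rnorm_star expr_le1 ?rnorm_ge0.
rewrite yy rnormZ rnorm_diag mulr1.
by rewrite -lecR -rnormE normr_nat lern1.
Qed.

(** The row estimate makes the multiplicities 0 or 1 and separates ranges; applied to the adjoint it
    separates sources. Summands of an upper triangular unit are upper triangular because its image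
    at level [j] is an upper triangular matrix, whose entries they are. *)
Lemma unit_decompose i j (u : idx i) : (i <= j)%N -> exists V : {set idx j},
  [/\ E u = \sum_(v in V) E v,
      {in V &, injective (@munit_rng _ (@bsize R S j))},
      {in V &, injective (@munit_src _ (@bsize R S j))},
      munit_upper u -> forall v, v \in V -> munit_upper v
    & munit_upper (munit_adj u) -> forall v, v \in V -> munit_upper (munit_adj v)].
Proof.
move=> ij; have [N uN] := unit_nat_comb u ij.
have auN : E (munit_adj u) = \sum_v (N (munit_adj v))%:R *: E v.
  rewrite -unit_star uN cs_star_sum (reindex_inj (can_inj (@adjK _ _))).
  by apply: eq_bigr => v _; rewrite cs_starZ conjC_nat unit_star adjK.
have row (w : idx i) M r (wM : E w = \sum_v (M v)%:R *: E v) (v v' : idx j) :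
    munit_rng v = r -> munit_rng v' = r -> M v != 0%N -> M v' != 0%N -> v = v'.
  move=> vr vr' Mv Mv'; have := @nat_comb_row i j w M r wM.
  apply: contraTeq => vv'; rewrite -ltnNge (bigD1 v)/=; last by rewrite vr.
  rewrite (bigD1 v')/=; last by rewrite vr' eqxx eq_sym.
  rewrite addnA ltn_addr// -[2%N]/(1 + 1)%N.
  by rewrite leq_add// expn_gt0 lt0n ?Mv ?Mv'.
have N1 v : N v != 0%N -> N v = 1%N.
  move=> Nv; have := @nat_comb_row i j u N (munit_rng v) uN.
  rewrite (bigD1 v)//= => /(leq_trans (leq_addr _ _)).
  by case: (N v) Nv => [|[|k]].
pose V := finset (fun v => N v != 0%N).
have uV : E u = \sum_(v in V) E v.
  rewrite uN big_mkcond; rewrite [RHS]big_mkcond; apply: eq_bigr => v _.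
  by rewrite finset.in_set; case: eqP => [->|/eqP/N1 ->] /=; rewrite ?scale0r ?scale1r.
have up (w : idx i) (W : {set idx j}) : E w = \sum_(v in W) E v -> munit_upper w ->
    forall v, v \in W -> munit_upper v.
  move=> wW /munit_is_upper-/(_ R)/(taf_union_level L ij)[y uy yw] v vW.
  apply/negPn/negP => vl; move/fd_upperE: uy => /(_ v vl).
  have -> : y = \sum_(v in W) munit R v.
    apply: (@af_in_inj _ _ L j); rewrite yw linear_sum -unit_inE wW.
    by apply: eq_bigr => x _; rewrite unit_inE.
  rewrite coord_sum (bigD1 v)//= big1 => [|x /andP[_ xv]].
    by rewrite coord_munit eqxx addr0 => /eqP; rewrite oner_eq0.
  by rewrite coord_munit eq_sym (negPf xv).
exists V; split => //.
- move=> v v'; rewrite !finset.in_set => Nv Nv' vv'.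
  exact: (@row u N (munit_rng v) uN v v').
- move=> v v'; rewrite !finset.in_set => Nv Nv' vv'; apply: (can_inj (@adjK _ _)).
  by apply: (@row _ _ (munit_src v) auN) => //; rewrite adjK.
- exact: up.
- have aV : E (munit_adj u) = \sum_(v in (@munit_adj _ _ @: V)%SET) E v.
    rewrite -unit_star uV cs_star_sum big_imset/=; last first.
      by move=> v v' _ _; exact: (can_inj (@adjK _ _)).
    by apply: eq_bigr => v _; rewrite unit_star.
  by move=> uu v vV; apply: (up _ _ aV uu); exact: imset_f.
Qed.

(* [v] is the summand of [u] with source [munit_src v] in a later level. *)
Definition part i j (u : idx i) (v : idx j) : Prop := E u ** P (munit_src v) = E v.

Lemma unit_lift i j (u : idx i) s : (i <= j)%N -> E u ** @diag_in R S L j s <> 0 ->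
  exists v : idx j, [/\ munit_src v = s, part u v,
    munit_upper u -> munit_upper v
    & munit_upper (munit_adj u) -> munit_upper (munit_adj v)].
Proof.
move=> ij us0; have [V [uV _ srcI upV lowV]] := unit_decompose u ij.
have [v /andP[vV /eqP vs]|none] := pickP (fun v => (v \in V) && (munit_src v == s)).
  exists v; split => // [|uu|uu]; [|exact: upV|exact: lowV].
  have z w : (w \in V) && (w != v) -> E w ** P (munit_src v) = 0.
    move=> /andP[wV wv]; apply: unit_diag0; apply: contra_neq wv => wv.
    exact: srcI.
  rewrite /part uV cs_mul_suml (bigD1 v vV) /=.
  by rewrite (big1 _ _ _ z) addr0; exact: unit_diag.
case: us0; rewrite uV cs_mul_suml big1// => v vV; apply: unit_diag0.
by have := none v; rewrite vV /= => ->.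
Qed.

Lemma part_rng i j (u : idx i) (v : idx j) : part u v ->
  P (munit_rng u) ** P (munit_rng v) = P (munit_rng v).
Proof. by move=> uv; rewrite -(unit_adjr v) -uv !cs_mulA diag_unit. Qed.

Lemma part_src i j (u : idx i) (v : idx j) : part u v ->
  P (munit_src u) ** P (munit_src v) = P (munit_src v).
Proof.
move=> uv; apply: projection_below; [exact: diag_projection|exact: diag_projection|].
rewrite -[RHS](unit_adjl v) -unit_star -uv cs_starM (diag_projection _).1 unit_star.
by rewrite cs_mul4 (unit_adjl u).
Qed.

(** The range and source projections of [v] lie under those of [u], so the compression that reads
    the entry [v] factors through the one that reads [u]. *)
Lemma part_coord i j (u : idx i) (v : idx j) x y : part u v ->
  af_in L j y = af_in L i x -> coord y v = coord x u.
Proof.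
move=> uv yx; apply: (@unit_scaleI j v) => /=; rewrite -compress_coord yx.
have [sP _] := diag_projection (munit_rng v); have [sQ _] := diag_projection (munit_rng u).
have pr : P (munit_rng v) ** P (munit_rng u) = P (munit_rng v).
  apply: projection_belowC; [exact: diag_projection|exact: diag_projection|].
  exact: part_rng.
rewrite -pr -(part_src uv) cs_mul5 compress_coord.
by rewrite cs_mulZr cs_mulZl -cs_mulA uv diag_unit.
Qed.

End LimitUnitsTheory.

(** * Forms carried by one matrix unit at each high level *)

Section Levels.
Variables (R : realType) (S : taf_system R) (L : af_limit S).
Local Notation A := (taf L).
Local Notation idx j := (munit_index (@bsize R S j)).

(* Only meaningful when [x] is upper triangular (it is 0 otherwise). *)
Fact taf_in_seal : {f : forall j, fdalg R (@bsize R S j) -> A |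
  forall j x, f j x = insubd (0 : A) (af_in L j x)}.
Proof. by exists (fun j x => insubd (0 : A) (af_in L j x)). Qed.
Definition taf_in j (x : fdalg R (@bsize R S j)) : A := sval taf_in_seal j x.

Fact taf_unit_seal : {f : forall j, idx j -> A | forall j u, f j u = taf_in (munit R u)}.
Proof. by exists (fun j u => taf_in (munit R u)). Qed.
Definition taf_unit j (u : idx j) : A := sval taf_unit_seal j u.

Lemma taf_unitE j (u : idx j) : taf_unit u = taf_in (munit R u).
Proof. exact: (svalP taf_unit_seal). Qed.

Lemma val_taf_in j x : fd_upper x -> \val (@taf_in j x) = af_in L j x.
Proof.
move=> ux; rewrite /taf_in (svalP taf_in_seal) val_insubd; case: ifPn => // /asboolP[].
by apply: subset_closure; exists j => //; exists x.
Qed.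

Lemma val_taf_unit j (u : idx j) : munit_upper u -> \val (taf_unit u) = unit_in L u.
Proof. by move=> uu; rewrite taf_unitE val_taf_in ?unit_inE//; exact: munit_is_upper. Qed.

End Levels.

Section Germs.
Variables (R : realType) (S : taf_system R) (L : af_limit S).
Local Notation A := (taf L).
Local Notation idx j := (munit_index (@bsize R S j)).
Local Notation taf_in := (@taf_in R S L _).
Local Notation taf_unit := (@taf_unit R S L _).

Lemma fd_upper_lin j c (x y : fdalg R (@bsize R S j)) :
  fd_upper x -> fd_upper y -> fd_upper (c *: x + y).
Proof. by move=> ux uy k p q qp; rewrite !mxE ux// uy// mulr0 addr0. Qed.

Lemma fd_upper0 j : fd_upper (0 : fdalg R (@bsize R S j)).
Proof. by move=> k p q _; rewrite mxE. Qed.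

Lemma taf_in_lin j c x y : fd_upper x -> fd_upper y ->
  (taf_in ((c *: x + y) : fdalg R (@bsize R S j))) = c *: taf_in x + taf_in y.
Proof.
move=> ux uy; apply: val_inj.
by rewrite linearP /= !val_taf_in ?linearP//; exact: fd_upper_lin.
Qed.

Lemma taf_in0 j : (taf_in (0 : fdalg R (@bsize R S j))) = 0.
Proof. by apply: val_inj; rewrite val_taf_in ?linear0//; exact: fd_upper0. Qed.

Lemma val_taf_mul (a b : A) : \val (taf_mul a b) = cs_mul L (\val a) (\val b).
Proof. by []. Qed.

Lemma val_taf0 : \val (0 : A) = 0. Proof. by []. Qed.

Lemma val_tafB (a b : A) : \val (a - b) = \val a - \val b. Proof. by []. Qed.

Lemma val_tafZ c (a : A) : \val (c *: a) = c *: \val a. Proof. by []. Qed.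

Lemma taf_unit_mul j (u v : idx j) : munit_src u = munit_rng v ->
  munit_upper u -> munit_upper v ->
  taf_mul (taf_unit u) (taf_unit v) = taf_unit (munit_comp u v).
Proof.
move=> uv uu vu; apply: val_inj.
rewrite val_taf_mul (val_taf_unit L uu) (val_taf_unit L vu).
by rewrite (val_taf_unit L (upper_comp uv uu vu)) unit_mul.
Qed.

Lemma taf_unit_mul0 j (u v : idx j) : munit_src u != munit_rng v ->
  munit_upper u -> munit_upper v -> taf_mul (taf_unit u) (taf_unit v) = 0.
Proof.
move=> uv uu vu; apply: val_inj.
by rewrite val_taf_mul (val_taf_unit L uu) (val_taf_unit L vu) unit_mul0.
Qed.

Lemma munitsP j (e : A) : munits L j e <-> exists2 u : idx j, munit_upper u & e = taf_unit u.
Proof.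
split=> [[u uu eu]|[u uu ->]]; exists u => //.
  by apply: val_inj; rewrite val_taf_unit// unit_inE.
by rewrite val_taf_unit// unit_inE.
Qed.

Lemma taf_lift i j x : (i <= j)%N -> fd_upper x -> exists y,
  [/\ fd_upper y, (taf_in (y : fdalg R (@bsize R S j))) = (taf_in (x : fdalg R (@bsize R S i))) & af_in L j y = af_in L i x].
Proof.
move=> ij ux; have [y uy yx] := taf_union_level L ij ux.
by exists y; split => //; apply: val_inj; rewrite !val_taf_in.
Qed.

Lemma taf_dense (a : A) (e : R) : 0 < e -> exists i x, fd_upper x /\
  rnorm (\val a - \val ((taf_in (x : fdalg R (@bsize R S i))))) <= e.
Proof.
move=> e0; have /asboolP/closure_normP/(_ _ e0)[_ [i _ [x ux <-]] ax] := valP a.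
by exists i, x; split => //; rewrite val_taf_in.
Qed.

Section LinearForms.
Variable w : A -> R[i].
Hypothesis wlin : scalar w.

Lemma form0 : w 0 = 0.
Proof. by have := wlin (-1) 0 0; rewrite scaler0 addr0 mulN1r addNr. Qed.

Lemma formD a b : w (a + b) = w a + w b.
Proof. by have := wlin 1 a b; rewrite scale1r mul1r. Qed.

Lemma formB a b : w (a - b) = w a - w b.
Proof.
by rewrite addrC -scaleN1r wlin mulN1r addrC.
Qed.

Lemma form_taf_in j (x : fdalg R (@bsize R S j)) : fd_upper x ->
  w (taf_in x) = \sum_(u | munit_upper u) coord x u * w (taf_unit u).
Proof.
move=> ux; have -> : x = \sum_(u | munit_upper u) coord x u *: munit R u.
  rewrite [LHS]coord_sumE (bigID (@munit_upper _ _))/= [X in _ + X]big1 ?addr0//.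
  by move=> u ul; rewrite (fd_upperE x).1// scale0r.
suff [_ ->] : fd_upper (\sum_(u | munit_upper u) coord x u *: munit R u) /\
    w (taf_in (\sum_(u | munit_upper u) coord x u *: munit R u)) =
    \sum_(u | munit_upper u) coord x u * w (taf_unit u).
  apply: eq_bigr => u uu; congr (_ * _); rewrite coord_sum (bigD1 u)//= big1.
    by rewrite coordZ coord_munit eqxx mulr1 addr0.
  by move=> v /andP[_ vu]; rewrite coordZ coord_munit eq_sym (negPf vu) mulr0.
elim/big_rec2: _ => [|u a b uu [ub wb]].
  by split; [exact: fd_upper0|rewrite taf_in0 form0].
have uup := munit_is_upper R uu.
by split; [exact: fd_upper_lin|rewrite taf_in_lin// wlin wb taf_unitE].
Qed.

End LinearForms.

Lemma dual_form_cst c w : dual_form w -> dual_form (fun a : A => c * w a).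
Proof.
move=> [wl [M wM]]; split; first by move=> d a b; rewrite wl mulrDr mulrCA.
exists (rnorm c * M) => a; rewrite rnormM -mulrA.
by rewrite ler_wpM2l// rnorm_ge0.
Qed.

(** At level [j] the form reads the single entry [e], up to the factor [c]. The spectrum consists of
    the bounded forms that do so with [c = 1] at all large levels. *)
Definition germ (w : A -> R[i]) c j (e : idx j) := munit_upper e /\
  forall x, fd_upper x -> w ((taf_in (x : fdalg R (@bsize R S j)))) = c * coord x e.

Lemma germ_units w c j (e : idx j) : scalar w -> munit_upper e ->
  w (taf_unit e) = c ->
  (forall u, munit_upper u -> u != e -> w (taf_unit u) = 0) -> germ w c e.
Proof.
move=> wl ue we w0; split=> // x ux; rewrite (form_taf_in wl ux) (bigD1 e)//=.
rewrite we big1 ?addr0 ?[c * _]mulrC// => u /andP[uu une].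
by rewrite w0// mulr0.
Qed.

Lemma germ_unit w c j (e u : idx j) : germ w c e -> munit_upper u ->
  w (taf_unit u) = c * (e == u)%:R.
Proof.
by move=> [_ we] uu; rewrite taf_unitE we ?coord_munit//; exact: munit_is_upper.
Qed.

Lemma germ_val w c j (e : idx j) : germ w c e -> w (taf_unit e) = c.
Proof. by move=> we; rewrite (germ_unit we) ?we.1// eqxx mulr1. Qed.

Lemma germ_inj w c d j (e e' : idx j) : c != 0 -> germ w c e -> germ w d e' -> e = e'.
Proof.
move=> c0 we we'; have := germ_unit we we'.1; rewrite (germ_val we').
have := germ_unit we' we.1; rewrite (germ_val we) eq_sym.
case: eqP => // _; rewrite mulr0 => /eqP; by rewrite (negPf c0).
Qed.

(** The value at [e] is the sum of the values at the summands of [e] in level [j]; as it is not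
    zero, the only unit [e'] with a non-zero value is one of them. *)
Lemma germ_part w c i j (e : idx i) (e' : idx j) : (i <= j)%N -> c != 0 ->
  germ w c e -> germ w c e' -> part L e e'.
Proof.
move=> ij c0 we we'; have [V [eV _ srcI upV _]] := unit_decompose L e ij.
have ueV : fd_upper (\sum_(v in V) munit R v).
  move=> k p q qp; have := (fd_upperE (\sum_(v in V) munit R v)).2; apply => //.
  move=> v vl; rewrite coord_sum big1// => x xV; rewrite coord_munit.
  by case: eqP => // vx; rewrite vx (upV we.1) in vl.
have : taf_in (\sum_(v in V) munit R v) = taf_unit e.
  apply: val_inj; rewrite val_taf_in// val_taf_unit ?we.1// eV linear_sum.
  by apply: eq_bigr => v _; rewrite unit_inE.
move=> /(congr1 w); rewrite (germ_val we) we'.2// coord_sum.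
have [e'V|e'V] := boolP (e' \in V); last first.
  rewrite big1 ?mulr0 => [/esym/eqP|v vV]; first by rewrite (negPf c0).
  by rewrite coord_munit; case: eqP => // ev; rewrite ev vV in e'V.
move=> _; rewrite /part eV cs_mul_suml (bigD1 e' e'V)/= big1 ?addr0.
  exact: unit_diag.
move=> v /andP[vV ve]; apply: unit_diag0; apply: contra_neq ve => ve.
exact: srcI.
Qed.

(** On high levels this is [coord_le]; the bound [M] of the form, which may be larger, only enters
    the approximation error. *)
Lemma germ_bound w c : dual_form w -> (\forall j \near \oo, exists e : idx j, germ w c e) ->
  forall a, rnorm (w a) <= rnorm c * rnorm (\val a).
Proof.
move=> [wl [M wM]] [K _ wg] a; apply/ler_addgt0Pr => r r0.
(* One error comes from the form at [a - l], another from the norm of [l]; with e = r / (B + 1) they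
   add up to B e, which is less than r. *)
pose B := `|M| + rnorm c; have B0 : 0 < B + 1.
  by rewrite ltr_wpDl// addr_ge0 ?rnorm_ge0.
have e0 : 0 < r / (B + 1) by rewrite divr_gt0.
set e := r / _ in e0.
have [i [x [ux ax]]] := taf_dense a e0.
have [y [uy yx yx']] := taf_lift (leq_maxl i K) ux.
have [u wu] := wg _ (leq_maxr i K).
rewrite -yx in ax; set l := taf_in y in ax.
have wl_le : rnorm (w l) <= rnorm c * rnorm (\val l).
  rewrite wu.2// rnormM ler_wpM2l ?rnorm_ge0// val_taf_in//; exact: coord_le.
rewrite -(subrK l a) formD//; apply: le_trans (rnormD _ _) _.
rewrite subrK.
have -> : rnorm c * rnorm (\val a) + r = rnorm c * rnorm (\val a) + (B * e + e).
  by congr (_ + _); rewrite /e; field; rewrite gt_eqF.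
have h1 : rnorm (w (a - l)) <= `|M| * e.
  apply: le_trans (wM _) _; apply: (@le_trans _ _ (`|M| * rnorm (\val (a - l)))).
    by rewrite ler_wpM2r ?rnorm_ge0// ler_norm.
  by rewrite ler_wpM2l// val_tafB.
have h2 : rnorm (w l) <= rnorm c * rnorm (\val a) + rnorm c * e.
  apply: le_trans wl_le _; rewrite -mulrDr ler_wpM2l ?rnorm_ge0//.
  rewrite -(subrK (\val a) (\val l)) addrC; apply: le_trans (rnormD _ _) _.
  by rewrite lerD2l rnormBC.
apply: le_trans (lerD h1 h2) _; rewrite /B mulrDl addrCA lerD2l lerDl.
exact: ltW.
Qed.

(** The supremum is attained at the matrix unit of the germ, which has norm 1. *)
Lemma fnorm_germ w c : dual_form w -> (\forall j \near \oo, exists e : idx j, germ w c e) ->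
  fnorm w = rnorm c.
Proof.
move=> dw wg; have bw := germ_bound dw wg; have [K _ Kg] := wg.
have [e we] := Kg _ (leqnn K).
apply/eqP; rewrite eq_le; apply/andP; split.
  apply: ge_sup => [|_ [a /= a1 <-]].
    by exists (rnorm (w 0)); exists 0 => //; rewrite /mkset val_taf0 rnorm0 ler01.
  apply: le_trans (bw a) _.
  by rewrite -[leRHS]mulr1 ler_wpM2l ?rnorm_ge0.
apply: ub_le_sup.
  exists (rnorm c) => _ [a /= a1 <-]; apply: le_trans (bw a) _.
  by rewrite -[leRHS]mulr1 ler_wpM2l ?rnorm_ge0.
exists (taf_unit e) => /=; first by rewrite val_taf_unit ?we.1// rnorm_unit.
by rewrite (germ_val we).
Qed.

Lemma dual_form_le_fnorm (w : A -> R[i]) a : dual_form w -> rnorm (w a) <= fnorm w * rnorm (\val a).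
Proof.
move=> [wl [M wM]].
have [a0|a0] := eqVneq (rnorm (\val a)) 0.
  by have := wM a; rewrite a0 !mulr0.
have ap : 0 < rnorm (\val a) by rewrite lt_def a0 rnorm_ge0.
rewrite -ler_pdivrMr//; apply: ub_le_sup.
  exists `|M| => _ [b /= b1 <-]; apply: le_trans (wM b) _.
  apply: (@le_trans _ _ (`|M| * rnorm (\val b))).
    by rewrite ler_wpM2r ?rnorm_ge0// ler_norm.
  by rewrite -[leRHS]mulr1 ler_wpM2l.
have rV : rnorm ((rnorm (\val a))^-1%:C : R[i]) = (rnorm (\val a))^-1.
  by rewrite /rnorm ger0_norm ?ler0c ?invr_ge0 ?rnorm_ge0.
exists ((rnorm (\val a))^-1%:C *: a).
  by rewrite /mkset val_tafZ rnormZ rV mulVf.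
have := wl (rnorm (\val a))^-1%:C a 0; rewrite (form0 wl) !addr0 => ->.
by rewrite rnormM rV mulrC.
Qed.

Lemma dual_form_ext (w w' : A -> R[i]) : dual_form w -> dual_form w' ->
  (\forall j \near \oo, forall x, fd_upper x -> w ((taf_in (x : fdalg R (@bsize R S j)))) = w' (taf_in x)) ->
  w = w'.
Proof.
move=> [wl [M wM]] [wl' [M' wM']] [K _ ww']; apply/funext => a.
apply/eqP; rewrite -subr_eq0; apply/eqP; apply: rnorm_le_eps => r r0.
have B0 : 0 < `|M| + `|M'| + 1 by rewrite ltr_wpDl// addr_ge0.
have [i [x [ux ax]]] := taf_dense a (divr_gt0 r0 B0).
have [y [uy yx _]] := taf_lift (leq_maxl i K) ux.
rewrite -yx in ax; set l := taf_in y in ax.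
have -> : w a - w' a = w (a - l) - w' (a - l).
  rewrite !formB// (ww' _ (leq_maxr i K) y uy) -/l.
  by rewrite opprB addrA subrK.
set e := r / _ in ax.
have bd (v : A -> R[i]) N : (forall b, rnorm (v b) <= N * rnorm (\val b)) -> rnorm (v (a - l)) <= `|N| * e.
  move=> vN; apply: le_trans (vN _) _; apply: (@le_trans _ _ (`|N| * rnorm (\val (a - l)))).
    by rewrite ler_wpM2r ?rnorm_ge0// ler_norm.
  by rewrite ler_wpM2l// val_tafB.
apply: le_trans (rnormD _ _) _; rewrite rnormN.
apply: (@le_trans _ _ (`|M| * e + `|M'| * e)).
  by apply: lerD; apply: bd.
rewrite -mulrDl /e mulrCA -[leRHS]mulr1 ler_wpM2l ?(ltW r0)// ler_pdivrMr//.
by rewrite mul1r lerDl.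
Qed.

End Germs.

Section SpecGerms.
Variables (R : realType) (S : taf_system R) (L : af_limit S).
Local Notation A := (taf L).
Local Notation idx j := (munit_index (@bsize R S j)).
Local Notation taf_in := (@taf_in R S L _).
Local Notation taf_unit := (@taf_unit R S L _).
Implicit Types (w : A -> R[i]).

Lemma taf_unit_decompose i j (u : idx i) : (i <= j)%N -> munit_upper u ->
  exists V : {set idx j}, [/\ (forall v, v \in V -> munit_upper v),
    (forall v, v \in V -> part L u v)
    & forall w, scalar w -> w (taf_unit u) = \sum_(v in V) w (taf_unit v)].
Proof.
move=> ij uu; have [V [uV _ srcI upV _]] := unit_decompose L u ij.
exists V; split; first by move=> v; exact: upV.
  move=> v vV; rewrite /part uV cs_mul_suml (bigD1 v vV)/= big1 ?addr0.
    exact: unit_diag.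
  move=> x /andP[xV xv]; apply: unit_diag0; apply: contra_neq xv => xv.
  exact: srcI.
move=> w wl; have vE : taf_unit u = \sum_(v in V) taf_unit v.
  apply: val_inj; rewrite val_taf_unit// uV raddf_sum.
  by apply: eq_bigr => v vV; exact: esym (val_taf_unit L (upV uu _ vV)).
rewrite vE; elim/big_rec2: _ => [|v a b _ <-]; first exact: form0.
by rewrite (formD wl).
Qed.

Lemma form_neq0_unit w a : dual_form w -> w a != 0 ->
  exists i (u : idx i), munit_upper u /\ w (taf_unit u) != 0.
Proof.
move=> dw wa; apply: contrapT => none.
have d0 : dual_form (fun _ : A => 0 : R[i]).
  split; first by move=> c x y; rewrite mulr0 addr0.
  by exists 0 => x; rewrite rnorm0 mul0r.
have w0 : w = fun _ => 0.
  apply: dual_form_ext => //; near=> j => x ux; rewrite (form_taf_in dw.1 ux).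
  rewrite big1// => u uu; case: (eqVneq (w (taf_unit u)) 0) => [->|wu].
    by rewrite mulr0.
  by case: none; exists j, u.
by rewrite w0 eqxx in wa.
Unshelve. all: by end_near.
Qed.

(** By density some unit has a non-zero value. That value is the sum of the values at the summands
    of a later level, only one of which is non-zero: the whole value is carried by one unit, so the
    constant is the same at all later levels. *)
Lemma germ_exists w a : dual_form w -> w a != 0 ->
  (forall j (u v : idx j), munit_upper u -> munit_upper v ->
    w (taf_unit u) != 0 -> w (taf_unit v) != 0 -> u = v) ->
  exists2 c, c != 0 & \forall j \near \oo, exists e : idx j, germ w c e.
Proof.
move=> dw wa uniq; have [i [u [uu wu]]] := form_neq0_unit dw wa.
exists (w (taf_unit u)) => //; exists i => // j /= ij.
have [V [upV _ wV]] := taf_unit_decompose ij uu.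
have wVu := wV _ dw.1.
have [v /andP[vV wv]|none] := pickP (fun v => (v \in V) && (w (taf_unit v) != 0)).
  exists v; apply: germ_units => //; first exact: dw.1; first exact: upV.
    rewrite wVu (bigD1 v)//= big1 ?addr0// => x /andP[xV xv].
    apply/eqP; apply: contraNT xv => wx; apply/eqP; apply: uniq => //; exact: upV.
  move=> x ux xv; apply/eqP; apply: contraNT xv => wx; apply/eqP; apply: uniq => //.
  exact: upV.
move: wu; rewrite wVu big1 ?eqxx// => v vV.
by have := none v; rewrite vV /= => /negbT; rewrite negbK => /eqP.
Qed.

(** If the sources differ, the sum times its adjoint is a sum of two diagonal projections; otherwise
    the ranges differ and the adjoint is used. A form of norm 1 therefore cannot be 1 at two units
    of one level, as it would take the value 2 at an element of norm at most the square root of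
    2. *)
Lemma rnorm_unitD j (u v : idx j) : u != v ->
  rnorm (unit_in L u + unit_in L v) ^+ 2 <= 2.
Proof.
wlog ns : u v / munit_src u != munit_src v.
  move=> wl uv; have [|su] := boolP (munit_src u != munit_src v); first by move=> ?; exact: wl.
  rewrite -rnorm_star cs_starD !unit_star; apply: wl.
    apply: contra_neq uv => rr; apply: rng_src_inj; first exact: rr.
    by apply/eqP; rewrite negbK in su.
  by apply: contra_neq uv => /(can_inj (@adjK _ _)).
move=> _; set x := _ + _.
have -> : rnorm x ^+ 2 = rnorm (cs_mul L x (cs_star x)).
  by rewrite -{2}(cs_starK x) rnorm_star_mul rnorm_star.
have -> : cs_mul L x (cs_star x) = diag_in L (munit_rng u) + diag_in L (munit_rng v).
  rewrite /x cs_starD cs_mulDl !cs_mulDr !unit_star !unit_adjr.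
  rewrite (@unit_mul0 _ _ _ _ u (munit_adj v)) ?rng_adj// addr0.
  by rewrite (@unit_mul0 _ _ _ _ v (munit_adj u)) ?rng_adj ?add0r// eq_sym.
by apply: le_trans (rnormD _ _) _; rewrite !rnorm_diag.
Qed.

Lemma Spec_germ w : Spec L w -> \forall j \near \oo, exists e : idx j, germ w 1 e.
Proof.
move=> [dw fw w01].
have val01 j (u : idx j) : munit_upper u -> w (taf_unit u) = 0 \/ w (taf_unit u) = 1.
  by move=> uu; apply: (w01 j); apply/munitsP; exists u.
have [a wa] : exists a, w a != 0.
  apply: contrapT => none; have w0 a : w a = 0.
    by apply: contrapT => /eqP wa; apply: none; exists a.
  have /eqP : fnorm w = 0.
    apply/eqP; rewrite eq_le; apply/andP; split.
      apply: ge_sup => [|_ [x _ <-]]; last by rewrite w0 rnorm0.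
      by exists (rnorm (w 0)); exists 0 => //; rewrite /mkset val_taf0 rnorm0 ler01.
    by rewrite -[fnorm w]mulr1 -(rnorm1 R); case: dw => _ _; rewrite fw mul1r rnorm1 ler01.
  by rewrite fw oner_eq0.
have [|c c0 wc] := germ_exists dw wa.
  move=> j u v uu vu wu wv; apply/eqP; apply: contraT => uv.
  have {}wu : w (taf_unit u) = 1 by case: (val01 _ _ uu) wu => -> //; rewrite eqxx.
  have {}wv : w (taf_unit v) = 1 by case: (val01 _ _ vu) wv => -> //; rewrite eqxx.
  have := dual_form_le_fnorm (taf_unit u + taf_unit v) dw.
  have r2 : rnorm (1 + 1 : R[i]) = 2.
    by rewrite /rnorm -mulr2n normr_nat -(rmorph_nat (real_complex R)).
  rewrite fw mul1r (formD dw.1) wu wv r2 => le2.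
  have := rnorm_unitD uv; rewrite -!(val_taf_unit L)// => le4.
  have : (2 : R) ^+ 2 <= 2.
    by apply: le_trans le4; rewrite lerXn2r ?nnegrE ?rnorm_ge0.
  by rewrite expr2 ger_pMr// lern1.
suff <- : c = 1 by [].
have [K _ Kg] := wc; have [e we] := Kg _ (leqnn K).
by case: (val01 _ _ we.1); rewrite (germ_val we) => // c00; rewrite c00 eqxx in c0.
Qed.

(** At a low level the value at a unit is 1 or 0 according to whether the unit carrying the form at
    a later level is one of its summands. *)
Lemma germ_Spec w : dual_form w ->
  (\forall j \near \oo, exists e : idx j, germ w 1 e) -> Spec L w.
Proof.
move=> dw wg; split=> //; first by rewrite (fnorm_germ dw wg) rnorm1.
move=> i _ /munitsP[u uu ->]; have [K _ Kg] := wg.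
have [V [upV _ wV]] := taf_unit_decompose (leq_maxl i K) uu.
have [e we] := Kg _ (leq_maxr i K).
rewrite (wV _ dw.1); have [eV|eV] := boolP (e \in V).
  right; rewrite (bigD1 e eV)/= (germ_val we) big1 ?addr0// => v /andP[vV ve].
  by rewrite (germ_unit we (upV _ vV)) eq_sym (negPf ve) mulr0.
left; rewrite big1// => v vV; rewrite (germ_unit we (upV _ vV)).
by case: eqP => [ev|_]; rewrite ?mulr0//; rewrite ev vV in eV.
Qed.

End SpecGerms.

(** * Vectors spanning atoms in a nest representation *)

Section NestRepresentations.
Variables (R : realType) (S : taf_system R) (L : af_limit S).
Local Notation A := (taf L).
Local Notation idx j := (munit_index (@bsize R S j)).
Local Notation row j := {k & 'I_(@bsize R S j k).+1}.
Local Notation taf_in := (@taf_in R S L _).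
Local Notation taf_unit := (@taf_unit R S L _).

Definition taf_diag j (r : row j) : A := taf_unit (munit_diag r).

Variable rho : representation L.
Local Notation H := (rep_space rho).
Local Notation dot := (hs_dot H).
Implicit Types (x y g h : H).

Lemma rep_form x y : scalar (fun a => dot (rho a x) y).
Proof. by move=> c a b; rewrite rep_linear dotDl dotZl. Qed.

Lemma rep0 x : rho 0 x = 0.
Proof.
by have := rep_linear (-1) 0 0 x; rewrite scaler0 addr0 scaleN1r addNr.
Qed.

Lemma rep_bounded0 : exists2 M : R, 0 <= M &
  forall (a : A) x, rnorm (rho a x) <= M * rnorm (\val a) * rnorm x.
Proof.
have [M rM] := rep_bounded rho; exists `|M| => // a x.
by apply: le_trans (rM _ _) _; rewrite !ler_wpM2r ?rnorm_ge0 ?ler_norm.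
Qed.

Lemma coef_dual_form g h : dual_form (coef g h).
Proof.
split; first exact: rep_form.
have [M rM] := rep_bounded rho; exists (M * rnorm g * rnorm h) => a.
apply: le_trans (rnorm_dot _ _) _.
have -> : M * rnorm g * rnorm h * rnorm (\val a) = M * rnorm (\val a) * rnorm g * rnorm h.
  by ring.
by rewrite ler_wpM2r ?rnorm_ge0.
Qed.

Definition fixes g j (r : row j) := rho (taf_diag r) g = g.

Lemma rep_unit_src j (u : idx j) x : munit_upper u ->
  rho (taf_unit u) (rho (taf_diag (munit_src u)) x) = rho (taf_unit u) x.
Proof.
move=> uu; rewrite -rep_mul /taf_diag taf_unit_mul ?rng_diag//; last exact: upper_diag.
congr (rho (taf_unit _) x); apply: rng_src_inj; first exact: rng_comp.
by rewrite src_comp ?src_diag ?rng_diag.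
Qed.

Lemma rep_unit_rng j (u : idx j) x : munit_upper u ->
  rho (taf_diag (munit_rng u)) (rho (taf_unit u) x) = rho (taf_unit u) x.
Proof.
move=> uu; rewrite -rep_mul /taf_diag taf_unit_mul ?src_diag//; last exact: upper_diag.
congr (rho (taf_unit _) x); apply: rng_src_inj; first by rewrite rng_comp rng_diag.
by rewrite src_comp ?src_diag.
Qed.

Lemma rep_diag_ortho j (r s : row j) x : r != s -> rho (taf_diag r) (rho (taf_diag s) x) = 0.
Proof.
move=> rs; rewrite -rep_mul /taf_diag taf_unit_mul0 ?upper_diag ?src_diag ?rng_diag//.
exact: rep0.
Qed.

Lemma fixes_inj g j (r s : row j) : g != 0 -> fixes g r -> fixes g s -> r = s.
Proof.
move=> g0 gr gs; apply/eqP; apply: contra_neqT g0 => rs.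
by rewrite -gr -{1}gs rep_diag_ortho.
Qed.

Lemma rep_diagK j (r : row j) x : rho (taf_diag r) (rho (taf_diag r) x) = rho (taf_diag r) x.
Proof.
have := @rep_unit_rng j (munit_diag r) x (upper_diag r).
by rewrite rng_diag.
Qed.

Hypothesis rho_nest : nrep_star rho.

Lemma rep_diag_sym j (r : row j) x y :
  dot (rho (taf_diag r) x) y = dot x (rho (taf_diag r) y).
Proof.
apply: rho_nest.2; rewrite val_taf_unit ?upper_diag// unit_star adj_diag.
by [].
Qed.

(** The constant of the representation may exceed 1, but a diagonal projection acts as a
    self-adjoint idempotent. *)
Lemma rnorm_rep_diag j (r : row j) x : rnorm (rho (taf_diag r) x) <= rnorm x.
Proof.
have [->|x0] := eqVneq (rnorm (rho (taf_diag r) x)) 0; first exact: rnorm_ge0.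
have xp : 0 < rnorm (rho (taf_diag r) x) by rewrite lt_def x0 rnorm_ge0.
rewrite -(ler_pM2r xp) -expr2.
have e : dot x (rho (taf_diag r) x) = (rnorm (rho (taf_diag r) x) ^+ 2)%:C.
  by rewrite rmorphXn/= -rnormE hs_norm rep_diag_sym rep_diagK.
have <- : rnorm (dot x (rho (taf_diag r) x)) = rnorm (rho (taf_diag r) x) ^+ 2.
  by rewrite e /rnorm ger0_norm// ler0c exprn_ge0// rnorm_ge0.
exact: rnorm_dot.
Qed.

(** A self-adjoint operator preserving two subspaces preserves their orthogonal difference, here a
    line. *)
Lemma atom_diag g j (r : row j) : lat_atom (line g) -> exists c,
  rho (taf_diag r) g = c *: g.
Proof.
move=> [N [M [[_ _ _ Ninv] [_ _ _ Minv] _ _ lg]]].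
have : ominus N M (rho (taf_diag r) g).
  have : line g g by exists 1 => //; rewrite scale1r.
  rewrite lg => -[Ng gM]; split; first exact: Ninv.
  by move=> y My; rewrite rep_diag_sym gM//; exact: Minv.
by rewrite -lg => -[c _ <-]; exists c.
Qed.

(** A non-zero eigenvalue of an idempotent is 1. *)
Lemma atom_fixes g j (r : row j) : lat_atom (line g) ->
  rho (taf_diag r) g != 0 -> fixes g r.
Proof.
move=> /(atom_diag r)[c gc] g0; have := rep_diagK r g.
rewrite gc linearZ/= gc scalerA => /eqP; rewrite -subr_eq0 -scalerBl scaler_eq0.
rewrite gc scaler_eq0 negb_or in g0; have [c0 g0'] := andP g0.
rewrite (negPf g0') orbF -{3}[c]mulr1 -mulrBr mulf_eq0 (negPf c0) subr_eq0.
by move=> /eqP c1; rewrite /fixes gc c1 scale1r.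
Qed.

Lemma coef_unit_fixes g h j (u : idx j) : lat_atom (line g) -> lat_atom (line h) ->
  munit_upper u -> coef g h (taf_unit u) != 0 ->
  fixes g (munit_src u) /\ fixes h (munit_rng u).
Proof.
move=> ag ah uu w0; split; apply: atom_fixes => //; apply: contra_neq w0 => e.
  by rewrite /coef -rep_unit_src// e linear0 dot0l.
by rewrite /coef -rep_unit_rng// rep_diag_sym e dot0r.
Qed.

Lemma coef_germ g h : lat_atom (line g) -> lat_atom (line h) ->
  (exists a, coef g h a != 0) -> exists2 c, c != 0 &
  \forall j \near \oo, exists e : idx j,
    [/\ germ (coef g h) c e, fixes g (munit_src e) & fixes h (munit_rng e)].
Proof.
move=> ag ah [a wa].
have g0 : g != 0 by apply: contra_neq wa => ->; rewrite /coef linear0 dot0l.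
have h0 : h != 0 by apply: contra_neq wa => ->; rewrite /coef dot0r.
have [|c c0 wc] := germ_exists (coef_dual_form g h) wa.
  move=> j u v uu vu /(coef_unit_fixes ag ah uu)[gu hu].
  move=> /(coef_unit_fixes ag ah vu)[gv hv].
  by apply: rng_src_inj; [exact: fixes_inj h0 hu hv|exact: fixes_inj g0 gu gv].
exists c => //; near=> j; have [e we] : exists e : idx j, germ (coef g h) c e.
  by near: j.
have [|ge he] := coef_unit_fixes ag ah we.1; first by rewrite (germ_val we).
by exists e.
Unshelve. all: by end_near. Qed.

(** Multiples of [x] are added because the algebra may have no unit, and [x] must belong to the
    subspace. *)
Definition cyclic_subspace x : set H :=
  closure [set z | exists c a, z = c *: x + rho a x].

Lemma closure_linear (M : set H) : (forall c y z, M y -> M z -> M (c *: y + z)) ->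
  forall c y z, closure M y -> closure M z -> closure M (c *: y + z).
Proof.
move=> Ml c y z /closure_normP My /closure_normP Mz; apply/closure_normP => e e0.
have d0 : 0 < rnorm c + 1 by rewrite ltr_wpDl ?rnorm_ge0.
have [y' My' yy'] := My _ (divr_gt0 e0 (addr_gt0 d0 ltr01)).
have [z' Mz' zz'] := Mz _ (divr_gt0 e0 (addr_gt0 d0 ltr01)).
exists (c *: y' + z'); first exact: Ml.
have -> : c *: y + z - (c *: y' + z') = c *: (y - y') + (z - z').
  by rewrite scalerBr opprD addrACA.
apply: le_trans (rnormD _ _) _; rewrite rnormZ.
set d := e / _ in yy' zz'.
apply: (@le_trans _ _ (rnorm c * d + d)).
  by rewrite lerD// ler_wpM2l ?rnorm_ge0.
rewrite -{2}[d]mul1r -mulrDl /d mulrCA -[leRHS]mulr1 ler_wpM2l ?(ltW e0)//.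
by rewrite ler_pdivrMr ?(addr_gt0 d0 ltr01)// mul1r lerDl.
Qed.

Lemma cyclic_lat x : rep_lat (cyclic_subspace x).
Proof.
split.
- by apply: subset_closure; exists 0, 0; rewrite scale0r rep0 addr0.
- apply: closure_linear => c y z [d [a ->]] [d' [a' ->]].
  exists (c * d + d'), (c *: a + a'); rewrite rep_linear scalerDr scalerA scalerDl.
  by rewrite addrACA.
- exact: closed_closure.
move=> a y /closure_normP xy; apply/closure_normP => e e0.
have [M M0 rM] := rep_bounded0.
pose B := M * rnorm (\val a).
have B0 : 0 <= B by rewrite mulr_ge0 ?rnorm_ge0.
have [_ [c [b ->]] yb] := xy _ (divr_gt0 e0 (ltr_wpDl B0 ltr01)).
exists (rho a (c *: x + rho b x)).
  exists 0, (c *: a + taf_mul a b); rewrite scale0r add0r rep_linear rep_mul.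
  by rewrite linearP.
rewrite -linearB; apply: le_trans (rM _ _) _; rewrite -/B.
set d := e / _ in yb; apply: (@le_trans _ _ (B * d)); first by rewrite ler_wpM2l.
rewrite /d mulrCA -[leRHS]mulr1 ler_wpM2l ?(ltW e0)//.
by rewrite ler_pdivrMr ?ltr_wpDl// mul1r lerDl.
Qed.

(* [y] is a limit of vectors that the diagonal projections fixing both [x] and
   [y] compress to multiples of [x]. *)
Lemma cyclic_orthogonal x y (K : nat) :
  (forall j, (K <= j)%N -> exists r : row j, fixes x r /\ fixes y r) ->
  dot x y = 0 -> cyclic_subspace x y -> y = 0.
Proof.
move=> xyr xy /closure_normP yx; apply: rnorm_le_eps => e e0.
have e20 : 0 < e / 2 by rewrite divr_gt0.
have [_ [c [a ->]] yc] := yx _ e20.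
have [M M0 rM] := rep_bounded0.
pose B := M * rnorm x; have B0 : 0 <= B by rewrite mulr_ge0 ?rnorm_ge0.
have [i [z [uz az]]] := taf_dense a (divr_gt0 e20 (ltr_wpDl B0 ltr01)).
have [z' [uz' zz' _]] := taf_lift L (leq_maxl i K) uz.
set j := maxn i K in z' uz' zz'; have jK : (K <= j)%N := leq_maxr _ _.
rewrite -zz' in az; set l := taf_in z' in az.
have yl : rnorm (y - (c *: x + rho l x)) <= e.
  rewrite [leRHS]splitr; apply: le_trans (rnormB _ (c *: x + rho a x) _) _.
  rewrite lerD// opprD addrACA subrr add0r.
  have -> : rho a x - rho l x = rho (a - l) x.
    by have := rep_linear (-1) l a x; rewrite !scaleN1r addrC => ->; rewrite addrC.
  apply: le_trans (rM _ _) _; rewrite mulrAC -/B val_tafB.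
  set d := _ / _ in az; apply: (@le_trans _ _ (B * d)); first by rewrite ler_wpM2l.
  rewrite /d mulrCA -[leRHS]mulr1 ler_wpM2l ?(ltW e20)//.
  by rewrite ler_pdivrMr ?ltr_wpDl// mul1r lerDl.
have [r [xr yr]] := xyr j jK.
pose p := taf_diag r; pose k := coord z' (munit_diag r).
(* Compression of an element of a level by a minimal diagonal projection of that level is scalar. *)
have plp : taf_mul (taf_mul p l) p = k *: p.
  apply: val_inj; rewrite !val_taf_mul val_tafZ /p /taf_diag val_taf_unit ?upper_diag//.
  rewrite val_taf_in// -diag_inE.
  by have := compress_coord L z' (munit_diag r); rewrite rng_diag src_diag -diag_inE.
have pl : rho p (rho l x) = k *: x.
  rewrite -{1}xr -!rep_mul plp.
  have := rep_linear k p 0 x; rewrite addr0 rep0 addr0 => ->.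
  by rewrite xr.
have py : rho p (y - (c *: x + rho l x)) = y - (c + k) *: x.
  rewrite linearB linearP yr xr pl.
  by rewrite -scalerDl.
have : rnorm (y - (c + k) *: x) <= e.
  by rewrite -py; apply: le_trans (rnorm_rep_diag _ _) _.
(* As [y] is orthogonal to [x], Pythagoras bounds the norm of [y] by that of [y - (c + k) *: x]. *)
apply: le_trans; rewrite -(@ler_pXn2r _ 2)// ?nnegrE ?rnorm_ge0//.
rewrite -lecR !rmorphXn/= -!rnormE !hs_norm dotBl !dotBr !dotZl !dotZr xy.
rewrite [dot y x]dotC xy conjC0 !mulr0 subr0 sub0r opprK lerDl.
by rewrite mulrA mulr_ge0 ?mul_conjC_ge0// -hs_norm exprn_ge0.
Qed.

(** The component [z] of [y] orthogonal to [x] is fixed by the same projections. The nest condition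
    puts one of [x], [z] into the cyclic subspace of the other, so one of them vanishes, and it is
    not [x]. *)
Lemma fixes_line x y (K : nat) : x != 0 ->
  (forall j, (K <= j)%N -> exists r : row j, fixes x r /\ fixes y r) ->
  exists c, y = c *: x.
Proof.
move=> x0 xyr; pose c := dot y x / dot x x; exists c.
have xx : dot x x != 0 by apply: contra_neq x0; exact: dot_eq0.
pose z := y - c *: x.
have zx : dot z x = 0 by rewrite dotBl dotZl divfK// subrr.
have xz : dot x z = 0 by rewrite dotC zx conjC0.
have xzr j : (K <= j)%N -> exists r : row j, fixes x r /\ fixes z r.
  move=> /xyr[r [xr yr]]; exists r; split => //.
  by rewrite /fixes linearB linearZ/= yr xr.
have zxr j : (K <= j)%N -> exists r : row j, fixes z r /\ fixes x r.
  by move=> /xzr[r [xr zr]]; exists r.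
suff : z = 0 by move=> /eqP; rewrite subr_eq0 => /eqP.
have self v : cyclic_subspace v v.
  by apply: subset_closure; exists 1, 0; rewrite scale1r rep0 addr0.
have [sub|sub] := rho_nest.1 _ _ (cyclic_lat x) (cyclic_lat z).
  by have /eqP := cyclic_orthogonal zxr zx (sub _ (self x)); rewrite (negPf x0).
exact: cyclic_orthogonal xzr xz (sub _ (self z)).
Qed.

End NestRepresentations.

(** * Composition of forms and multiplication of matrix units *)

Section FormComposition.
Variables (R : realType) (S : taf_system R) (L : af_limit S).
Local Notation A := (taf L).
Local Notation idx j := (munit_index (@bsize R S j)).
Local Notation taf_unit := (@taf_unit R S L _).

Lemma line_sub (rho : representation L) (g h : rep_space rho) : line g = line h ->
  exists c, h = c *: g.
Proof.
move=> gh; have : line h h by exists 1 => //; rewrite scale1r.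
by rewrite -gh => -[c _ <-]; exists c.
Qed.

Lemma fixesZ (rho : representation L) (g : rep_space rho) c j r :
  @fixes R S L rho g j r -> @fixes R S L rho (c *: g) j r.
Proof. by move=> gr; rewrite /fixes linearZ/= gr. Qed.

Lemma part_mul i j (u : idx i) (v : idx j) : munit_upper u -> munit_upper v ->
  part L u v -> taf_mul (taf_unit u) (taf_diag L (munit_src v)) = taf_unit v.
Proof.
move=> uu vu uv; apply: val_inj.
by rewrite val_taf_mul !val_taf_unit ?upper_diag// -diag_inE uv.
Qed.

(** The unit carrying [w2] sends g' to a vector fixed by the same projections as g, hence to a
    non-zero multiple of g. So the product form does not vanish at the product of the two units. The
    form [s] is the diagonal coefficient at the common vector g. *)
Lemma form_comp_germ (w1 w2 w : A -> R[i]) : form_comp w1 w2 w ->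
  (exists a, w1 a != 0) -> (exists a, w2 a != 0) ->
  (exists a, w a != 0) /\ exists2 s : A -> R[i], Omega L s &
  exists c1 c2 c d, [/\ c1 != 0, c2 != 0, c != 0, d != 0 &
    \forall j \near \oo, exists e1 e2 : idx j, [/\ munit_src e1 = munit_rng e2,
      germ w1 c1 e1, germ w2 c2 e2, germ w c (munit_comp e1 e2)
      & germ s d (munit_diag (munit_src e1))]].
Proof.
move=> [rho [g [h [g' [h' [rn [ag ah ag' ah'] -> -> [gh ->]]]]]]] w1n w2n.
have [c1 c10 [K1 _ germ1]] := coef_germ rn ag ah w1n.
have [c2 c20 [K2 _ germ2]] := coef_germ rn ag' ah' w2n.
have nz (u v : rep_space rho) : (exists a, coef u v a != 0) -> u != 0 /\ v != 0.
  move=> [a wa]; split; apply: contra_neq wa => ->; first by rewrite /coef linear0 dot0l.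
  by rewrite /coef dot0r.
have [g0 h0] := nz _ _ w1n; have [g'0 h'0] := nz _ _ w2n.
have [lam glam] := line_sub (esym gh).
pose K := maxn K1 K2.
have K1K : (K1 <= K)%N := leq_maxl _ _; have K2K : (K2 <= K)%N := leq_maxr _ _.
have both j : (K <= j)%N -> exists e1 e2 : idx j, [/\ munit_src e1 = munit_rng e2,
    [/\ germ (coef g h) c1 e1, fixes g (munit_src e1) & fixes h (munit_rng e1)] &
    [/\ germ (coef g' h') c2 e2, fixes g' (munit_src e2) & fixes h' (munit_rng e2)]].
  move=> Kj; have [e1 [ge1 gf hf]] := germ1 j (leq_trans K1K Kj).
  have [e2 [ge2 gf' hf']] := germ2 j (leq_trans K2K Kj).
  exists e1, e2; split => //; apply: (fixes_inj g0 gf).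
  by rewrite glam; exact: fixesZ.
have [e1 [e2 [e12 [ge1 gf hf] [ge2 gf' hf']]]] := both K (leqnn K).
pose y := rho (taf_unit e2) g'.
(* The vector [y] does not depend on the level: the unit of a later level is [e2] times a projection
   that fixes g'. *)
have yE k (u : idx k) : (K <= k)%N -> germ (coef g' h') c2 u -> fixes g' (munit_src u) ->
    rho (taf_unit u) g' = y.
  move=> Kk gu fu; have /(part_mul ge2.1 gu.1) <- := germ_part Kk c20 ge2 gu.
  by rewrite rep_mul fu.
have [mu ymu] : exists mu, y = mu *: g.
  apply: (fixes_line rn (K := K)) g0 _ => k Kk.
  have [u1 [u2 [u12 [gu1 fg _] [gu2 fg' _]]]] := both k Kk.
  exists (munit_src u1); split => //.
  by rewrite u12 /fixes -(yE _ _ Kk gu2 fg') rep_unit_rng// gu2.1.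
have mu0 : mu != 0.
  apply: contra_neq c20 => mu0; rewrite -(germ_val ge2) /coef -/y ymu mu0.
  by rewrite scale0r dot0l.
have wn : exists a, coef g' h a != 0.
  exists (taf_mul (taf_unit e1) (taf_unit e2)).
  rewrite /coef rep_mul -/y ymu linearZ dotZl mulf_neq0//.
  by have := germ_val ge1; rewrite /coef => ->.
have sn : exists a, coef g g a != 0.
  exists (taf_diag L (munit_src e1)); rewrite /coef gf.
  by apply: contra_neq g0; exact: dot_eq0.
have [c c0 [K3 _ germ3]] := coef_germ rn ag' ah wn.
have [d d0 [K4 _ germ4]] := coef_germ rn ag ag sn.
split=> //; exists (coef g g); first by split => //; exists rho, g, g.
exists c1, c2, c, d; split => //; exists (maxn K (maxn K3 K4)) => // j /= jm.
have Kj : (K <= j)%N := leq_trans (leq_maxl _ _) jm.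
have [e3 [ge3 f3 f3']] := germ3 j (leq_trans (leq_trans (leq_maxl _ _) (leq_maxr K _)) jm).
have [e4 [ge4 f4 f4']] := germ4 j (leq_trans (leq_trans (leq_maxr _ _) (leq_maxr K _)) jm).
have [u1 [u2 [u12 [gu1 fg fh] [gu2 fg' fh']]]] := both j Kj.
exists u1, u2; split => //.
  suff <- : e3 = munit_comp u1 u2 by [].
  apply: rng_src_inj; first by rewrite rng_comp; exact: (fixes_inj h0 f3' fh).
  by rewrite src_comp//; exact: (fixes_inj g'0 f3 fg').
suff <- : e4 = munit_diag (munit_src u1) by [].
apply: rng_src_inj; first by rewrite rng_diag; exact: (fixes_inj g0 f4' fg).
by rewrite src_diag; exact: (fixes_inj g0 f4 fg).
Qed.

End FormComposition.

(* A decreasing sequence of minimal diagonal projections, that is a point of the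
   spectrum of the diagonal. *)
Record thread (R : realType) (S : taf_system R) (L : af_limit S) := Thread {
  th_start : nat;
  th_row : forall l, {k & 'I_(@bsize R S (th_start + l) k).+1};
  th_below : forall l l', (l <= l')%N ->
    cs_mul L (diag_in L (th_row l)) (diag_in L (th_row l')) = diag_in L (th_row l') }.

(** * The orbit of a thread *)

Section Points.
Variables (R : realType) (S : taf_system R) (L : af_limit S) (c : thread L).
Local Notation "x ** y" := (cs_mul L x y) (at level 40, left associativity).
Local Notation star := (@cs_star R L).
Local Notation idx j := (munit_index (@bsize R S j)).
Local Notation E := (@unit_in R S L _).
Local Notation K := (th_start c).

Definition th_block l : 'I_(nblocks S (K + l)) := tag (th_row c l).
Definition th_dim l : nat := (bsize (th_block l)).+1.
Definition th_proj l : L := diag_in L (th_row c l).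

Definition th_unit l (s t : 'I_(th_dim l)) : idx (K + l) :=
  Tagged (fun k => 'I_(bsize k).+1 * 'I_(bsize k).+1)%type (s, t).
(** The unit leading from the place of the thread to the place [s] of the same block; the places of
    that block are the points of the orbit visible at level [l]. *)
Definition to_unit l (s : 'I_(th_dim l)) : idx (K + l) := th_unit s (tagged (th_row c l)).

Lemma src_to_unit l (s : 'I_(th_dim l)) : munit_src (to_unit s) = th_row c l.
Proof. by rewrite /munit_src /to_unit/= /th_unit /th_block; case: (th_row c l) s. Qed.

Lemma to_unit_src l (v : idx (K + l)) : munit_src v = th_row c l ->
  exists s, v = to_unit s.
Proof.
rewrite /to_unit /th_unit /th_dim /th_block; case: (th_row c l) => k q.
case: v => k' [p' q'] e /=; have kk : k' = k := congr1 tag e.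
subst k'; exists p'; apply: rng_src_inj => //; exact: e.
Qed.

Lemma to_unit_inj l : injective (@to_unit l).
Proof. by move=> s s' /eqP; rewrite eq_Tagged => /eqP[]. Qed.

Lemma th_proj_neq0 l : th_proj l != 0.
Proof. by rewrite /th_proj diag_inE unit_neq0. Qed.

Lemma th_projP l : projection (th_proj l).
Proof. exact: diag_projection. Qed.

Lemma th_projM l l' : (l <= l')%N -> th_proj l ** th_proj l' = th_proj l'.
Proof. exact: th_below. Qed.

Lemma th_projC l l' : (l <= l')%N -> th_proj l' ** th_proj l = th_proj l'.
Proof. by move=> /(th_below c); apply: projection_belowC; exact: th_projP. Qed.

(* The pure state attached to the thread; junk value 0 where the compressions
   are not eventually scalar. *)
Definition tau (z : L) : R[i] :=
  xget 0 [set t | \forall l \near \oo, th_proj l ** z ** th_proj l = t *: th_proj l].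

Lemma tau_eq z t :
  (\forall l \near \oo, th_proj l ** z ** th_proj l = t *: th_proj l) -> tau z = t.
Proof.
move=> zt; rewrite /tau; case: xgetP => [t' _ zt'|/(_ t) //].
near \oo => l; have e : t' *: th_proj l = t *: th_proj l.
  have <- : th_proj l ** z ** th_proj l = t' *: th_proj l by near: l.
  by near: l.
move: e => /eqP; rewrite -subr_eq0 -scalerBl scaler_eq0 (negPf (th_proj_neq0 l)).
by rewrite orbF subr_eq0 => /eqP.
Unshelve. all: by end_near. Qed.

Lemma tau_congr z z' l : (forall l', (l <= l')%N -> th_proj l' ** z = th_proj l' ** z') ->
  tau z = tau z'.
Proof.
move=> zz'; rewrite /tau; congr xget; apply/seteqP; split=> t /= [K0 _ zt];
  exists (maxn K0 l) => // l' /=; rewrite geq_max => /andP[/zt zl' /zz' e].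
  by rewrite -e.
by rewrite e.
Qed.

Lemma tau_level l x : tau (af_in L (K + l) x) = coord x (munit_diag (th_row c l)).
Proof.
apply: tau_eq; exists l => // l' /= ll'.
rewrite -{1}(th_projC ll') -{2}(th_projM ll') cs_mul5.
have := compress_coord L x (munit_diag (th_row c l)).
rewrite rng_diag src_diag -diag_inE => ->.
by rewrite cs_mulZr cs_mulZl (th_projC ll') (th_projP l').2.
Qed.

Lemma tau0 : tau 0 = 0.
Proof. by rewrite -(linear0 (af_in L (K + 0))) tau_level coord0. Qed.

Lemma tau_proj l : tau (th_proj l) = 1.
Proof.
rewrite /th_proj diag_inE unit_inE tau_level.
by rewrite coord_munit eqxx.
Qed.

(* A point of the orbit of the thread is encoded by the form it defines on [L],
   which makes the names of the same point at different levels equal. *)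
Definition pt l (s : 'I_(th_dim l)) : L -> R[i] := fun y => tau (star (E (to_unit s)) ** y).

Definition orbit : set (L -> R[i]) := [set g | exists l (s : 'I_(th_dim l)), g = pt s].

Lemma orbit_pt l (s : 'I_(th_dim l)) : orbit (pt s).
Proof. by exists l, s. Qed.

Lemma pt_self l (s : 'I_(th_dim l)) : pt s (E (to_unit s)) = 1.
Proof. by rewrite /pt unit_star unit_adjl src_to_unit -(tau_proj l). Qed.

Lemma pt_other l (s t : 'I_(th_dim l)) : s != t -> pt s (E (to_unit t)) = 0.
Proof.
move=> st; rewrite /pt unit_star unit_mul0 ?tau0// src_adj.
by apply: contra_neq st => e; apply/to_unit_inj/rng_src_inj; rewrite ?src_to_unit.
Qed.

Lemma pt_inj l : injective (@pt l).
Proof.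
move=> s t st; apply/eqP; apply: contraT => /pt_other.
by rewrite st pt_self => /eqP; rewrite oner_eq0.
Qed.

(** The summand of [to_unit s] whose source is the later projection of the thread defines the same
    functional, since [tau] depends only on compressions by late projections. *)
Lemma pt_lift l l' (s : 'I_(th_dim l)) : (l <= l')%N ->
  exists s' : 'I_(th_dim l'), part L (to_unit s) (to_unit s') /\ pt s = pt s'.
Proof.
move=> ll'; have KK : (K + l <= K + l')%N by rewrite leq_add2l.
have [|v [sv pv _ _]] := @unit_lift R S L _ _ (to_unit s) (th_row c l') KK.
  move=> e; have := th_proj_neq0 l'; rewrite -{1}(th_projP l').2 -{1}(th_projC ll').
  rewrite /th_proj -(src_to_unit s) -(unit_adjl L (to_unit s)) -cs_mulA -cs_mulA e.
  by rewrite !cs_mul0r eqxx.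
have [s' vs'] := to_unit_src sv; subst v; exists s'; split => //.
apply/funext => y; apply: (@tau_congr _ _ l') => l2 l'l2.
rewrite -pv cs_starM !cs_mulA src_to_unit (diag_projection _ _).1 -/(th_proj l').
by rewrite (th_projC l'l2).
Qed.

(** The zero functional is what a matrix unit makes of a point that it does not reach; functions on
    the orbit must vanish there. *)
Lemma orbit0 : ~ orbit (fun _ => 0).
Proof.
by move=> [l [s e]]; have := pt_self s; rewrite -e => /esym/eqP; rewrite oner_eq0.
Qed.

(* The coordinates, at the points of level [l], of the image of [xi] under a
   matrix unit of an earlier level. *)
Lemma orbit_act (xi : (L -> R[i]) -> R[i]) l0 l (u : idx (K + l0)) y s :
  (forall g, ~ orbit g -> xi g = 0) -> (l0 <= l)%N -> af_in L (K + l) y = E u ->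
  xi (fun z => @pt l s (E u ** z)) = \sum_t y (th_block l) s t * xi (pt t).
Proof.
move=> xi0 ll0 yu; have KK : (K + l0 <= K + l)%N by rewrite leq_add2l.
have [V [uV rngI _ _ _]] := unit_decompose L u KK.
have yV : y = \sum_(v in V) munit R v.
  apply: (@af_in_inj _ _ L); rewrite yu uV linear_sum.
  by apply: eq_bigr => v _; rewrite unit_inE.
have yE t : y (th_block l) s t = (th_unit s t \in V)%:R.
  rewrite -[LHS]/(coord y (th_unit s t)) yV coord_sum.
  have [tV|tV] := boolP (th_unit s t \in V).
    rewrite (bigD1 _ tV)/= big1 ?addr0 ?coord_munit ?eqxx// => v /andP[_ vt].
    by rewrite coord_munit eq_sym (negPf vt).
  rewrite big1// => v vV; rewrite coord_munit; case: eqP => // e.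
  by rewrite e vV in tV.
have starE v : star (E (to_unit s)) ** E v = star (E (munit_adj v) ** E (to_unit s)).
  by rewrite cs_starM -(unit_star L v) cs_starK.
(* Either one summand of [u] has its range at [s], and precomposition moves [s] to the source [t] of
   that summand, or none has, and it gives the zero functional. *)
have [/existsP[t tV]|none] := boolP [exists t, th_unit s t \in V].
  have -> : (fun z => pt s (E u ** z)) = pt t.
    apply/funext => z; rewrite /pt cs_mulA; congr (tau (_ ** z)).
    rewrite uV cs_mul_sumr (bigD1 _ tV)/= big1 ?addr0 => [|v /andP[vV vt]].
      rewrite starE unit_mul//; congr (star (E _)).
      apply: rng_src_inj; first by rewrite rng_comp.
      by rewrite src_comp// !src_to_unit.
    rewrite unit_star unit_mul0// src_adj; apply: contra_neq vt => e.
    by apply: rngI => //; rewrite -e.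
  rewrite (bigD1 t)//= yE tV mul1r big1 ?addr0// => t' tt'.
  rewrite yE; case: (boolP (th_unit s t' \in V)) => [t'V|_]; last by rewrite mul0r.
  have /eqP : th_unit s t' = th_unit s t by exact: rngI.
  by rewrite eq_Tagged => /eqP[e]; rewrite e eqxx in tt'.
have none' t : (th_unit s t \in V) = false.
  by apply/negbTE; apply: contra none => tV; apply/existsP; exists t.
rewrite big1 => [|t _]; last by rewrite yE none' mul0r.
suff -> : (fun z => pt s (E u ** z)) = fun _ => 0 by apply: xi0; exact: orbit0.
apply/funext => z; rewrite /pt cs_mulA uV cs_mul_sumr big1 ?cs_mul0l ?tau0// => v vV.
rewrite unit_star unit_mul0// src_adj; apply/eqP => e.
have [t vt] : exists t, v = th_unit s t.
  case: v vV e => k [p q] vV e; have kk : th_block l = k := congr1 tag e.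
  subst k; exists q; apply: rng_src_inj => //; exact: esym e.
by move: vV; rewrite vt none'.
Qed.

End Points.

(** * Contractivity of the action of a block *)

Section BlockAction.
Variables (R : realType) (S : taf_system R) (L : af_limit S) (j : nat).
Variable k : 'I_(nblocks S j).
Local Notation M := (fdalg R (@bsize R S j)).
Local Notation I := 'I_(@bsize R S j k).+1.
Implicit Types (x y : M) (z w : I -> R[i]).

Definition block_app y z : I -> R[i] := fun s => \sum_t y k s t * z t.
Definition block_sq z : R := \sum_s nsq (z s).

Lemma block_appM x y z : block_app (fd_mul x y) z = block_app x (block_app y z).
Proof.
apply/funext => s; rewrite /block_app.
under eq_bigr do rewrite /fd_mul mxE mulr_suml.
rewrite exchange_big; apply: eq_bigr => t _; rewrite mulr_sumr.
by apply: eq_bigr => r _; rewrite mulrA.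
Qed.

Lemma block_app_star y z w : \sum_s block_app y z s * Num.conj (w s) =
  \sum_t z t * Num.conj (block_app (fd_star y) w t).
Proof.
rewrite /block_app; under eq_bigr do rewrite mulr_suml.
rewrite exchange_big; apply: eq_bigr => t _.
rewrite rmorph_sum mulr_sumr; apply: eq_bigr => s _.
by rewrite /fd_star !mxE rmorphM/= conjCK mulrCA mulrA.
Qed.

Lemma block_sq_ge0 z : 0 <= block_sq z.
Proof. by rewrite sumr_ge0// => s _; exact: nsq_ge0. Qed.

Lemma nsqM (a b : R[i]) : nsq (a * b) = nsq a * nsq b.
Proof. by rewrite /nsq; case: a b => a a' [b b']/=; ring. Qed.

Lemma nsq_sum (s : seq I) z :
  nsq (\sum_(t <- s) z t) <= 2 ^+ size s * \sum_(t <- s) nsq (z t).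
Proof.
elim: s => [|t s IH]; first by rewrite !big_nil mulr0 /nsq/= expr0n addr0.
rewrite !big_cons /= exprS mulrDr.
have nsqD (a b : R[i]) : nsq (a + b) <= 2 * nsq a + 2 * nsq b.
  rewrite -subr_ge0 (_ : _ - _ = nsq (a - b)) ?nsq_ge0//.
  by rewrite /nsq; case: a b => a a' [b b']/=; ring.
apply: le_trans (nsqD _ _) _; rewrite lerD//.
  rewrite ler_wpM2r ?nsq_ge0// ler_peMr// exprn_ege1//.
  by rewrite -[1]/(1%:R) ler_nat.
by rewrite -mulrA ler_wpM2l.
Qed.

(** Any constant independent of [y] and [z] will do here, as it is lowered to 1 below; the entries
    are bounded by [coord_le]. *)
Lemma block_app_crude : exists2 B : R, 0 <= B & forall y z,
  block_sq (block_app y z) <= B * rnorm (af_in L j y) ^+ 2 * block_sq z.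
Proof.
pose N := size (index_enum I); exists (\sum_(s : I) 2 ^+ N).
  by rewrite sumr_ge0// => s _; rewrite exprn_ge0.
move=> y z; rewrite !mulr_suml; apply: ler_sum => s _.
apply: le_trans (nsq_sum _ _) _; rewrite -mulrA ler_wpM2l ?exprn_ge0//.
rewrite /block_sq mulr_sumr; apply: ler_sum => t _; rewrite nsqM.
rewrite ler_wpM2r ?nsq_ge0// -rnorm_sqr lerXn2r ?nnegrE ?rnorm_ge0//.
have := coord_le L y (Tagged (fun k => 'I_(@bsize R S j k).+1 * 'I_(@bsize R S j k).+1)%type (s, t)).
exact.
Qed.

(* The C*-identity halves the distance from [B] to 1. *)
Lemma block_app_half (B : R) : 0 <= B ->
  (forall y z, block_sq (block_app y z) <= B * rnorm (af_in L j y) ^+ 2 * block_sq z) ->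
  forall y z, block_sq (block_app y z) <=
    (B + 1) / 2 * rnorm (af_in L j y) ^+ 2 * block_sq z.
Proof.
move=> B0 bB y z; set n := rnorm (af_in L j y).
have [n0|n0] := eqVneq n 0.
  by have := bB y z; rewrite -/n n0 expr0n/= !mulr0.
have np : 0 < n ^+ 2 by rewrite exprn_gt0// lt_def n0 rnorm_ge0.
pose w := block_app (fd_mul (fd_star y) y) z.
have Qw : block_sq w <= B * n ^+ 4 * block_sq z.
  apply: le_trans (bB _ _) _; rewrite af_inM af_in_star rnorm_star_mul -/n.
  by rewrite -exprM.
have conj_nsq (a : R[i]) : a * Num.conj a = (nsq a)%:C by rewrite -normCK nsqE.
have QE : (block_sq (block_app y z))%:C = \sum_t z t * Num.conj (w t).
  rewrite rmorph_sum/= /w block_appM -block_app_star.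
  by apply: eq_bigr => s _; rewrite conj_nsq.
(* The square of |y z| is the product of z with w = y^* y z. The weight n^2 balances the two terms,
   because |w|^2 is at most B n^4 |z|^2. *)
have amgm (a b : R[i]) : complex.Re (a * Num.conj b) <= (n ^+ 2 * nsq a + nsq b / n ^+ 2) / 2.
  have n20 : n ^+ 2 != 0 by rewrite gt_eqF.
  rewrite -subr_ge0; set e := (X in 0 <= X).
  suff -> : e = nsq ((n ^+ 2)%:C * a - b) / n ^+ 2 / 2.
    by rewrite !divr_ge0 ?nsq_ge0 ?(ltW np).
  rewrite /e /nsq {e}; case: a b => a a' [b b']/=; move: (n ^+ 2) n20 => m m0.
  by field.
have ReD : {morph (@complex.Re R) : a b / a + b} by move=> [a a'] [b b'].
have -> : block_sq (block_app y z) = \sum_t complex.Re (z t * Num.conj (w t)).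
  rewrite -[LHS]/(complex.Re (block_sq (block_app y z))%:C) QE.
  by rewrite (big_morph _ ReD (erefl _)).
apply: (@le_trans _ _ (\sum_t (n ^+ 2 * nsq (z t) + nsq (w t) / n ^+ 2) / 2)).
  by apply: ler_sum => t _; exact: amgm.
rewrite -mulr_suml big_split/= -mulr_sumr -mulr_suml -/(block_sq z) -/(block_sq w).
rewrite (_ : (B + 1) / 2 * n ^+ 2 * block_sq z =
  (n ^+ 2 * block_sq z + B * (n ^+ 2 * block_sq z)) / 2); last by field.
rewrite ler_wpM2r ?invr_ge0// lerD2l.
rewrite ler_pdivrMr//; apply: le_trans Qw _.
by rewrite le_eqVlt; apply/orP; left; apply/eqP; ring.
Qed.

(** Each use of [block_app_half] halves the excess over 1, so the constant 1 + B / 2^n is valid for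
    every n. *)
Lemma block_app_le y z :
  block_sq (block_app y z) <= rnorm (af_in L j y) ^+ 2 * block_sq z.
Proof.
have [B B0 crude] := block_app_crude.
have iter n : forall y z, block_sq (block_app y z) <=
    (1 + B / 2 ^+ n) * rnorm (af_in L j y) ^+ 2 * block_sq z.
  elim: n => [|n IH] y' z'.
    rewrite expr0 divr1; apply: le_trans (crude _ _) _.
    rewrite ler_wpM2r ?block_sq_ge0// ler_wpM2r ?exprn_ge0 ?rnorm_ge0//.
    by rewrite lerDr.
  have B1 : 0 <= 1 + B / 2 ^+ n by rewrite addr_ge0// divr_ge0// exprn_ge0.
  apply: le_trans (block_app_half B1 IH y' z') _.
  rewrite ler_wpM2r ?block_sq_ge0// ler_wpM2r ?exprn_ge0 ?rnorm_ge0//.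
  rewrite le_eqVlt; apply/orP; left; apply/eqP; rewrite exprS.
  have : 2 ^+ n != 0 :> R by rewrite expf_neq0.
  by move: (2 ^+ n) => m m0; field.
set X := _ * block_sq z; have X0 : 0 <= X by rewrite mulr_ge0 ?block_sq_ge0 ?exprn_ge0 ?rnorm_ge0.
apply/ler_addgt0Pr => e e0.
(* Then n exceeds B X / e, and so does 2^n, which makes the excess B X / 2^n at most e. *)
pose n := Num.bound (B * X / e).
apply: le_trans (iter n y z) _; rewrite -mulrA -/X mulrDl mul1r lerD2l mulrAC.
rewrite ler_pdivrMr ?exprn_gt0// -ler_pdivrMl// mulrC.
have BX0 : 0 <= B * X / e := divr_ge0 (mulr_ge0 B0 X0) (ltW e0).
apply: le_trans (ltW (archi_boundP BX0)) _; rewrite -/n -natrX ler_nat ltnW//.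
exact: ltn_expl.
Qed.

End BlockAction.

Section FiniteSums.
Variables (R : realType) (T : choiceType).

Lemma ler_sum_subset (s s' : seq T) (F : T -> R) : (forall t, 0 <= F t) ->
  uniq s -> {subset s <= s'} -> \sum_(t <- s) F t <= \sum_(t <- s') F t.
Proof.
move=> F0; elim: s s' => [|a s IH] s' /=; first by rewrite big_nil sumr_ge0.
move=> /andP[as_ us] ss'; rewrite big_cons (big_rem a (ss' _ (mem_head _ _)))/= lerD2l.
apply: IH => // x xs; have xs' : x \in s' by apply: ss'; rewrite inE xs orbT.
have xa : x != a by apply: contraNneq as_ => <-.
by move: xs'; rewrite (perm_mem (perm_to_rem (ss' _ (mem_head _ _)))) inE (negPf xa).
Qed.

Lemma esum_le_finite (f : T -> R[i]) (C : R) :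
  (forall s : seq T, uniq s -> \sum_(t <- s) nsq (f t) <= C) ->
  (\esum_(t in [set: T]) (nsq (f t))%:E <= C%:E)%E.
Proof.
move=> fC; apply: ge_ereal_sup => _ [A [fA _] <-].
by rewrite fsbig_finite//= sumEFin lee_fin fC.
Qed.

Lemma finite_le_sqsum (X : set T) (f : ell2 R X) (s : seq T) : uniq s ->
  \sum_(t <- s) nsq (f t) <= sqsum f.
Proof.
move=> us; rewrite -lee_fin sqsumE -sumEFin; apply: esum_ge.
exists [set` s]; first by split => //; exact: finite_seq.
rewrite fsbig_finite ?finite_seq//= le_eqVlt; apply/orP; left; apply/eqP.
apply: perm_big; apply: uniq_perm => // x.
by rewrite in_fset_set ?finite_seq// mem_setE.
Qed.

End FiniteSums.

(** * The representation on the orbit *)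

Section OrbitSpace.
Variables (R : realType) (S : taf_system R) (L : af_limit S) (c : thread L).
Local Notation star := (@cs_star R L).
Local Notation K := (th_start c).
Local Notation V := (@ell2 R (L -> R[i] : choiceType) (orbit c)).
Local Notation M l := (fdalg R (@bsize R S (K + l))).
Implicit Types (xi eta : V) (a b : L).

Definition level_coord (f : (L -> R[i]) -> R[i]) l (s : 'I_(th_dim c l)) : R[i] := f (pt s).

Lemma orbit_common (s : seq (L -> R[i] : choiceType)) : exists l0, forall l, (l0 <= l)%N ->
  forall g, g \in s -> orbit c g -> exists t : 'I_(th_dim c l), g = pt t.
Proof.
elim: s => [|g s [l0 IH]]; first by exists 0%N.
have [[l1 [t gt]]|ng] := pselect (orbit c g); last first.
  exists l0 => l ll g'; rewrite inE => /orP[/eqP ->//|]; exact: IH.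
exists (maxn l0 l1) => l; rewrite geq_max => /andP[ll0 ll1] g'; rewrite inE.
move=> /orP[/eqP -> _|]; last exact: IH.
by have [t' [_ e]] := pt_lift t ll1; exists t'; rewrite gt e.
Qed.

Definition level_pts l : seq (L -> R[i] : choiceType) :=
  [seq pt t | t <- index_enum 'I_(th_dim c l)].

Lemma level_pts_uniq l : uniq (level_pts l).
Proof. by rewrite map_inj_uniq ?index_enum_uniq//; exact: pt_inj. Qed.

Lemma mem_level_pts l (t : 'I_(th_dim c l)) : (pt t : (L -> R[i] : choiceType)) \in level_pts l.
Proof. by apply: map_f; rewrite mem_index_enum. Qed.

Lemma level_sq_le xi l : block_sq (level_coord xi (l := l)) <= sqsum xi.
Proof.
have := finite_le_sqsum xi (level_pts_uniq l).
by rewrite /level_pts big_map.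
Qed.

(** Finitely many points of the orbit are all visible at one late level, so finite partial sums are
    bounded by the sum over a level. *)
Lemma level_sq_bound (f : (L -> R[i]) -> R[i]) (C : R) l0 :
  (forall g, ~ orbit c g -> f g = 0) ->
  (forall l, (l0 <= l)%N -> block_sq (level_coord f (l := l)) <= C) ->
  (\esum_(g in [set: L -> R[i]]) (nsq (f g))%:E <= C%:E)%E.
Proof.
move=> f0 fC; apply: esum_le_finite => s us.
have [l1 sl1] := orbit_common s.
apply: le_trans (fC _ (leq_maxl l0 l1)); set l := maxn l0 l1.
rewrite (bigID (fun g => `[< orbit c g >]))/= [X in _ + X]big1 ?addr0; last first.
  by move=> g /asboolP/f0 ->; rewrite /nsq/= expr0n addr0.
rewrite -big_filter; apply: (@le_trans _ _ (\sum_(g <- level_pts l) nsq (f g))).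
  apply: ler_sum_subset; [by move=> g; exact: nsq_ge0|exact: filter_uniq|].
  move=> g; rewrite mem_filter => /andP[/asboolP og gs].
  by have [t ->] := sl1 _ (leq_maxr l0 l1) g gs og; exact: mem_level_pts.
by rewrite /level_pts big_map.
Qed.

Definition acts_to l (x : M l) xi eta := forall s, level_coord eta s =
  block_app x (level_coord xi (l := l)) s.

(** For a fixed [xi] this is the graph of a bounded linear map defined on the union of the levels,
    in the form required by [bounded_extension]. *)
Definition graph xi a eta := exists l0, forall l, (l0 <= l)%N ->
  exists2 x : M l, a = af_in L (K + l) x & acts_to x xi eta.

Lemma acts_to_linl l d (x x' : M l) xi eta eta' : acts_to x xi eta -> acts_to x' xi eta' ->
  acts_to (d *: x + x') xi (d *: eta + eta').
Proof.
move=> xe xe' s; rewrite /level_coord !ell2E -/(level_coord eta s) -/(level_coord eta' s).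
rewrite xe xe' /block_app mulr_sumr -big_split; apply: eq_bigr => t _.
by rewrite !mxE mulrDl mulrA.
Qed.

Lemma acts_to_linr l d (x : M l) xi xi' eta eta' : acts_to x xi eta -> acts_to x xi' eta' ->
  acts_to x (d *: xi + xi') (d *: eta + eta').
Proof.
move=> xe xe' s; rewrite /level_coord !ell2E -/(level_coord eta s) -/(level_coord eta' s).
rewrite xe xe' /block_app mulr_sumr -big_split; apply: eq_bigr => t _.
by rewrite /level_coord !ell2E mulrDr mulrCA.
Qed.

Lemma acts_toM l (x y : M l) xi eta zeta : acts_to y xi eta -> acts_to x eta zeta ->
  acts_to (fd_mul x y) xi zeta.
Proof.
move=> ye xe s; rewrite xe block_appM; congr (block_app x _ s).
by apply/funext => t; exact: ye.
Qed.

Lemma graph_lin xi d a b eta eta' : graph xi a eta -> graph xi b eta' ->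
  graph xi (d *: a + b) (d *: eta + eta').
Proof.
move=> [l0 ga] [l1 gb]; exists (maxn l0 l1) => l; rewrite geq_max => /andP[/ga[x ax xe]].
move=> /gb[y bx ye]; exists (d *: x + y); first by rewrite ax bx linearP.
exact: acts_to_linl.
Qed.

Lemma graph_le xi a eta : graph xi a eta -> rnorm eta <= rnorm xi * rnorm a.
Proof.
move=> [l0 ga]; rewrite -(@ler_pXn2r _ 2)// ?nnegrE ?mulr_ge0 ?rnorm_ge0//.
rewrite exprMn !rnorm_ell2 -lee_fin sqsumE; apply: (@level_sq_bound _ _ l0).
  by move=> g; exact: ell2_out.
move=> l /ga[x ax xe].
have -> : level_coord eta (l := l) = block_app x (level_coord xi (l := l)).
  by apply/funext => s; exact: xe.
apply: le_trans (block_app_le L _ _) _; rewrite -ax mulrC.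
by rewrite ler_wpM2r ?exprn_ge0 ?rnorm_ge0// level_sq_le.
Qed.

Lemma graph_exists xi l0 (x : M l0) : exists eta, forall l (y : M l), (l0 <= l)%N ->
  af_in L (K + l) y = af_in L (K + l0) x -> acts_to y xi eta.
Proof.
(* A matrix unit acts on functions of functionals by precomposition with its left multiplication;
   this is extended linearly through the entries of [x], and cut off outside of the orbit. *)
pose f (g : L -> R[i]) : R[i] := if `[< orbit c g >] then
  \sum_u coord x u * xi (fun z => g (cs_mul L (unit_in L u) z)) else 0.
have f0 g : ~ orbit c g -> f g = 0 by move=> og; rewrite /f asboolF.
have fE l (y : M l) (s : 'I_(th_dim c l)) : (l0 <= l)%N ->
    af_in L (K + l) y = af_in L (K + l0) x ->
    level_coord f s = block_app y (level_coord xi (l := l)) s.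
  move=> ll0 yx; have KK : (K + l0 <= K + l)%N by rewrite leq_add2l.
  have [Y YP] := choice (fun u => af_in_lift L (munit R u) KK).
  have yE : y = \sum_u coord x u *: Y u.
    apply: (@af_in_inj _ _ L); rewrite yx af_in_coord linear_sum.
    by apply: eq_bigr => u _; rewrite linearZ/= YP unit_inE.
  rewrite /level_coord /f asboolT; last exact: orbit_pt.
  transitivity (\sum_u coord x u * \sum_t Y u (th_block c l) s t * xi (pt t)).
    apply: eq_bigr => u _; congr (_ * _); apply: orbit_act => //.
      by move=> g; exact: ell2_out.
    by rewrite YP unit_inE.
  rewrite /block_app; under eq_bigr do rewrite mulr_sumr.
  rewrite exchange_big; apply: eq_bigr => t _.
  rewrite -[y _ s t]/(coord y (th_unit s t)) yE coord_sum mulr_suml.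
  by apply: eq_bigr => u _; rewrite coordZ mulrA.
have fP : f \in @ell2_pred R _ (orbit c).
  apply/asboolP; split=> [g|]; first exact: f0.
  apply: le_lt_trans (ltry (rnorm (af_in L _ x) ^+ 2 * sqsum xi)).
  apply: (@level_sq_bound _ _ l0) => // l ll0.
  have [y yx] := af_in_lift L x (leq_add (leqnn K) ll0).
  have -> : level_coord f (l := l) = block_app y (level_coord xi (l := l)).
    by apply/funext => s; exact: fE.
  apply: le_trans (block_app_le L _ _) _; rewrite yx.
  by rewrite ler_wpM2l ?exprn_ge0 ?rnorm_ge0// level_sq_le.
by exists (Ell2 fP) => l y ll0 yx s; exact: fE.
Qed.

Lemma graph_intro xi eta l0 (x : M l0) : (forall l (y : M l), (l0 <= l)%N ->
  af_in L (K + l) y = af_in L (K + l0) x -> acts_to y xi eta) ->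
  graph xi (af_in L (K + l0) x) eta.
Proof.
move=> h; exists l0 => l ll0.
have [y yx] := af_in_lift L x (leq_add (leqnn K) ll0).
by exists y => //; exact: h.
Qed.

Lemma af_in_start j (x : fdalg R (@bsize R S j)) : exists l (y : M l),
  af_in L (K + l) y = af_in L j x.
Proof. by exists j; exact: af_in_lift (leq_addl K j). Qed.

Lemma graph_dense xi : closure [set a | exists eta, graph xi a eta] = setT.
Proof.
apply/seteqP; split=> // a _.
have : closure (\bigcup_i range (af_in L i)) a by rewrite af_dense.
move=> aU B /aU[_ [[j _ [x _ <-]] Bx]]; exists (af_in L j x); split => //.
have [l [y <-]] := af_in_start x; have [eta h] := graph_exists xi y.
by exists eta; exact: graph_intro.
Qed.

Lemma orbit_op_exists : exists Pi : L -> V -> V, forall xi, [/\ linear (Pi^~ xi),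
  forall a, rnorm (Pi a xi) <= rnorm xi * rnorm a
  & forall a eta, graph xi a eta -> Pi a xi = eta].
Proof.
have ext xi : exists G : L -> V, [/\ linear G,
    forall a, rnorm (G a) <= rnorm xi * rnorm a & forall a eta, graph xi a eta -> G a = eta].
  apply: bounded_extension; [exact: rnorm_ge0| | |exact: graph_dense].
    by move=> d a a' eta eta'; exact: graph_lin.
  by move=> a eta; exact: graph_le.
have [G GP] := choice ext; exists (fun a xi => G xi a) => xi; exact: GP.
Qed.

Definition orbit_op : L -> V -> V := projT1 (cid orbit_op_exists).

Lemma orbit_op_lin xi : linear (orbit_op^~ xi).
Proof. by have [] := projT2 (cid orbit_op_exists) xi. Qed.

Lemma orbit_op_le a xi : rnorm (orbit_op a xi) <= rnorm a * rnorm xi.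
Proof. by rewrite mulrC; have [] := projT2 (cid orbit_op_exists) xi. Qed.

Lemma orbit_op_graph xi a eta : graph xi a eta -> orbit_op a xi = eta.
Proof. by have [_ _] := projT2 (cid orbit_op_exists) xi; apply. Qed.

Lemma orbit_op_level l (x : M l) xi : acts_to x xi (orbit_op (af_in L (K + l) x) xi).
Proof.
have [eta h] := graph_exists xi x; rewrite (orbit_op_graph (graph_intro h)).
exact: h.
Qed.

Lemma level_ext xi eta l0 : (forall l, (l0 <= l)%N -> forall s, @level_coord xi l s = level_coord eta s) ->
  xi = eta.
Proof.
move=> h; apply: ell2P => g; have [[l [s ->]]|og] := pselect (orbit c g); last first.
  by rewrite !ell2_out.
have [s' [_ ->]] := pt_lift s (leq_maxl l l0).
exact: h (leq_maxr _ _) s'.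
Qed.

(** Algebraic identities between the operators are checked at the levels, where they are matrix
    identities, and carried to [L] by this. *)
Lemma dense_additive_eq0 (W : normedModType R[i]) (phi : L -> W) (C : R) :
  (forall a b, phi (a - b) = phi a - phi b) -> (forall a, rnorm (phi a) <= C * rnorm a) ->
  (forall l (x : M l), phi (af_in L (K + l) x) = 0) -> forall a, phi a = 0.
Proof.
move=> phiB phiC phi0 a; apply: rnorm_le_eps => e e0.
have B0 : 0 < `|C| + 1 by rewrite ltr_wpDl.
have : closure (\bigcup_i range (af_in L i)) a by rewrite af_dense.
move=> /closure_normP/(_ _ (divr_gt0 e0 B0))[_ [j _ [x _ <-]] ax].
have [l [y yx]] := af_in_start x; rewrite -yx in ax.
have -> : phi a = phi (a - af_in L (K + l) y) by rewrite phiB phi0 subr0.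
apply: le_trans (phiC _) _; set d := rnorm _ in ax *.
apply: (@le_trans _ _ ((`|C| + 1) * d)).
  by rewrite ler_wpM2r ?rnorm_ge0// (le_trans (ler_norm _))// lerDl.
by rewrite mulrC -ler_pdivlMr.
Qed.

Lemma subrACA (W : zmodType) (x y z t : W) : (x - y) - (z - t) = (x - z) - (y - t).
Proof. by rewrite !opprD !opprK addrACA. Qed.

Lemma orbit_opB a b xi : orbit_op (a - b) xi = orbit_op a xi - orbit_op b xi.
Proof.
by rewrite [a - b]addrC -scaleN1r orbit_op_lin scaleN1r addrC.
Qed.

Lemma orbit_op_linear a : linear (orbit_op a).
Proof.
move=> d xi eta; apply/eqP; rewrite -subr_eq0; apply/eqP.
pose phi a := orbit_op a (d *: xi + eta) - (d *: orbit_op a xi + orbit_op a eta).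
apply: (@dense_additive_eq0 _ phi
  (rnorm (d *: xi + eta) + (rnorm d * rnorm xi + rnorm eta))) => {a}.
- move=> a b; rewrite /phi !orbit_opB scalerBr.
  rewrite [_ - _ + (orbit_op a eta - _)]addrACA -opprD.
  exact: subrACA.
- move=> a; rewrite /phi mulrDl; apply: le_trans (rnormD _ _) _; rewrite rnormN lerD//.
    by rewrite mulrC orbit_op_le.
  apply: le_trans (rnormD _ _) _; rewrite rnormZ mulrDl lerD//.
    by rewrite -mulrA ler_wpM2l ?rnorm_ge0// mulrC orbit_op_le.
  by rewrite mulrC orbit_op_le.
move=> l x; apply/eqP; rewrite subr_eq0; apply/eqP; apply: (@level_ext _ _ l) => l' ll'.
have [y yx] := af_in_lift L x (leq_add (leqnn K) ll'); rewrite -yx => s.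
by rewrite orbit_op_level; apply/esym/acts_to_linr; exact: orbit_op_level.
Qed.

Lemma orbit_op_mul_level l l' (x : M l) (y : M l') xi :
  orbit_op (cs_mul L (af_in L (K + l) x) (af_in L (K + l') y)) xi =
  orbit_op (af_in L (K + l) x) (orbit_op (af_in L (K + l') y) xi).
Proof.
apply: (@level_ext _ _ (maxn l l')) => m; rewrite geq_max => /andP[lm lm'] s.
have [x' <-] := af_in_lift L x (leq_add (leqnn K) lm).
have [y' <-] := af_in_lift L y (leq_add (leqnn K) lm').
rewrite -af_inM orbit_op_level; apply/esym.
by apply: acts_toM; exact: orbit_op_level.
Qed.

Lemma orbit_opM a b xi : orbit_op (cs_mul L a b) xi = orbit_op a (orbit_op b xi).
Proof.
apply/eqP; rewrite -subr_eq0; apply/eqP.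
pose phi b a := orbit_op (cs_mul L a b) xi - orbit_op a (orbit_op b xi).
have opB x u v : orbit_op x (u - v) = orbit_op x u - orbit_op x v.
  by rewrite [u - v]addrC -scaleN1r orbit_op_linear scaleN1r addrC.
(* Density is used twice: in [b] first, then in [a] for [b] in some level. *)
apply: (@dense_additive_eq0 _ (fun b => phi b a) (rnorm a * rnorm xi + rnorm a * rnorm xi)) => {b}.
- move=> b b'; rewrite /phi cs_mulBr !orbit_opB opB.
  exact: subrACA.
- move=> b; rewrite /phi mulrDl; apply: le_trans (rnormD _ _) _; rewrite rnormN lerD//.
    apply: le_trans (orbit_op_le _ _) _; rewrite mulrAC ler_wpM2r ?rnorm_ge0//.
    exact: rnorm_mul.
  apply: le_trans (orbit_op_le _ _) _; rewrite -mulrA ler_wpM2l ?rnorm_ge0// mulrC.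
  exact: orbit_op_le.
move=> l' y; set b := af_in _ _ y.
apply: (@dense_additive_eq0 _ (phi b) (rnorm b * rnorm xi + rnorm b * rnorm xi)) => {a}.
- move=> a a'; rewrite /phi cs_mulBl !orbit_opB.
  exact: subrACA.
- move=> a; rewrite /phi mulrDl; apply: le_trans (rnormD _ _) _; rewrite rnormN lerD//.
    apply: le_trans (orbit_op_le _ _) _; rewrite mulrAC ler_wpM2r ?rnorm_ge0//.
    by rewrite mulrC; exact: rnorm_mul.
  apply: le_trans (orbit_op_le _ _) _; rewrite mulrC ler_wpM2r ?rnorm_ge0//.
  exact: orbit_op_le.
by move=> l x; rewrite /phi orbit_op_mul_level subrr.
Qed.

End OrbitSpace.

Section OrbitRepresentation.
Variables (R : realType) (S : taf_system R) (L : af_limit S) (c : thread L).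
Local Notation "x ** y" := (cs_mul L x y) (at level 40, left associativity).
Local Notation star := (@cs_star R L).
Local Notation E := (@unit_in R S L _).
Local Notation K := (th_start c).
Local Notation V := (@ell2 R (L -> R[i] : choiceType) (orbit c)).
Local Notation M l := (fdalg R (@bsize R S (K + l))).
Local Notation A := (taf L).
Implicit Types (xi eta : V) (a b : L) (g h : L -> R[i]).

Definition pdelta l (s : 'I_(th_dim c l)) : V := delta R (orbit c) (pt s : (L -> R[i] : choiceType)).

Lemma pdeltaE l (s t : 'I_(th_dim c l)) : pdelta s (pt t) = (s == t)%:R.
Proof. by rewrite deltaE; [rewrite eq_sym (inj_eq (@pt_inj _ _ _ c l))|exact: orbit_pt]. Qed.

Definition truncate l xi : V := \sum_(s < th_dim c l) xi (pt s) *: pdelta s.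

Lemma truncate_pt l xi (s : 'I_(th_dim c l)) : truncate l xi (pt s) = xi (pt s).
Proof.
rewrite /truncate -(big_map (fun s => xi (pt s) *: pdelta s) predT id) ell2_sum//.
rewrite big_map (bigD1 s)//= big1 => [|t ts].
  by rewrite ell2E pdeltaE eqxx mulr1 addr0.
by rewrite ell2E pdeltaE (negPf ts) mulr0.
Qed.

Lemma truncate_out l xi g : (forall s : 'I_(th_dim c l), g <> pt s) -> truncate l xi g = 0.
Proof.
move=> gs; rewrite /truncate -(big_map (fun s => xi (pt s) *: pdelta s) predT id) ell2_sum//.
rewrite big_map big1// => t _; rewrite ell2E deltaE; last exact: orbit_pt.
by case: eqP => [e|_]; [case: (gs t)|rewrite mulr0].
Qed.

Lemma truncate_cvg xi (e : R) : 0 < e -> exists l0, forall l, (l0 <= l)%N ->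
  rnorm (xi - truncate l xi) <= e.
Proof.
move=> /(ell2_tail xi)[s sP]; have [l0 l0P] := orbit_common c s.
exists l0 => l /l0P ll; apply: sP => g; rewrite ell2B.
  move=> gs; have [og|og] := pselect (orbit c g).
    by have [t ->] := ll _ gs og; rewrite truncate_pt subrr.
  by rewrite !ell2_out// subr0.
have [[t ->]|gt] := pselect (exists t : 'I_(th_dim c l), g = pt t).
  by rewrite truncate_pt subrr /nsq/= expr0n addr0 addr_ge0// sqr_ge0.
by rewrite truncate_out ?subr0// => t e'; apply: gt; exists t.
Qed.

Lemma dot_truncate l xi eta : hs_dot (ell2_hilbert R (orbit c)) (truncate l xi) eta =
  \sum_(s < th_dim c l) xi (pt s) * Num.conj (eta (pt s)).
Proof.
rewrite dot_sum_l; apply: eq_bigr => s _; rewrite dotZl dotC; congr (_ * Num.conj _).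
by apply: dot_delta; exact: orbit_pt.
Qed.

Local Notation dot := (hs_dot (ell2_hilbert R (orbit c))).

(** At a level this is the identity for the adjoint of a matrix, applied to truncated vectors;
    truncations converge, and density does the rest. *)
Lemma orbit_op_starC a xi eta : dot (orbit_op a xi) eta = dot xi (orbit_op (star a) eta).
Proof.
apply/eqP; rewrite -subr_eq0; apply/eqP.
pose phi a := dot (orbit_op a xi) eta - dot xi (orbit_op (star a) eta) : R[i]^o.
apply: (@dense_additive_eq0 _ _ _ c _ phi (rnorm xi * rnorm eta + rnorm xi * rnorm eta)) => {a}.
- move=> a b; rewrite /phi cs_starB !orbit_opB dotBl dotBr; exact: subrACA.
- move=> a; rewrite /phi mulrDl; apply: le_trans (rnormD _ _) _; rewrite rnormN lerD//.
    apply: le_trans (rnorm_dot _ _) _; rewrite mulrAC ler_wpM2r ?rnorm_ge0// mulrC.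
    exact: orbit_op_le.
  apply: le_trans (rnorm_dot _ _) _; rewrite -mulrA ler_wpM2l ?rnorm_ge0// mulrC.
  by apply: le_trans (orbit_op_le _ _) _; rewrite rnorm_star.
move=> l x; apply: rnorm_le_eps => e e0; rewrite /phi.
set xi' := orbit_op _ xi; set eta' := orbit_op _ eta.
have B0 : 0 < rnorm eta + rnorm eta' + 1 by rewrite ltr_wpDl// addr_ge0 ?rnorm_ge0.
have [l1 h1] := truncate_cvg xi' (divr_gt0 e0 B0).
have [l2 h2] := truncate_cvg xi (divr_gt0 e0 B0).
pose m := maxn l (maxn l1 l2).
have {}h1 := h1 m (leq_trans (leq_maxl l1 l2) (leq_maxr l _)).
have {}h2 := h2 m (leq_trans (leq_maxr l1 l2) (leq_maxr l _)).
have [y yx] := af_in_lift L x (leq_add (leqnn K) (leq_maxl l (maxn l1 l2))).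
have e1 : acts_to y xi xi' by rewrite /xi' -yx; exact: orbit_op_level.
have e2 : acts_to (fd_star y) eta eta'.
  by rewrite /eta' -yx -af_in_star; exact: orbit_op_level.
(* Both sides are finite sums over the points of level [m], where [y] and its adjoint act by
   matrices. *)
have key : dot (truncate m xi') eta = dot (truncate m xi) eta'.
  rewrite !dot_truncate.
  transitivity (\sum_s block_app y (level_coord xi (l := m)) s * Num.conj (level_coord eta s)).
    by apply: eq_bigr => s _; rewrite -e1.
  rewrite block_app_star; apply: eq_bigr => s _; congr (_ * Num.conj _).
  by rewrite -e2.
have -> : dot xi' eta - dot xi eta' =
    dot (xi' - truncate m xi') eta - dot (xi - truncate m xi) eta'.
  by rewrite !dotBl key opprB addrA subrK.
set d := e / _ in h1 h2.
apply: (@le_trans _ _ (d * rnorm eta + d * rnorm eta')).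
  apply: le_trans (rnormD _ _) _; rewrite rnormN lerD//.
    by apply: le_trans (rnorm_dot _ _) _; rewrite ler_wpM2r ?rnorm_ge0.
  by apply: le_trans (rnorm_dot _ _) _; rewrite ler_wpM2r ?rnorm_ge0.
rewrite -mulrDr /d -mulrA -[leRHS]mulr1 ler_wpM2l ?(ltW e0)//.
by rewrite mulrC ler_pdivrMr// mul1r lerDl.
Qed.

HB.instance Definition _ a := GRing.isLinear.Build R[i] V V *:%R (orbit_op (c := c) a)
  (@orbit_op_linear _ _ _ c a).

Definition orbit_rep_op (a : A) : {linear V -> V} := orbit_op (c := c) (\val a).

Lemma orbit_rep_linear d (a b : A) xi :
  orbit_rep_op (d *: a + b) xi = d *: orbit_rep_op a xi + orbit_rep_op b xi.
Proof. exact: orbit_op_lin. Qed.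

Lemma orbit_rep_mul (a b : A) xi :
  orbit_rep_op (taf_mul a b) xi = orbit_rep_op a (orbit_rep_op b xi).
Proof. exact: orbit_opM. Qed.

Lemma orbit_rep_bounded : exists B : R, forall (a : A) xi,
  rnorm (orbit_rep_op a xi) <= B * rnorm (\val a) * rnorm xi.
Proof. by exists 1 => a xi; rewrite mul1r; exact: orbit_op_le. Qed.

Definition orbit_rep : representation L := @Representation R S L
  (ell2_hilbert R (orbit c)) orbit_rep_op orbit_rep_linear orbit_rep_mul orbit_rep_bounded.

Lemma orbit_rep_star : star_on_diagonal orbit_rep.
Proof. by move=> a b ab x y; rewrite /= ab orbit_op_starC. Qed.

(** The action is known only at the points of each level. But the image has norm at most 1 and its
    coordinate at [pt s] is already 1, so nothing is left for the other points. *)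
Lemma orbit_op_unit l (s t : 'I_(th_dim c l)) :
  orbit_op (E (th_unit s t)) (pdelta t) = pdelta s.
Proof.
set eta := orbit_op _ _.
have eta1 : sqsum eta <= 1.
  rewrite -rnorm_ell2 expr_le1// ?rnorm_ge0//; apply: le_trans (orbit_op_le _ _) _.
  by rewrite rnorm_unit mul1r rnorm_delta//; exact: orbit_pt.
have etas : eta (pt s) = 1.
  rewrite -/(level_coord eta s) /eta unit_inE orbit_op_level /block_app.
  rewrite (bigD1 t)//= big1 ?addr0 => [|t' tt'].
    rewrite /level_coord pdeltaE eqxx mulr1.
    by rewrite -[LHS]/(coord (munit R (th_unit s t)) (th_unit s t)) coord_munit eqxx.
  by rewrite /level_coord pdeltaE eq_sym (negPf tt') mulr0.
apply/eqP; rewrite -subr_eq0; apply/eqP; apply: sqsum_eq0; apply/eqP.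
rewrite eq_le sqsum_ge0 andbT -lecR -rnorm_ell2 rmorphXn/= -rnormE.
have os : orbit c (pt s) by exact: orbit_pt.
have -> : `|eta - pdelta s| ^+ 2 = dot (eta - pdelta s) (eta - pdelta s).
  exact: hs_norm (eta - pdelta s : ell2_hilbert R (orbit c)).
rewrite dotBl !dotBr.
have de x : dot x (pdelta s) = x (pt s) by exact: dot_delta.
rewrite [dot (pdelta s) eta]dotC !de etas pdeltaE eqxx conjC1 subrr subr0.
have <- : `|eta| ^+ 2 = dot eta eta by exact: hs_norm (eta : ell2_hilbert R (orbit c)).
by rewrite rnormE -rmorphXn/= rnorm_ell2 subr_le0 lecR.
Qed.

Lemma orbit_op_unit0 l (s t t' : 'I_(th_dim c l)) : t != t' ->
  orbit_op (E (th_unit s t)) (pdelta t') = 0.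
Proof.
move=> tt'; rewrite -(orbit_op_unit t' t') -orbit_opM unit_mul0.
  by have := orbit_opB (0 : L) 0 (pdelta t'); rewrite !subrr => ->.
by apply: contra_neq tt' => /eqP; rewrite eq_Tagged => /eqP.
Qed.

(** The diagonal projections at one point decrease strongly to the projection onto its basis vector.
    This lets a closed invariant subspace split off single coordinates. *)
Lemma orbit_proj_cvg xi l1 (s1 : 'I_(th_dim c l1)) (e : R) : 0 < e ->
  exists l (s : 'I_(th_dim c l)), pt s = pt s1 /\
  rnorm (orbit_op (E (th_unit s s)) xi - xi (pt s) *: pdelta s) <= e.
Proof.
move=> /(truncate_cvg xi)[l0 l0P]; have {}l0P := l0P _ (leq_maxr l1 l0).
set l := maxn l1 l0 in l0P; have [s [_ ss]] := pt_lift s1 (leq_maxl l1 l0).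
exists l, s; split => //.
have -> : xi (pt s) *: pdelta s = orbit_op (E (th_unit s s)) (truncate l xi).
  rewrite /truncate linear_sum (bigD1 s)//= big1 => [|t ts].
    by rewrite linearZ/= orbit_op_unit addr0.
  by rewrite linearZ/= orbit_op_unit0 ?scaler0// eq_sym.
rewrite -linearB; apply: le_trans (orbit_op_le _ _) _.
by rewrite rnorm_unit mul1r.
Qed.

End OrbitRepresentation.

(** * The order of the orbit and the invariant subspaces *)

Section OrbitLattice.
Variables (R : realType) (S : taf_system R) (L : af_limit S) (c : thread L).
Local Notation E := (@unit_in R S L _).
Local Notation K := (th_start c).
Local Notation V := (@ell2 R (L -> R[i] : choiceType) (orbit c)).
Local Notation M l := (fdalg R (@bsize R S (K + l))).
Local Notation A := (taf L).
Local Notation taf_in := (@taf_in R S L _).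
Local Notation taf_unit := (@taf_unit R S L _).
Local Notation rho := (orbit_rep c).
Implicit Types (xi eta : V) (g h : L -> R[i]).

Lemma orbit_rep_unit l (u : munit_index (@bsize R S (K + l))) xi : munit_upper u ->
  rho (taf_unit u) xi = orbit_op (E u) xi.
Proof. by move=> uu; rewrite /= /orbit_rep_op (val_taf_unit L uu). Qed.

Lemma unit_inj j : injective (@unit_in R S L j).
Proof.
move=> u v; rewrite !unit_inE => /(@af_in_inj _ _ L) uv.
have := coord_munit R v u; rewrite -uv coord_munit eqxx.
by have [->|_ /eqP] := eqVneq u v; rewrite ?oner_eq0.
Qed.

Lemma th_unit_to l (s t : 'I_(th_dim c l)) :
  cs_mul L (E (th_unit s t)) (E (to_unit t)) = E (to_unit s).
Proof.
rewrite unit_mul//; congr E; apply: rng_src_inj => //.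
by rewrite src_comp// !src_to_unit.
Qed.

(** The unit from [t] to [s] has a summand from [t'] to [s'], and summands of an upper triangular
    unit are upper triangular. Hence the order of two points survives at later levels. *)
Lemma th_unit_lift l l' (s t : 'I_(th_dim c l)) (s' t' : 'I_(th_dim c l')) : (l <= l')%N ->
  pt s = pt s' -> pt t = pt t' -> (s <= t)%N -> (s' <= t')%N.
Proof.
move=> ll' ss tt st; have KK : (K + l <= K + l')%N by rewrite leq_add2l.
have [s2 [ps s2E]] := pt_lift s ll'; have [t2 [pt2 t2E]] := pt_lift t ll'.
have {s2E} s2s : s2 = s' by apply: pt_inj; rewrite -s2E.
have {t2E} t2t : t2 = t' by apply: pt_inj; rewrite -t2E.
subst s2 t2.
have stt : cs_mul L (E (th_unit s t)) (E (to_unit t')) = E (to_unit s').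
  by rewrite -ps -pt2 !cs_mulA th_unit_to !src_to_unit.
have [|v [sv pv upv _]] := @unit_lift R S L _ _ (th_unit s t) (munit_rng (to_unit t')) KK.
  move=> e; have := unit_neq0 L (to_unit s').
  by rewrite -stt -(diag_unit L (to_unit t')) cs_mulA e cs_mul0l eqxx.
have : E (to_unit s') = E (munit_comp v (to_unit t')).
  by rewrite -unit_mul// -pv sv -cs_mulA diag_unit.
move=> /unit_inj vE; have rv : munit_rng v = munit_rng (to_unit s').
  by rewrite vE rng_comp.
have -> : (s' <= t')%N = munit_upper (th_unit s' t') by [].
suff <- : v = th_unit s' t' by exact: upv.
by apply: rng_src_inj => //; rewrite sv.
Qed.

Definition ple g h := exists l (s t : 'I_(th_dim c l)), [/\ g = pt s, h = pt t & (s <= t)%N].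

(** If the order at another level were reversed at level [l], both orders would hold at a common
    later level and the points would coincide. *)
Lemma pleP l (s t : 'I_(th_dim c l)) : ple (pt s) (pt t) <-> (s <= t)%N.
Proof.
split=> [|st]; last by exists l, s, t.
move=> [l1 [s1 [t1 [ss tt st1]]]]; pose m := maxn l l1.
have [s' [_ s'E]] := pt_lift s (leq_maxl l l1).
have [t' [_ t'E]] := pt_lift t (leq_maxl l l1).
have st' : (s' <= t')%N by apply: (th_unit_lift (leq_maxr l l1) _ _ st1); rewrite -?ss -?tt.
rewrite leqNgt; apply/negP => ts.
have ts' : (t' <= s')%N by apply: (th_unit_lift (leq_maxl l l1) t'E s'E (ltnW ts)).
have e : s' = t' by apply/val_inj/eqP; rewrite eqn_leq st' ts'.
have : s = t by apply: pt_inj; rewrite s'E t'E e.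
by move=> est; rewrite est ltnn in ts.
Qed.

Lemma orbit_common2 g h l0 : orbit c g -> orbit c h -> exists l, (l0 <= l)%N /\
  exists s t : 'I_(th_dim c l), g = pt s /\ h = pt t.
Proof.
move=> og oh; have [l1 h1] := orbit_common c [:: g : (L -> R[i] : choiceType); h].
exists (maxn l0 l1); split; first exact: leq_maxl.
have [s gs] := h1 _ (leq_maxr l0 l1) g (mem_head _ _) og.
have [|t ht] := h1 _ (leq_maxr l0 l1) h _ oh; first by rewrite !inE eqxx orbT.
by exists s, t.
Qed.

Lemma ple_orbit g h : ple g h -> orbit c g /\ orbit c h.
Proof. by move=> [l [s [t [-> -> _]]]]; split; exact: orbit_pt. Qed.

Lemma ple_total g h : orbit c g -> orbit c h -> ple g h \/ ple h g.
Proof.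
move=> og oh; have [l [_ [s [t [-> ->]]]]] := orbit_common2 0 og oh.
have [st|ts] := leqP s t; first by left; apply/pleP.
by right; apply/pleP; exact: ltnW.
Qed.

Lemma ple_trans g h k : ple g h -> ple h k -> ple g k.
Proof.
move=> gh hk; have [og oh] := ple_orbit gh; have [_ ok] := ple_orbit hk.
have [l [_ [s [t [gs ht]]]]] := orbit_common2 0 og oh.
have [l' [ll' [t' [u' [ht' ku']]]]] := orbit_common2 l oh ok.
have [s' [_ s'E]] := pt_lift s ll'; move: gh hk.
rewrite gs s'E ht' ku' => /pleP st /pleP tu; apply/pleP; exact: leq_trans tu.
Qed.

Lemma ple_anti g h : ple g h -> ple h g -> g = h.
Proof.
move=> gh; have [og oh] := ple_orbit gh; move: gh.
have [l [_ [s [t [-> ->]]]]] := orbit_common2 0 og oh.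
move=> /pleP st /pleP ts; congr pt; apply/val_inj/eqP.
by rewrite eqn_leq st ts.
Qed.

Let dlt g : V := delta R (orbit c) (g : (L -> R[i] : choiceType)).

Lemma lat_delta (N : set V) xi g : @rep_lat _ _ _ rho N -> N xi -> xi g <> 0 -> N (dlt g).
Proof.
move=> [N0 Nlin Ncl Ninv] Nxi xig; have og : orbit c g.
  by apply: contrapT => ng; apply: xig; exact: ell2_out.
have Nscale a x : N x -> N (a *: x) by move=> Nx; rewrite -[_ *: _]addr0; exact: Nlin.
suff : N (xi g *: dlt g).
  by move=> /(Nscale (xi g)^-1); rewrite scalerA mulVf ?scale1r//; apply/eqP.
apply: closed_normP => // e e0; have [l1 [s1 gs]] := og.
have [l [s [ss he]]] := orbit_proj_cvg xi s1 e0.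
exists (rho (taf_unit (th_unit s s)) xi); first exact: Ninv.
rewrite orbit_rep_unit; last by rewrite /munit_upper/=.
by rewrite gs -ss rnormBC.
Qed.

Lemma lat_down (N : set V) g h : @rep_lat _ _ _ rho N -> N (dlt h) -> ple g h -> N (dlt g).
Proof.
move=> [_ _ _ Ninv] Nh [l [s [t [gs ht st]]]].
have := Ninv (taf_unit (th_unit s t)) _ Nh.
by rewrite orbit_rep_unit// ht -/(pdelta t) orbit_op_unit gs.
Qed.

Lemma lat_span (N : set V) xi : @rep_lat _ _ _ rho N ->
  (forall g, xi g <> 0 -> N (dlt g)) -> N xi.
Proof.
move=> [N0 Nlin Ncl _] h; apply: ell2_closed_span => // g /eqP; exact: h.
Qed.

Definition supported (D : set (L -> R[i])) : set V := [set xi | forall g, ~ D g -> xi g = 0].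

(** An upper triangular matrix computes the coordinate at [s] from those at [t] with s <= t, which
    all vanish when [s] is outside of an initial segment. Closedness extends this from the levels to
    all of the algebra. *)
Lemma lat_supported (D : set (L -> R[i])) : (forall g h, ple g h -> D h -> D g) ->
  @rep_lat _ _ _ rho (supported D).
Proof.
move=> down; have cl : closed (supported D).
  move=> xi /closure_normP xiD g ng; apply: rnorm_le_eps => e e0.
  have [eta etaD xe] := xiD _ e0; apply: le_trans xe.
  have -> : xi g = (xi - eta : V) g by rewrite ell2B etaD// subr0.
  rewrite -(@ler_pXn2r _ 2)// ?nnegrE ?rnorm_ge0// rnorm_sqr rnorm_ell2.
  exact: nsq_le_sqsum.
split => //.
  by move=> a x y xD yD g ng; rewrite !ell2E xD// yD// mulr0 addr0.
move=> a xi xiD; apply: (closed_normP cl) => e e0.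
have B0 : 0 < rnorm xi + 1 by rewrite ltr_wpDl ?rnorm_ge0.
have [i [x [ux ax]]] := taf_dense a (divr_gt0 e0 B0).
have iK := leq_addl K i; have [y [uy yx yx']] := taf_lift L iK ux.
rewrite -yx in ax; exists (rho (taf_in y) xi); last first.
  have -> : rho a xi - rho (taf_in y) xi = orbit_op (\val a - \val (taf_in y)) xi.
    by rewrite orbit_opB.
  apply: le_trans (orbit_op_le _ _) _; set d := e / _ in ax.
  apply: (@le_trans _ _ (d * rnorm xi)); first by rewrite ler_wpM2r ?rnorm_ge0.
  rewrite /d -mulrA -[leRHS]mulr1 ler_wpM2l ?(ltW e0)// mulrC ler_pdivrMr//.
  by rewrite mul1r lerDl.
move=> g ng; have [og|og] := pselect (orbit c g); last exact: ell2_out.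
have [l [il [s [_ [gs _]]]]] := orbit_common2 i og og.
have KK : (K + i <= K + l)%N by rewrite leq_add2l.
have [z [uz zy zy']] := taf_lift L KK uy.
rewrite gs /= /orbit_rep_op -zy val_taf_in// -/(level_coord _ s) orbit_op_level.
rewrite /block_app big1// => t _; have [st|ts] := leqP s t; last first.
  by rewrite (uz _ s t ts) mul0r.
rewrite /level_coord xiD ?mulr0// => Dt; apply: ng.
by rewrite gs; apply: down Dt; apply/pleP.
Qed.

(** If a vector of [N] charges a point [g] whose basis vector is not in [N'], then every point
    charged by [N'] lies below [g], for otherwise [N'] would contain that basis vector. *)
Lemma orbit_rep_nest : nest_rep rho.
Proof.
move=> N N' NL NL'; apply: contrapT => /not_orP[/existsNP[xi /not_implyP[Nxi N'xi]] h].
apply: h => eta N'eta; have [g [xig N'g]] : exists g, xi g <> 0 /\ ~ N' (dlt g).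
  apply: contrapT => none; apply: N'xi; apply: lat_span => // g xig.
  by apply: contrapT => N'g; apply: none; exists g.
have Ng : N (dlt g) by exact: lat_delta Nxi xig.
apply: lat_span => // h etah; have N'h : N' (dlt h) by exact: lat_delta N'eta etah.
have orb (x : V) k : x k <> 0 -> orbit c k.
  by move=> xk; apply: contrapT => ok; apply: xk; exact: ell2_out.
have [gh|hg] := ple_total (orb _ _ xig) (orb _ _ etah).
  by case: N'g; exact: lat_down N'h gh.
exact: lat_down Ng hg.
Qed.

Lemma orbit_rep_nrep : nrep_star rho.
Proof. by split; [exact: orbit_rep_nest|exact: orbit_rep_star]. Qed.

(** The closed and the strict initial segments at the point differ by one coordinate, so no
    invariant subspace lies strictly between them. *)
Lemma lat_atom_delta l (s : 'I_(th_dim c l)) : @lat_atom _ _ _ rho (line (pdelta s : rep_space rho)).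
Proof.
pose DN g := ple g (pt s); pose DM g := ple g (pt s) /\ g <> pt s.
have latN : @rep_lat _ _ _ rho (supported DN).
  by apply: lat_supported => g h gh; exact: ple_trans.
have latM : @rep_lat _ _ _ rho (supported DM).
  apply: lat_supported => g h gh [hs hns]; split; first exact: ple_trans hs.
  by move=> gs; apply: hns; apply: ple_anti => //; rewrite -gs.
have pss : ple (pt s) (pt s) by apply/pleP.
have Nd : supported DN (pdelta s).
  move=> g ng; rewrite deltaE; last exact: orbit_pt.
  by case: eqP => // gs; case: ng; rewrite gs.
have decomp (xi : V) : supported DN xi -> supported DM (xi - xi (pt s) *: pdelta s).
  move=> xiN g ng; rewrite ell2B ell2Z deltaE; last exact: orbit_pt.
  case: eqP => [->|gs]; first by rewrite mulr1 subrr.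
  by rewrite mulr0 subr0; apply: xiN => pg; apply: ng.
exists (supported DN), (supported DM); split => //.
- split; first by move=> x xM g ng; apply: xM => -[].
  move=> /(_ (pdelta s) Nd)/(_ (pt s)); rewrite pdeltaE eqxx => h.
  have /eqP : (1 : R[i]) = 0 by apply: h => -[].
  by rewrite oner_eq0.
- move=> N NL MN NN; have [Ns|Ns] := pselect (N (pdelta s)).
    right; apply/seteqP; split => // xi xiN.
    rewrite -(subrK (xi (pt s) *: pdelta s) xi) addrC.
    by have [_ Nlin _ _] := NL; apply: Nlin => //; apply: MN; exact: decomp.
  left; apply/seteqP; split => // xi Nxi g ng.
  have [gs|gs] := pselect (g = pt s); last first.
    by apply: (NN _ Nxi) => pg; apply: ng.
  by apply: contrapT => xig; apply: Ns; rewrite /pdelta -gs; exact: lat_delta Nxi xig.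
apply/seteqP; split => [_ [a _ <-]|xi [xiN xiM]].
  split; first by move=> g ng; rewrite ell2Z (Nd g ng) mulr0.
  move=> y yM; rewrite dotZl dotC.
  have -> : hs_dot (rep_space rho) y (pdelta s) = y (pt s).
    by apply: dot_delta; exact: orbit_pt.
  by rewrite yM ?conjC0 ?mulr0// => -[].
exists (xi (pt s)) => //; have dM := decomp xi xiN.
apply/eqP; rewrite eq_sym -subr_eq0; apply/eqP; apply: (@dot_eq0 R (rep_space rho)).
rewrite dotBl xiM// dotZl dotC.
have -> : hs_dot (rep_space rho) (xi - xi (pt s) *: pdelta s) (pdelta s) =
    (xi - xi (pt s) *: pdelta s : V) (pt s) by apply: dot_delta; exact: orbit_pt.
by rewrite dM ?conjC0 ?mulr0 ?subr0// => -[].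
Qed.

Lemma coef_delta l (s t : 'I_(th_dim c l)) : (s <= t)%N ->
  germ (coef (pdelta t : rep_space rho) (pdelta s)) 1 (th_unit s t).
Proof.
move=> st; split => // x ux; rewrite mul1r /coef.
have -> : hs_dot (rep_space rho) (rho (taf_in x) (pdelta t)) (pdelta s) =
    (rho (taf_in x) (pdelta t) : V) (pt s) by apply: dot_delta; exact: orbit_pt.
rewrite /= /orbit_rep_op val_taf_in// -/(level_coord _ s) orbit_op_level /block_app.
rewrite (bigD1 t)//= big1 ?addr0 => [|t' tt']; first by rewrite /level_coord pdeltaE eqxx mulr1.
by rewrite /level_coord pdeltaE eq_sym (negPf tt') mulr0.
Qed.

End OrbitLattice.

(** * Elements of the spectrum as coefficients of orbit representations *)

Section Realization.
Variables (R : realType) (S : taf_system R) (L : af_limit S).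
Local Notation A := (taf L).
Local Notation E := (@unit_in R S L _).
Local Notation idx j := (munit_index (@bsize R S j)).
Implicit Types (w : A -> R[i]).

Section Thread.
Variable c : thread L.
Local Notation K := (th_start c).
Local Notation rho := (orbit_rep c).

Definition base l : 'I_(th_dim c l) := tagged (th_row c l).
Definition pdlt (g : L -> R[i]) : rep_space rho :=
  delta R (orbit c) (g : (L -> R[i] : choiceType)).

Lemma pt_part l l' (s : 'I_(th_dim c l)) (s' : 'I_(th_dim c l')) : (l <= l')%N ->
  part L (to_unit s) (to_unit s') -> pt s = pt s'.
Proof.
move=> ll' ss'; have [t [st ->]] := pt_lift s ll'; congr pt.
apply: to_unit_inj; apply: (@unit_inj R S L).
by rewrite -st -ss' !src_to_unit.
Qed.

Lemma part_pt l l' (s : 'I_(th_dim c l)) (s' : 'I_(th_dim c l')) : (l <= l')%N ->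
  pt s = pt s' -> part L (to_unit s) (to_unit s').
Proof.
move=> ll' ss'; have [t [st e]] := pt_lift s ll'.
by have <- : t = s' by apply: pt_inj; rewrite -e.
Qed.

Lemma pt_base l : pt (base l) = pt (base 0).
Proof.
apply/esym/pt_part => //.
have toE m : to_unit (base m) = munit_diag (th_row c m).
  by apply: rng_src_inj; rewrite ?rng_diag ?src_diag ?src_to_unit// /munit_rng/=;
     rewrite /base /th_block; case: (th_row c m).
by rewrite /part src_to_unit !toE -!diag_inE; exact: th_below.
Qed.

(** If the units carrying [w] have the point [g] of the orbit as source, their ranges at all high
    levels name one point, which is [h]. *)
Lemma realize w g : dual_form w ->
  (\forall l \near \oo, exists s t : 'I_(th_dim c l), pt t = g /\ germ w 1 (th_unit s t)) ->
  exists h, [/\ w = coef (pdlt g) (pdlt h), lat_atom (line (pdlt g)), lat_atom (line (pdlt h))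
    & \forall l \near \oo, exists s t : 'I_(th_dim c l),
      [/\ pt t = g, pt s = h & germ w 1 (th_unit s t)]].
Proof.
move=> dw [l0 _ wl]; have [s0 [t0 [t0g w0]]] := wl l0 (leqnn _).
have near_h l : (l0 <= l)%N -> exists s t : 'I_(th_dim c l),
    [/\ pt t = g, pt s = pt s0 & germ w 1 (th_unit s t)].
  (* The unit at [l] is a part of the unit at [l0]; applied to parts of the same point [g], they
     give parts of the same point. *)
  move=> ll0; have [s [t [tg ws]]] := wl l ll0; exists s, t; split => //.
  have KK : (K + l0 <= K + l)%N by rewrite leq_add2l.
  apply/esym/pt_part => //; rewrite /part.
  have tt : part L (to_unit t0) (to_unit t) by apply: part_pt => //; rewrite t0g.
  have uu : part L (th_unit s0 t0) (th_unit s t) by exact: germ_part KK (oner_neq0 _) w0 ws.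
  have {}tt : cs_mul L (E (to_unit t0)) (diag_in L (th_row c l)) = E (to_unit t).
    by rewrite -tt src_to_unit.
  rewrite -(th_unit_to s0 t0) src_to_unit -cs_mulA tt -(diag_unit L (to_unit t)).
  rewrite cs_mulA; have -> : munit_rng (to_unit t) = munit_src (th_unit s t) by [].
  by rewrite uu th_unit_to.
exists (pt s0); rewrite -t0g; split; [|exact: lat_atom_delta|exact: lat_atom_delta|]; last first.
  by exists l0 => // l /near_h; rewrite t0g.
apply: dual_form_ext => //; first exact: coef_dual_form.
exists (K + l0)%N => // j /= Kj x ux.
have [l jE] : exists l, j = (K + l)%N by exists (j - K)%N; rewrite subnKC// (leq_trans (leq_addr _ _) Kj).
subst j; rewrite leq_add2l in Kj; have [s [t [tg sh ws]]] := near_h l Kj.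
have cE : germ (coef (pdlt g) (pdlt (pt s0))) 1 (th_unit s t).
  by rewrite -tg -sh; exact: coef_delta ws.1.
rewrite t0g; exact: (etrans (ws.2 x ux) (esym (cE.2 x ux))).
Qed.

End Thread.

(** The thread consists of the sources of the units carrying the form: a later unit is a part of an
    earlier one, so the source projections decrease. *)
Lemma thread_of_germs w : (\forall j \near \oo, exists e : idx j, germ w 1 e) ->
  exists c : thread L, forall l, exists s, germ w 1 (th_unit s (base c l)).
Proof.
move=> [K _ wK]; have wl l : exists e : idx (K + l), germ w 1 e by exact: wK (leq_addr _ _).
pose e l := projT1 (cid (wl l)).
have eP l : germ w 1 (e l) by exact: projT2 (cid (wl l)).
have below l l' : (l <= l')%N -> cs_mul L (diag_in L (munit_src (e l)))
    (diag_in L (munit_src (e l'))) = diag_in L (munit_src (e l')).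
  move=> ll'; apply: part_src.
  apply: (germ_part _ (oner_neq0 _) (eP l) (eP l')); by rewrite leq_add2l.
exists (Thread below) => l.
have [s es] := @to_unit_src R S L (Thread below) l (e l) erefl.
by exists s; rewrite -[th_unit _ _]/(to_unit s) -es.
Qed.

End Realization.

(** * Composition in the spectrum *)

Section SpecComposition.
Variables (R : realType) (S : taf_system R) (L : af_limit S).
Local Notation A := (taf L).
Local Notation idx j := (munit_index (@bsize R S j)).
Local Notation taf_unit := (@taf_unit R S L _).
Implicit Types (x y z w : Spec L).

Local Notation form w := (\val w : A -> R[i]).

Lemma Spec_dual w : dual_form (form w).
Proof. by have [] := set_valP w. Qed.

Lemma Spec_near w : \forall j \near \oo, exists e : idx j, germ (form w) 1 e.
Proof. by apply: Spec_germ; exact: set_valP. Qed.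

Definition form_Spec (f : A -> R[i]) (h : Spec L f) : Spec L := SigSub (mem_set h).

Lemma germ1_inj w j (e e' : idx j) : germ (form w) 1 e -> germ (form w) 1 e' -> e = e'.
Proof. exact: (germ_inj (oner_neq0 _)). Qed.

Lemma germ1_unit w j (e u : idx j) : germ (form w) 1 e -> munit_upper u ->
  form w (taf_unit u) = 1 -> e = u.
Proof.
move=> we uu; rewrite (germ_unit we uu) mul1r; case: eqP => // _ /esym/eqP.
by rewrite oner_eq0.
Qed.

Lemma germ1_ext x y : (\forall j \near \oo, exists e : idx j,
  germ (form x) 1 e /\ germ (form y) 1 e) -> x = y.
Proof.
move=> [K _ xy]; apply: val_inj.
apply: (dual_form_ext (Spec_dual x) (Spec_dual y)); exists K => // j /xy[e [xe ye]] a ua.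
by rewrite xe.2// ye.2.
Qed.

(** Read on the units carrying the forms, composability and the product no longer refer to a third
    element of the spectrum as common source and range. *)
Definition germ_composable x y := \forall j \near \oo, exists e1 e2 : idx j,
  [/\ munit_src e1 = munit_rng e2, germ (form x) 1 e1 & germ (form y) 1 e2].

Definition germ_composite x y z := \forall j \near \oo, exists e1 e2 : idx j,
  [/\ munit_src e1 = munit_rng e2, germ (form x) 1 e1, germ (form y) 1 e2
    & germ (form z) 1 (munit_comp e1 e2)].

(* The representation is the one attached to the orbit of the source of [y]. *)
Lemma Spec_realize x y : germ_composable x y -> exists (rho : representation L)
  (g h k : rep_space rho), [/\ nrep_star rho,
    [/\ lat_atom (line g), lat_atom (line h) & lat_atom (line k)],
    form x = coef h k, form y = coef g h &
    [/\ exists z : Spec L, form z = coef g k /\ germ_composite x y z &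
      exists s : Spec L, \forall j \near \oo, exists e1 e2 : idx j,
        [/\ munit_src e1 = munit_rng e2, germ (form x) 1 e1, germ (form y) 1 e2
          & germ (form s) 1 (munit_diag (munit_src e1))]]].
Proof.
move=> xy; have [c yc] := thread_of_germs (Spec_near y).
pose K := th_start c; pose b := pt (base c 0).
have [|h [yE ab ah ynear]] := @realize _ _ _ c _ b (Spec_dual y).
  by exists 0%N => // l _; have [s ys] := yc l; exists s, (base c l); split => //; exact: pt_base.
have shift (Q : nat -> Prop) : (\forall j \near \oo, Q j) -> \forall l \near \oo, Q (K + l)%N.
  by move=> [m _ mQ]; exists m => // l /= ml; apply: mQ => /=; exact: leq_trans ml (leq_addl _ _).
have unshift (Q : nat -> Prop) : (\forall l \near \oo, Q (K + l)%N) -> \forall j \near \oo, Q j.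
  move=> [m _ mQ]; exists (K + m)%N => // j /= mj.
  have Kj : (K <= j)%N := leq_trans (leq_addr _ _) mj.
  by rewrite -(subnKC Kj); apply: mQ; rewrite /= leq_subRL.
have both : \forall l \near \oo, exists s1 s t : 'I_(th_dim c l),
    [/\ pt t = b, pt s = h, germ (form x) 1 (th_unit s1 s) & germ (form y) 1 (th_unit s t)].
  apply: filterS (filterI ynear (shift _ xy)) => l.
  move=> [[s [t [tb sh ys]]] [e1 [e2 [e12 xe ye]]]].
  have e2E := germ1_inj ye ys; subst e2.
  have [s1 e1E] : exists s1, e1 = th_unit s1 s.
    case: e1 e12 xe => k [p q] e _; have kk : k = th_block c l := congr1 tag e.
    by subst k; exists p; exact: rng_src_inj.
  by exists s1, s, t; rewrite -e1E.
(* The source of [x] is the range [h] of [y], hence a point of the same orbit: both forms are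
   coefficients of one representation. *)
have [|k [xE _ ak xnear]] := @realize _ _ _ c _ h (Spec_dual x).
  by apply: filterS both => l [s1 [s [t [_ sh xs _]]]]; exists s1, s.
have all3 : \forall l \near \oo, exists s1 s t : 'I_(th_dim c l), [/\ pt t = b, pt s = h,
    pt s1 = k, germ (form x) 1 (th_unit s1 s) & germ (form y) 1 (th_unit s t)].
  apply: filterS (filterI both xnear) => l.
  move=> [[s1 [s [t [tb sh xs ys]]]] [s1' [s' [sh' sk' xs']]]].
  exists s1, s, t; split => //; rewrite -sk'; have /eqP := germ1_inj xs xs'.
  by rewrite eq_Tagged => /eqP[->].
have coefSpec (u v : L -> R[i]) : (\forall l \near \oo, exists s t : 'I_(th_dim c l),
    [/\ pt t = u, pt s = v & (s <= t)%N]) -> Spec L (coef (pdlt c u) (pdlt c v)).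
  move=> uv; apply: germ_Spec; first exact: coef_dual_form.
  apply: unshift; apply: filterS uv => l [s [t [<- <- st]]].
  by exists (th_unit s t); exact: coef_delta.
have compE l (s1 s t : 'I_(th_dim c l)) : munit_comp (th_unit s1 s) (th_unit s t) = th_unit s1 t.
  by apply: rng_src_inj => //; rewrite src_comp.
have zP : Spec L (coef (pdlt c b) (pdlt c k)).
  apply: coefSpec; apply: filterS all3 => l [s1 [s [t [tb sh sk [xs _] [ys _]]]]].
  by exists s1, t; split => //; exact: leq_trans xs ys.
(* The diagonal coefficient at [h] is the element of the spectrum that is both the source of [x] and
   the range of [y]. *)
have sP : Spec L (coef (pdlt c h) (pdlt c h)).
  by apply: coefSpec; apply: filterS all3 => l [s1 [s [t [tb sh _ _ _]]]]; exists s, s.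
exists (orbit_rep c), (pdlt c b), (pdlt c h), (pdlt c k); split => //.
  exact: orbit_rep_nrep.
split.
  exists (form_Spec zP); split; first exact: erefl.
  apply: unshift.
  apply: filterS all3 => l [s1 [s [t [tb sh sk xs ys]]]].
  have zg : germ (coef (pdlt c b) (pdlt c k)) 1 (th_unit s1 t).
    by rewrite -tb -sk; apply: coef_delta; exact: leq_trans xs.1 ys.1.
  exists (th_unit s1 s), (th_unit s t).
  by split; [exact: erefl|exact: xs|exact: ys|rewrite compE; exact: zg].
exists (form_Spec sP); apply: unshift.
apply: filterS all3 => l [s1 [s [t [tb sh sk xs ys]]]].
have sg : germ (coef (pdlt c h) (pdlt c h)) 1 (th_unit s s).
  by rewrite -sh; exact: coef_delta.
exists (th_unit s1 s), (th_unit s t).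
by split; [exact: erefl|exact: xs|exact: ys|exact: sg].
Qed.

Lemma Spec_composableP x y : composable (Spec_op L) x y <-> germ_composable x y.
Proof.
split=> [[s [xs ys]]|/Spec_realize[rho [g [h [k [_ _ _ _ [_ [s near_s]]]]]]]].
  apply: filterS (filterI (filterI xs ys)
    (filterI (Spec_near x) (filterI (Spec_near y) (Spec_near s)))) => j [[[_ [d1 [/munitsP[u uu ->] xu d1E sd1]]]]].
  move=> [_ [d2 [/munitsP[v vu ->] yv d2E sd2]]] [[e1 xe1] [[e2 ye2] [e3 se3]]].
  exists e1, e2; split => //.
  have e1u := germ1_unit xe1 uu xu; have e2v := germ1_unit ye2 vu yv; subst e1 e2.
  have d1d : d1 = taf_diag L (munit_src u).
    apply: val_inj; rewrite d1E !val_taf_unit ?upper_diag// -diag_inE.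
    by rewrite unit_star unit_adjl.
  have d2d : d2 = taf_diag L (munit_rng v).
    apply: val_inj; rewrite d2E !val_taf_unit ?upper_diag// -diag_inE.
    by rewrite unit_star unit_adjr.
  rewrite d1d in sd1; rewrite d2d in sd2.
  have := germ1_unit se3 (upper_diag _) sd1; rewrite (germ1_unit se3 (upper_diag _) sd2).
  by move=> /(congr1 (@munit_rng _ _)); rewrite !rng_diag.
exists s; split.
  apply: filterS near_s => j [e1 [e2 [e12 xe ye se]]].
  exists (taf_unit e1), (taf_diag L (munit_src e1)); split.
  - by apply/munitsP; exists e1 => //; exact: xe.1.
  - exact: germ_val xe.
  - by rewrite !val_taf_unit ?upper_diag ?xe.1// -diag_inE unit_star unit_adjl.
  - exact: germ_val se.
apply: filterS near_s => j [e1 [e2 [e12 xe ye se]]].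
exists (taf_unit e2), (taf_diag L (munit_src e1)); split.
- by apply/munitsP; exists e2 => //; exact: ye.1.
- exact: germ_val ye.
- by rewrite !val_taf_unit ?upper_diag ?ye.1// -diag_inE unit_star unit_adjr e12.
- exact: germ_val se.
Qed.

Lemma Spec_compositeP x y z : composite (Spec_op L) x y z <-> germ_composite x y z.
Proof.
split=> xyz.
  apply: filterS (filterI xyz
    (filterI (Spec_near x) (filterI (Spec_near y) (Spec_near z)))) => j [[_ [_ [/munitsP[u uu ->] /munitsP[v vu ->] xu yv zuv]]]].
  move=> [[e1 xe1] [[e2 ye2] [e3 ze3]]]; exists e1, e2.
  have e1u := germ1_unit xe1 uu xu; have e2v := germ1_unit ye2 vu yv; subst e1 e2.
  have [uv|uv] := eqVneq (munit_src u) (munit_rng v); last first.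
    move: zuv; rewrite taf_unit_mul0// (form0 (Spec_dual z).1) => /esym/eqP.
    by rewrite oner_eq0.
  split => //; move: zuv; rewrite taf_unit_mul// => zuv.
  by rewrite -(germ1_unit ze3 (upper_comp uv uu vu) zuv).
apply: filterS xyz => j [e1 [e2 [e12 xe ye ze]]].
exists (taf_unit e1), (taf_unit e2); split.
- by apply/munitsP; exists e1 => //; exact: xe.1.
- by apply/munitsP; exists e2 => //; exact: ye.1.
- exact: germ_val xe.
- exact: germ_val ye.
- by rewrite taf_unit_mul ?xe.1 ?ye.1//; exact: germ_val ze.
Qed.

Lemma germ_composite_exists x y : germ_composable x y -> exists z, germ_composite x y z.
Proof. by move=> /Spec_realize[rho [g [h [k [_ _ _ _ [[z [_ xyz]] _]]]]]]; exists z. Qed.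

Lemma germ_composite_uniq x y z z' : germ_composite x y z -> germ_composite x y z' -> z = z'.
Proof.
move=> xyz xyz'; apply: germ1_ext.
apply: filterS (filterI xyz xyz') => j [[e1 [e2 [e12 xe ye ze]]] [f1 [f2 [f12 xf yf zf]]]].
exists (munit_comp e1 e2); split => //.
by rewrite (germ1_inj xe xf) (germ1_inj ye yf).
Qed.

Lemma germ_composite_composable x y z : germ_composite x y z -> germ_composable x y.
Proof. by apply: filterS => j [e1 [e2 [e12 xe ye _]]]; exists e1, e2. Qed.

(* Outside of the composable pairs the value is irrelevant. *)
Definition spec_comp (p : Spec L * Spec L) : Spec L :=
  xget p.1 [set z | germ_composite p.1 p.2 z].

Lemma spec_compP x y : germ_composable x y -> germ_composite x y (spec_comp (x, y)).
Proof.
move=> xy; rewrite /spec_comp; case: xgetP => //= none.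
by have [z xyz] := germ_composite_exists xy; case: (none z).
Qed.

Lemma spec_comp_composableL x y z : germ_composable x y ->
  germ_composable (spec_comp (x, y)) z <-> germ_composable y z.
Proof.
move=> /spec_compP xyP; split=> h; apply: filterS (filterI xyP h) => j.
  move=> [[e1 [e2 [e12 xe ye ze]]] [f1 [f2 [f12 xf yf]]]].
  by exists e2, f2; split => //; rewrite -f12 -(germ1_inj ze xf) src_comp.
move=> [[e1 [e2 [e12 xe ye ze]]] [f1 [f2 [f12 xf yf]]]].
exists (munit_comp e1 e2), f2; split => //.
by rewrite src_comp// (germ1_inj ye xf).
Qed.

Lemma spec_comp_composableR x y z : germ_composable y z ->
  germ_composable x (spec_comp (y, z)) <-> germ_composable x y.
Proof.
move=> /spec_compP xyP; split=> h; apply: filterS (filterI xyP h) => j.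
  move=> [[e1 [e2 [e12 xe ye ze]]] [f1 [f2 [f12 xf yf]]]].
  by exists f1, e1; split => //; rewrite f12 -(germ1_inj ze yf) rng_comp.
move=> [[e1 [e2 [e12 xe ye ze]]] [f1 [f2 [f12 xf yf]]]].
exists f1, (munit_comp e1 e2); split => //.
by rewrite rng_comp f12 (germ1_inj xe yf).
Qed.

Lemma spec_compA x y z : germ_composable x y -> germ_composable y z ->
  spec_comp (spec_comp (x, y), z) = spec_comp (x, spec_comp (y, z)).
Proof.
move=> xy yz; have xyP := spec_compP xy; have yzP := spec_compP yz.
have lP := spec_compP ((spec_comp_composableL z xy).2 yz).
have rP := spec_compP ((spec_comp_composableR x yz).2 xy).
apply: germ1_ext; apply: filterS (filterI (filterI xyP yzP) (filterI lP rP)) => j.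
move=> [[[a1 [a2 [a12 xa ya xya]]] [b1 [b2 [b12 yb zb yzb]]]]].
move=> [[c1 [c2 [c12 xyc zc lc]]] [d1 [d2 [d12 xd yzd rd]]]].
exists (munit_comp c1 c2); split => //.
suff -> : munit_comp c1 c2 = munit_comp d1 d2 by [].
apply: rng_src_inj.
  by rewrite !rng_comp (germ1_inj xyc xya) rng_comp (germ1_inj xa xd).
by rewrite !src_comp// (germ1_inj zc zb) (germ1_inj yzd yzb) src_comp.
Qed.

End SpecComposition.

(** * The topology of the spectrum *)

Section SpecTopology.
Variables (R : realType) (S : taf_system R) (L : af_limit S).
Local Notation A := (taf L).
Local Notation idx j := (munit_index (@bsize R S j)).
Local Notation taf_unit := (@taf_unit R S L _).
Local Notation form w := (\val w : A -> R[i]).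
Implicit Types (x y z w : Spec L).

Lemma Spec_le w a : rnorm (form w a) <= rnorm (\val a).
Proof.
have := dual_form_le_fnorm a (Spec_dual w).
by have [_ -> _] := set_valP w; rewrite mul1r.
Qed.

Lemma Spec_unit01 w j (u : idx j) : munit_upper u ->
  form w (taf_unit u) = 0 \/ form w (taf_unit u) = 1.
Proof.
by move=> uu; have [_ _ w01] := set_valP w; apply: (w01 j); apply/munitsP; exists u.
Qed.

Lemma Spec_eval a : continuous (fun w => form w a : R[i]^o).
Proof.
move=> w; apply: (@continuous_comp _ _ _ (@set_val _ (Spec L)) (fun f => f a)).
  exact: initial_continuous.
exact: (@proj_continuous _ (fun _ : A => R[i]^o) a).
Qed.

Lemma Spec_cvg T (F : set_system T) (h : T -> Spec L) w : Filter F ->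
  (forall a, (fun t => form (h t) a : R[i]^o) @ F --> (form w a : R[i]^o)) -> h @ F --> w.
Proof.
move=> FF hw; suff vh : (fun t => \val (h t)) @ F --> (\val w : {ptws A -> R[i]^o}).
  move=> B [_ [[C oC <-] Cw CB]]; apply: filterS CB _.
  by apply: (vh C); apply: open_nbhs_nbhs.
apply/cvg_sup => a B [_ [[C oC <-] Cw CB]]; apply: filterS CB _.
by apply: (hw a C); apply: open_nbhs_nbhs.
Qed.

(** All the forms have norm 1, so agreement on the units of one level controls the values at every
    element close to that level. *)
Lemma Spec_cvg_units T (F : set_system T) (h : T -> Spec L) w : Filter F ->
  (forall j (u : idx j), munit_upper u ->
    \forall t \near F, form (h t) (taf_unit u) = form w (taf_unit u)) -> h @ F --> w.
Proof.
move=> FF hw; apply: Spec_cvg => a; apply/cvgrPdist_le => _ /complex_pos_real[r r0 ->].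
have [i [x [ux ax]]] := taf_dense a (divr_gt0 r0 (ltr0Sn R 1)).
set l := taf_in L x in ax.
have : \forall t \near F, forall u : idx i, munit_upper u ->
    form (h t) (taf_unit u) = form w (taf_unit u).
  apply: filter_forall => u; have [uu|ul] := boolP (munit_upper u).
    by apply: filterS (hw i u uu) => t e _.
  exact: nearW.
apply: filterS => t htw; rewrite normC_le.
have hl : form (h t) l = form w l.
  rewrite (form_taf_in (Spec_dual (h t)).1 ux) (form_taf_in (Spec_dual w).1 ux).
  by apply: eq_bigr => u uu; rewrite htw.
have bd (v : Spec L) : rnorm (form v (a - l)) <= r / 2.
  by apply: le_trans (Spec_le _ _) _; rewrite val_tafB.
have -> : form w a - form (h t) a = form w (a - l) - form (h t) (a - l).
  rewrite (formB (Spec_dual w).1) (formB (Spec_dual (h t)).1) hl.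
  by rewrite opprB addrA subrK.
by apply: le_trans (rnormD _ _) _; rewrite rnormN [leRHS]splitr lerD.
Qed.

(** The values are 0 or 1, so being closer than 1 means being equal. *)
Lemma Spec_near_unit w j (u : idx j) : munit_upper u ->
  \forall v \near w, form v (taf_unit u) = form w (taf_unit u).
Proof.
move=> uu; have := @Spec_eval (taf_unit u) w.
move/cvgrPdist_lt => /(_ 1 ltr01); apply: filterS => v.
case: (Spec_unit01 w uu) => ->; case: (Spec_unit01 v uu) => -> //.
  by rewrite sub0r normrN normr1 ltxx.
by rewrite subr0 normr1 ltxx.
Qed.

(** Two distinct diagonal projections of one level are orthogonal and cannot both lie above a
    non-zero projection. *)
Lemma part_uniq i j (u u' : idx i) (v : idx j) : part L u v -> part L u' v -> u = u'.
Proof.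
move=> uv u'v; apply: rng_src_inj; apply/eqP; apply: contraT => ne.
  have := diag_in_neq0 L (munit_rng v); rewrite -(part_rng uv) -(part_rng u'v).
  by rewrite cs_mulA diag_mul0// cs_mul0l eqxx.
have := diag_in_neq0 L (munit_src v); rewrite -(part_src uv) -(part_src u'v).
by rewrite cs_mulA diag_mul0// cs_mul0l eqxx.
Qed.

Lemma part_value w i j (u : idx i) (v : idx j) : (i <= j)%N -> munit_upper u ->
  part L u v -> germ (form w) 1 v -> form w (taf_unit u) = 1.
Proof.
move=> ij uu uv wv; have [y [uy yu yu']] := taf_lift L ij (munit_is_upper R uu).
rewrite taf_unitE -yu wv.2// mul1r (part_coord uv yu') coord_munit eqxx.
by [].
Qed.

(** Any unit of the level with value 1 has the unit carrying the form at a later level as a part,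
    and that part determines it. A single value thus fixes the form on the whole level. *)
Lemma germ_of_value w i (e : idx i) : munit_upper e -> form w (taf_unit e) = 1 ->
  germ (form w) 1 e.
Proof.
move=> ue we; have [K _ wK] := Spec_near w.
have [v wv] := wK _ (leq_maxr i K); have iK := leq_maxl i K.
have partv (u : idx i) : munit_upper u -> form w (taf_unit u) = 1 -> part L u v.
  move=> uu; have [V [upV pV wV]] := taf_unit_decompose L iK uu.
  rewrite (wV _ (Spec_dual w).1) => w1; apply: pV; apply: contraT => vV.
  move: w1; rewrite big1 => [/esym/eqP|x xV]; first by rewrite oner_eq0.
  rewrite (germ_unit wv (upV _ xV)); case: eqP => [vx|_]; last by rewrite mulr0.
  by rewrite vx xV in vV.
apply: germ_units => //; first exact: (Spec_dual w).1.
move=> u uu une; case: (Spec_unit01 w uu) => // wu; case/eqP: une.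
exact: part_uniq (partv _ uu wu) (partv _ ue we).
Qed.

(** The composite is described at large levels that depend on the pair. Going to a later level and
    back gives the description at any level where the two germs are known, which continuity
    requires. *)
Lemma composite_value x y z j (e1 e2 : idx j) : germ_composite x y z ->
  germ (form x) 1 e1 -> germ (form y) 1 e2 ->
  munit_src e1 = munit_rng e2 /\ germ (form z) 1 (munit_comp e1 e2).
Proof.
move=> [K _ xyz] xe ye; have [f1 [f2 [f12 xf yf zf]]] := xyz _ (leq_maxr j K).
have jK := leq_maxl j K; have o1 := oner_neq0 R[i].
have p1 := germ_part jK o1 xe xf; have p2 := germ_part jK o1 ye yf.
have e12 : munit_src e1 = munit_rng e2.
  apply/eqP; apply: contraT => ne; have := diag_in_neq0 L (munit_src f1).
  rewrite -(part_src p1) f12 -(part_rng p2) cs_mulA diag_mul0//.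
  by rewrite cs_mul0l eqxx.
have uc : munit_upper (munit_comp e1 e2) by apply: upper_comp; [|exact: xe.1|exact: ye.1].
split=> //; apply: germ_of_value => //; apply: part_value jK uc _ zf.
rewrite /part src_comp// -!unit_mul// -cs_mulA p2 -{1}(diag_unit L f2) cs_mulA -f12.
by rewrite p1.
Qed.

(** Taking the value 1 at two given units [e1] and [e2] is an open condition on the pair, and it
    fixes the composite on the whole level of these units. *)
Lemma spec_comp_continuous (D := [set p : Spec L * Spec L | composable (Spec_op L) p.1 p.2]) :
  {within D, continuous (@spec_comp R S L)}.
Proof.
apply/subspace_continuousP => -[x y] /Spec_composableP xy.
apply: Spec_cvg_units => i u uu; have xyz := spec_compP xy.
have [K _ xyK] := xyz; have [e1 [e2 [e12 xe ye ze]]] := xyK _ (leq_maxr i K).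
have near1 : \forall q \near (x, y), form q.1 (taf_unit e1) = form x (taf_unit e1).
  exact: (@cvg_fst _ _ (nbhs x) (nbhs y) _ _ (Spec_near_unit x xe.1)).
have near2 : \forall q \near (x, y), form q.2 (taf_unit e2) = form y (taf_unit e2).
  exact: (@cvg_snd _ _ (nbhs x) (nbhs y) _ _ (Spec_near_unit y ye.1)).
rewrite near_withinE; apply: filterS2 near1 near2 => -[x' y'] /= x'e y'e.
move=> /Spec_composableP/spec_compP xyz'.
rewrite (germ_val xe) in x'e; rewrite (germ_val ye) in y'e.
have [_ ze'] := composite_value xyz' (germ_of_value xe.1 x'e) (germ_of_value ye.1 y'e).
have [v [uv vu _]] := taf_lift L (leq_maxl i K) (munit_is_upper R uu).
by rewrite taf_unitE -vu ze'.2// ze.2.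
Qed.

End SpecTopology.

(** * From classes of forms to the spectrum *)

Section OmegaSpec.
Local Open Scope quotient_scope.
Variables (R : realType) (S : taf_system R) (L : af_limit S).
Local Notation A := (taf L).
Local Notation idx j := (munit_index (@bsize R S j)).
Local Notation taf_unit := (@taf_unit R S L _).
Local Notation form w := (\val w : A -> R[i]).

Lemma Omega_germ (w : A -> R[i]) : Omega L w -> dual_form w /\
  exists2 c, c != 0 & \forall j \near \oo, exists e : idx j, germ w c e.
Proof.
move=> [wn [rho [g [h [rn ag ah wE]]]]]; rewrite wE in wn *.
split; first exact: coef_dual_form.
have [c c0 wc] := coef_germ rn ag ah wn; exists c => //.
by apply: filterS wc => j [e [we _ _]]; exists e.
Qed.

Lemma Omega_scaled_Spec (w : A -> R[i]) : Omega L w ->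
  exists cs : R[i] * Spec L, cs.1 != 0 /\ forall a, w a = cs.1 * form cs.2 a.
Proof.
move=> /Omega_germ[dw [c c0 wc]].
have sP : Spec L (fun a => c^-1 * w a).
  apply: germ_Spec; first exact: dual_form_cst.
  apply: filterS wc => j [e we]; exists e; split; first exact: we.1.
  by move=> x ux; rewrite we.2// mulrA mulVf.
by exists (c, form_Spec sP); split => // a /=; rewrite mulrA mulfV// mul1r.
Qed.

Lemma Spec_Omega (s : Spec L) : Omega L (form s).
Proof.
have [c sc] := thread_of_germs (Spec_near s).
have [|h [sE ab ah _]] := @realize _ _ _ c _ (pt (base c 0)) (Spec_dual s).
  by exists 0%N => // l _; have [t st] := sc l; exists t, (base c l); split => //; exact: pt_base.
split; last by exists (orbit_rep c), (pdlt c (pt (base c 0))), (pdlt c h); split => //; exact: orbit_rep_nrep.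
have [K _ sK] := Spec_near s; have [e se] := sK _ (leqnn K).
by exists (taf_unit e); rewrite (germ_val se) oner_neq0.
Qed.

(** At a unit where the first form is 1 the second is 0 or 1, which forces the factor to be 1. So
    each class holds only one element of the spectrum. *)
Lemma Spec_scaled_eq (s t : Spec L) d : (forall a, form s a = d * form t a) -> s = t.
Proof.
move=> st; have [K _ sK] := Spec_near s; have [e se] := sK _ (leqnn K).
have d1 : d = 1.
  have := st (taf_unit e); rewrite (germ_val se).
  case: (Spec_unit01 t se.1) => ->; rewrite ?mulr0 ?mulr1 => // /eqP.
  by rewrite oner_eq0.
by apply/val_inj/funext => a; rewrite st d1 mul1r.
Qed.

Lemma germ_scaled (w : A -> R[i]) c d (s : Spec L) : c != 0 -> (forall a, w a = c * form s a) ->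
  d != 0 -> \forall j \near \oo, forall e : idx j, germ w d e -> germ (form s) 1 e.
Proof.
move=> c0 ws d0; apply: filterS (Spec_near s) => j [e' se'] e we.
suff -> : e = e' by [].
apply: (@germ_inj _ _ _ w d c) => //; split; first exact: se'.1.
by move=> x ux; rewrite ws se'.2// mul1r.
Qed.

Variable a : nat -> A.
Local Notation Q := (Omega_quot a).

Definition quot_Spec (p : Q) : Spec L :=
  (projT1 (cid (Omega_scaled_Spec (set_valP (repr p))))).2.

Lemma quot_SpecP (p : Q) : exists2 c, c != 0 &
  forall b, (\val (repr p) : A -> R[i]) b = c * form (quot_Spec p) b.
Proof. by case: (projT2 (cid (Omega_scaled_Spec (set_valP (repr p))))) => c0 ?; eexists; eauto. Qed.

(** Neither the representative nor the scalar chosen in [quot_Spec] matters. *)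
Lemma quot_Spec_pi (w : Omega L) c s : (forall b, (\val w : A -> R[i]) b = c * form s b) ->
  quot_Spec (\pi_Q w) = s.
Proof.
move=> ws; have [d d0 rs] := quot_SpecP (\pi_Q w).
have /eqmodP/asboolP[k k0 kw] : repr (\pi_Q w) = w %[mod Q] by rewrite reprK.
apply: (@Spec_scaled_eq _ _ (d^-1 * (k * c))) => b.
by rewrite -mulrA -mulrA -ws -kw rs mulrA mulVf// mul1r.
Qed.

Lemma quot_Spec_scale (w : Omega L) : exists2 c, c != 0 &
  forall b, (\val w : A -> R[i]) b = c * form (quot_Spec (\pi_Q w)) b.
Proof.
have [[c s] /= [c0 ws]] := Omega_scaled_Spec (set_valP w); exists c => // b.
by rewrite (quot_Spec_pi ws).
Qed.

Lemma quot_Spec_inj : injective quot_Spec.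
Proof.
move=> p q pq; rewrite -(reprK p) -(reprK q); apply/eqmodP/asboolP.
have [c c0 pc] := quot_SpecP p; have [d d0 qd] := quot_SpecP q.
exists (c / d); first by rewrite mulf_neq0 ?invr_eq0.
by move=> b; rewrite pc qd pq mulrA divfK.
Qed.

Definition Spec_quot (s : Spec L) : Q := \pi_Q (SigSub (mem_set (Spec_Omega s)) : Omega L).

Lemma Spec_quotK : cancel Spec_quot quot_Spec.
Proof. by move=> s; apply: (@quot_Spec_pi _ 1) => b; rewrite mul1r. Qed.

Lemma quot_SpecK : cancel quot_Spec Spec_quot.
Proof. by move=> p; apply: quot_Spec_inj; rewrite Spec_quotK. Qed.

Lemma quot_germ (w : Omega L) d : d != 0 -> \forall j \near \oo, forall e : idx j,
  germ (\val w : A -> R[i]) d e -> germ (form (quot_Spec (\pi_Q w))) 1 e.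
Proof. by move=> d0; have [c c0 ws] := quot_Spec_scale w; exact: germ_scaled c0 ws d0. Qed.

(** The point is that the product is not the zero form. *)
Lemma form_comp_Omega (w1 w2 w : A -> R[i]) :
  Omega L w1 -> Omega L w2 -> form_comp w1 w2 w -> Omega L w.
Proof.
move=> [n1 _] [n2 _] h; split; first by have [] := form_comp_germ h n1 n2.
by have [rho [g [k [g' [h' [rn [ag ak ag' _] _ _ [_ wE]]]]]]] := h; exists rho, g', k.
Qed.

Lemma form_comp_composite (w1 w2 w : Omega L) : form_comp (\val w1) (\val w2) (\val w) ->
  germ_composite (quot_Spec (\pi_Q w1)) (quot_Spec (\pi_Q w2)) (quot_Spec (\pi_Q w)).
Proof.
move=> h; have [n1 _] := set_valP w1; have [n2 _] := set_valP w2.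
have [_ [s _ [c1 [c2 [c [d [c10 c20 c0 _ hnear]]]]]]] := form_comp_germ h n1 n2.
apply: filterS (filterI hnear (filterI (quot_germ w1 c10)
  (filterI (quot_germ w2 c20) (quot_germ w c0)))) => j.
move=> [[e1 [e2 [e12 g1 g2 g _]]] [h1 [h2 h3]]]; exists e1, e2.
by split; [exact: e12|exact: h1|exact: h2|exact: h3].
Qed.

Lemma quot_composableP p q : composable (Omega_op a) p q <->
  germ_composable (quot_Spec p) (quot_Spec q).
Proof.
split=> [[w1 [w2 [w [<- <- h]]]]|].
  have [Ow1 Ow2] := (set_valP w1, set_valP w2).
  have Ow := form_comp_Omega Ow1 Ow2 h.
  exact: germ_composite_composable (@form_comp_composite w1 w2 (SigSub (mem_set Ow)) h).
move=> /Spec_realize[rho [g [h [k [rn [ag ah ak] pE qE _]]]]].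
(* Elements of the spectrum are themselves forms in [Omega L], and those two are composable
   representatives because they were realized in one representation. *)
exists (SigSub (mem_set (Spec_Omega (quot_Spec p)))), (SigSub (mem_set (Spec_Omega (quot_Spec q)))).
exists (coef g k); split; [exact: quot_SpecK|exact: quot_SpecK|].
by exists rho, h, k, g, h; split.
Qed.

Lemma quot_compositeP p q r : composite (Omega_op a) p q r <->
  germ_composite (quot_Spec p) (quot_Spec q) (quot_Spec r).
Proof.
split=> [[w1 [w2 [w [<- <- <- h]]]]|pqr]; first exact: form_comp_composite.
have /Spec_realize[rho [g [h [k [rn [ag ah ak] pE qE [[z [zE pqz]] _]]]]]] :=
  germ_composite_composable pqr.
have rz := germ_composite_uniq pqr pqz.
exists (SigSub (mem_set (Spec_Omega (quot_Spec p)))), (SigSub (mem_set (Spec_Omega (quot_Spec q)))).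
exists (SigSub (mem_set (Spec_Omega (quot_Spec r)))).
split; [exact: quot_SpecK|exact: quot_SpecK|exact: quot_SpecK|].
exists rho, h, k, g, h; split => //; split => //.
by rewrite -zE -rz.
Qed.

(** A representative is a scalar times an element of the spectrum, and its norm is the modulus of
    this scalar. *)
Lemma Omega_distE (p q : Q) : Omega_dist p q = (\sum_(0 <= n <oo) (2^-1 ^+ n.+1 *
  `|rnorm (form (quot_Spec p) (a n)) - rnorm (form (quot_Spec q) (a n))|)%:E)%E.
Proof.
have quot (u : Q) n : rnorm ((\val (repr u) : A -> R[i]) (a n)) / fnorm (\val (repr u)) =
    rnorm (form (quot_Spec u) (a n)).
  have [c c0 uc] := quot_SpecP u.
  have dr : dual_form (\val (repr u) : A -> R[i]) := (Omega_germ (set_valP (repr u))).1.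
  have -> : fnorm (\val (repr u)) = rnorm c.
    apply: (fnorm_germ dr); apply: filterS (Spec_near (quot_Spec u)) => j [e ue].
    exists e; split; first exact: ue.1.
    by move=> x ux; rewrite uc ue.2// mul1r.
  rewrite uc rnormM mulrAC divff ?mul1r//.
  by apply: contra_neq c0 => c0; apply: rnorm_eq0; rewrite c0.
by apply: eq_eseriesr => n _; rewrite !quot.
Qed.

Hypothesis a_dense : taf_set L `<=` closure (range (fun n => taf_val (a n))).
Hypothesis a_summable :
  (\sum_(0 <= n <oo) (2^-1 ^+ n.+1 * rnorm (taf_val (a n)))%:E < +oo)%E.

Let rnorm_dist (V : normedZmodType R[i]) (x y : V) : `|rnorm x - rnorm y| <= rnorm (x - y).
Proof.
rewrite ler_norml; apply/andP; split.
  by rewrite lerNl opprB lerBlDr rnormBC -{1}(subrK x y) rnormD.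
by rewrite lerBlDr -{1}(subrK y x) rnormD.
Qed.

Let wgt n : 0 < 2^-1 ^+ n.+1 :> R. Proof. by rewrite exprn_gt0// invr_gt0. Qed.

Lemma quot_Spec_continuous : continuous quot_Spec.
Proof.
move=> p; apply: (Spec_cvg_units (nbhs_filter p)) => j u uu.
have e8 : 0 < 8^-1 :> R by rewrite invr_gt0.
have [n un] : exists n, rnorm (\val (taf_unit u) - \val (a n)) <= 8^-1.
  have : taf_set L (\val (taf_unit u)) by apply/asboolP; exact: (valP (taf_unit u)).
  by move=> /a_dense/closure_normP/(_ _ e8)[_ [n _ <-] un]; exists n.
(* A ball of this radius leaves less than 1/4 at [a n]. With the error 1/8 on each side, the moduli
   at the unit differ by less than 1; as both are 0 or 1, they are equal, and so are the values. *)
have r0 : 0 < 2^-1 ^+ n.+1 / 4 :> R by rewrite divr_gt0.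
apply: filterS (nbhsx_ballx p _ r0) => q.
rewrite /ball /= /Omega_ball/= Omega_distE => pq.
have {}pq : `|rnorm (form (quot_Spec p) (a n)) - rnorm (form (quot_Spec q) (a n))| < 4^-1.
  rewrite -(ltr_pM2l (wgt n)) -lte_fin; apply: le_lt_trans pq.
  have t0 k : (0 <= k)%N -> xpredT k -> (0 <= (2^-1 ^+ k.+1 *
      `|rnorm (form (quot_Spec p) (a k)) - rnorm (form (quot_Spec q) (a k))|)%:E)%E.
    by move=> _ _; rewrite lee_fin mulr_ge0// ltW.
  apply: le_trans (nneseries_lim_ge n.+1 t0).
  by rewrite big_nat_recr//= leeDr// sumEFin lee_fin sumr_ge0.
have close (s : Spec L) : `|rnorm (form s (taf_unit u)) - rnorm (form s (a n))| <= 8^-1.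
  have sB : rnorm (form s (taf_unit u) - form s (a n)) <= 8^-1.
    rewrite -(formB (Spec_dual s).1); apply: le_trans (Spec_le _ _) _.
    by rewrite val_tafB.
  exact: le_trans (rnorm_dist _ _) sB.
have : `|rnorm (form (quot_Spec p) (taf_unit u)) - rnorm (form (quot_Spec q) (taf_unit u))| < 1.
  apply: le_lt_trans (ler_distD (rnorm (form (quot_Spec p) (a n))) _ _) _.
  apply: (@le_lt_trans _ _ (8^-1 + (4^-1 + 8^-1))); last by lra.
  rewrite lerD//; apply: le_trans (ler_distD (rnorm (form (quot_Spec q) (a n))) _ _) _.
  by rewrite lerD ?(ltW pq)// distrC.
rewrite -[LHS]/(form (quot_Spec q) (taf_unit u)) -[RHS]/(form (quot_Spec p) (taf_unit u)).
case: (Spec_unit01 (quot_Spec p) uu) => ->; case: (Spec_unit01 (quot_Spec q) uu) => -> //.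
  by rewrite rnorm0 rnorm1 sub0r normrN normr1 ltxx.
by rewrite rnorm0 rnorm1 subr0 normr1 ltxx.
Qed.

Lemma Spec_quot_continuous : continuous Spec_quot.
Proof.
move=> s; apply/(@cvg_ballP R Q _ _ (nbhs_filter s)) => e e0.
have e2 : 0 < e / 2 by rewrite divr_gt0.
have an0 n : xpredT n -> (0 <= (2^-1 ^+ n.+1 * rnorm (taf_val (a n)))%:E)%E.
  by move=> _; rewrite lee_fin mulr_ge0 ?rnorm_ge0// ltW.
(* The terms of the distance are dominated by those of this convergent series, uniformly on the
   spectrum, so only finitely many elements [a n] need to be controlled by the topology. *)
have [N tailN] : exists N, (\sum_(N <= n <oo) (2^-1 ^+ n.+1 * rnorm (taf_val (a n)))%:E <
    (e / 2)%:E)%E.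
  have := nneseries_tail_cvg a_summable an0.
  move=> /(_ [set x | (x < (e / 2)%:E)%E])[|N _ tailN].
    by apply: open_ereal_lt'; rewrite lte_fin.
  by exists N; exact: (tailN _ (leqnn N)).
(* [N] terms of size at most [del] add up to at most e / 2; the successor keeps the divisor positive
   for N = 0. *)
pose del := e / (2 * N.+1%:R); have del0 : 0 < del by rewrite divr_gt0// mulr_gt0// ltr0Sn.
have : \forall t \near s, forall n : 'I_N,
    `|rnorm (form s (a n)) - rnorm (form t (a n))| <= del.
  apply: (@filter_forall _ _ _ _ (nbhs_filter s)) => n; have := @Spec_eval _ _ _ (a n) s.
  move/cvgrPdist_le => /(_ del%:C); rewrite ltcR => /(_ del0); apply: filterS => t.
  rewrite normC_le => st; apply: le_trans st.
  exact: rnorm_dist.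
apply: (@filterS _ _ (nbhs_filter s)) => t st; rewrite /ball/= /Omega_ball/= Omega_distE !Spec_quotK.
rewrite (nneseries_split 0 N); last by move=> k _; rewrite lee_fin mulr_ge0// ltW.
rewrite add0n [e]splitr EFinD; apply: lee_ltD => //.
- by rewrite sumEFin.
- rewrite big_mkord sumEFin lee_fin.
  apply: (@le_trans _ _ (\sum_(n < N) del)).
    apply: ler_sum => n _; rewrite -[leRHS]mul1r ler_pM ?(ltW (wgt _))//.
    by rewrite exprn_ile1// ?invr_ge0// invf_le1// ler1n.
  rewrite sumr_const card_ord -[leLHS]mulr_natr /del.
  rewrite invfM mulrA -mulrA ler_piMr ?(ltW e2)//.
  by rewrite ler_pdivrMl ?ltr0Sn// mulr1 ler_nat.
apply: le_lt_trans tailN; apply: lee_nneseries => [n _ _|n _].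
  by rewrite lee_fin mulr_ge0// ltW.
(* Both moduli lie between 0 and the norm of [a n], so their difference is bounded by this norm
   without a factor 2. *)
rewrite lee_fin ler_wpM2l ?(ltW (wgt _))// ler_norml; apply/andP; split.
  by rewrite lerNl opprB lerBlDr (le_trans (Spec_le _ _))// lerDl rnorm_ge0.
by rewrite lerBlDr (le_trans (Spec_le _ _))// lerDl rnorm_ge0.
Qed.

Definition quot_comp (p : Q * Q) : Q := Spec_quot (spec_comp (quot_Spec p.1, quot_Spec p.2)).

Lemma quot_comp_continuous :
  {within [set p | composable (Omega_op a) p.1 p.2], continuous quot_comp}.
Proof.
apply/subspace_continuousP => -[p q] pq.
pose f (u : Q * Q) := (quot_Spec u.1, quot_Spec u.2).
have fpq : f @ nbhs (p, q) --> nbhs (f (p, q)).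
  move=> B [[B1 B2] [/= b1 b2] B12]; exists (quot_Spec @^-1` B1, quot_Spec @^-1` B2).
    by split; exact: quot_Spec_continuous.
  by move=> [u v] /= [u1 v2]; exact: (B12 (_, _)).
have cpq : composable (Spec_op L) (f (p, q)).1 (f (p, q)).2.
  by apply/Spec_composableP; move/quot_composableP : pq.
move=> B /(@Spec_quot_continuous (spec_comp (f (p, q)))) B1.
have /subspace_continuousP/(_ _ cpq)/(_ _ B1)/fpq := @spec_comp_continuous _ _ L.
apply: (@filterS _ _ (nbhs_filter (p, q))) => u Bu /quot_composableP fu; apply: Bu.
exact/Spec_composableP.
Qed.

Lemma Omega_topological_semigroupoid : topological_semigroupoid (Omega_op a).
Proof.
exists quot_comp; split; last exact: quot_comp_continuous.
- move=> p q /quot_composableP/spec_compP pq r; split=> [/quot_compositeP pqr|->].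
    by apply: quot_Spec_inj; rewrite Spec_quotK; exact: germ_composite_uniq pqr pq.
  by apply/quot_compositeP; rewrite Spec_quotK.
- move=> p q r /quot_composableP pq /quot_composableP qr; split.
  + by apply/quot_composableP; rewrite Spec_quotK; apply/spec_comp_composableL.
  + by apply/quot_composableP; rewrite Spec_quotK; apply/spec_comp_composableR.
  + by rewrite /quot_comp/= !Spec_quotK spec_compA.
- move=> p q r /quot_composableP pq /quot_composableP; rewrite Spec_quotK.
  by move/(spec_comp_composableL _ pq) => qr; apply/quot_composableP.
- move=> p q r /quot_composableP qr /quot_composableP; rewrite Spec_quotK.
  by move/(spec_comp_composableR _ qr) => pq; apply/quot_composableP.
Qed.

Lemma quot_Spec_isomorphism : semigroupoid_isomorphism (Omega_op a) (Spec_op L) quot_Spec.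
Proof.
split.
- exists Spec_quot; split; [exact: quot_SpecK|exact: Spec_quotK|..].
    exact: quot_Spec_continuous.
  exact: Spec_quot_continuous.
- by move=> p q; rewrite quot_composableP Spec_composableP.
- by move=> p q r _; rewrite quot_compositeP Spec_compositeP.
Qed.

End OmegaSpec.

Theorem theorem4p5 (R : realType) (S : taf_system R) (L : af_limit S)
    (a : nat -> taf L)
    (a_dense : taf_set L `<=` closure (range (fun n => taf_val (a n))))
    (a_summable :
      (\sum_(0 <= n <oo) (2^-1 ^+ n.+1 * rnorm (taf_val (a n)))%:E < +oo)%E) :
  [/\ forall w1 w2 w : taf L -> R[i],
        Omega L w1 -> Omega L w2 -> form_comp w1 w2 w -> Omega L w,
      topological_semigroupoid (Omega_op a)
    & exists f : Omega_quot a -> Spec L,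
        semigroupoid_isomorphism (Omega_op a) (Spec_op L) f].
Proof.
split; first exact: form_comp_Omega.
  exact: Omega_topological_semigroupoid.
by exists (@quot_Spec R S L a); exact: quot_Spec_isomorphism.
Qed.
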